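(* Let $m$ be a locally finite nonnegative Borel measure on $\mathbb{R}$ such that $\operatorname{supp} m\cap(-\infty,-b]\neq\emptyset$ and $\operatorname{supp} m\cap[b,\infty)\neq\emptyset$ for all $b>0$, let $\Psi$ be the convex function associated with $m$, and let $g:\mathbb{R}\to\mathbb{R}$ be continuous with $g(x)=o(\Psi(x))$ as $|x|\to\infty$. Let $U:\mathbb{R}\times[0,\infty)\to\mathbb{R}$ be the unique continuous function such that $U(x,t)=o(\Psi(x))$ as $|x|\to\infty$ locally uniformly in $t$, $2mU_t=U_{xx}$ in the sense of distributions on $\mathbb{R}\times(0,\infty)$, and $U(x,0)=\overline g(x)$. Then the distribution $U_{xx}$ is a measure on $\mathbb{R}\times(0,\infty)$ that is absolutely continuous with respect to $m\times\lambda$, where $\lambda$ is Lebesgue measure on $(0,\infty)$. Moreover, for each fixed $t>0$, the distribution $U_{xx}(\cdot,t)$ is a measure on $\mathbb{R}$ that is absolutely continuous with respect to $m$.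
   Context: ''Measure'' here means a locally finite signed measure, identified with the distribution it defines. For fixed $t$, $U_{xx}(\cdot,t)$ is the second distributional derivative of $x\mapsto U(x,t)$ on $\mathbb{R}$. Function $\Psi$: define $\Phi(x):=2\int_{[0,x)}y\,m(dy)$ for $x\ge 0$, $\Phi(x):=2\int_{[x,0)}y\,m(dy)$ for $x<0$, and $\Psi(x):=\int_0^x\Phi(y)\,dy$. Function $\overline g$: the continuous function that agrees with $g$ on $\operatorname{supp} m$ and is affine on each connected component of $\mathbb{R}\setminus\operatorname{supp} m$. Distributional equation: $2mU_t=U_{xx}$ means $$-2\iint U\varphi_t\,m(dx)\,dt=\iint U\varphi_{xx}\,dx\,dt\quad\text{for all }\varphi\in C_c^\infty(\mathbb{R}\times(0,\infty)).$$ Such a $U$ exists, is unique, and is given by $U(x,t)=\mathbb{E}\,g(X^x_t)$, where $X^x$ is the generalized diffusion with speed measure $m$ started at $x$: with $B$ a standard Brownian motion, $B_0=0$, with local time $L^y_u$ (jointly continuous occupation density with respect to Lebesgue measure), $\Gamma^x_u:=\int_{\mathbb{R}}L^{y-x}_u\,m(dy)$, $A^x_t:=\inf\{u:\Gamma^x_u>t\}$, $X^x_t:=x+B_{A^x_t}$. *)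

(* Defs.v *)
From HB Require Import structures.
From mathcomp Require Import all_boot all_order all_algebra.
From mathcomp Require Import all_classical all_reals all_analysis.
Import Order.TTheory GRing.Theory Num.Theory.
Import numFieldNormedType.Exports.

Set Implicit Arguments.
Unset Strict Implicit.
Unset Printing Implicit Defensive.

Local Open Scope classical_set_scope.
Local Open Scope ring_scope.

Definition locally_finite (R : realType) (T : topologicalType) (D : set T)
    (mu : set T -> \bar R) : Prop :=
  forall x, D x -> exists2 A, open_nbhs x A & (mu A < +oo)%E.

Definition msupp (R : realType) (T : topologicalType) (mu : set T -> \bar R) :
    set T :=
  [set x | forall A, open_nbhs x A -> (0 < mu A)%E].

(* A signed measure that need not be finite, so that it is not a set function
   on all measurable sets (a set may have infinite positive and negative
   parts): it is given by its Jordan decomposition, i.e. by two nonnegative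
   mutually singular measures. *)
Record signed_measure d (T : measurableType d) (R : realType) := SignedMeasure {
  spos : {measure set T -> \bar R} ;
  sneg : {measure set T -> \bar R} ;
  spos_sneg_singular :
    exists2 P : set T, measurable P & spos (~` P) = 0%E /\ sneg P = 0%E }.

Section signed_measure_ops.
Context d (T : measurableType d) (R : realType).
Variable nu : signed_measure T R.

(* The total variation of nu. *)
Definition var_measure (A : set T) : \bar R := (spos nu A + sneg nu A)%E.

Definition signed_Rintegral (phi : T -> R) : R :=
  \int[spos nu]_(x in setT) phi x - \int[sneg nu]_(x in setT) phi x.

End signed_measure_ops.

Section test_functions.
Context (R : realType) (V : normedModType R).

Definition iter_derive (f : V -> R) (s : seq V) : V -> R :=
  foldr (fun v h => 'D_v h) f s.

(* For finite-dimensional V this is the usual notion of a C^oo function. *)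
Definition smooth (f : V -> R) : Prop :=
  forall s : seq V, continuous (iter_derive f s) /\
    forall x v, derivable (iter_derive f s) x v.

(* phi represents an element of C_c^oo(D), extended by 0 outside D. *)
Definition test_function (D : set V) (phi : V -> R) : Prop :=
  smooth phi /\
  exists K : set V, [/\ compact K, K `<=` D & forall x, ~ K x -> phi x = 0].

End test_functions.

Section speed_measure.
Context (R : realType) (m : {measure set R -> \bar R}).

Definition Phi (x : R) : R :=
  if 0 <= x then 2 * \int[m]_(y in `[0, x[) y else 2 * \int[m]_(y in `[x, 0[) y.

(* The oriented integral of Phi from 0 to x. *)
Definition Psi (x : R) : R :=
  if 0 <= x then \int[lebesgue_measure]_(y in `[0, x]) Phi y
  else - \int[lebesgue_measure]_(y in `[x, 0]) Phi y.

Definition affine_interpolation (g h : R -> R) : Prop :=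
  [/\ continuous h,
      forall x, msupp m x -> h x = g x &
      forall x, ~ msupp m x -> exists a b : R,
        forall y, connected_component (~` msupp m) x y -> h y = a * y + b].

End speed_measure.

(* g(x) = o(h(x)) as |x| -> oo; this unfolds the two instances of "=o_" at
   +oo and -oo, which have no canonical filter structure for that notation. *)
Definition littleo_infty (R : realType) (g h : R -> R) : Prop :=
  forall eps : R, 0 < eps ->
    (\forall x \near +oo, `|g x| <= eps * `|h x|) /\
    (\forall x \near -oo, `|g x| <= eps * `|h x|).

Section space_time.
Context (R : realType).

(* Points of space-time are pairs (x, t). *)
Definition open_upper : set (R * R) := [set: R] `*` `]0, +oo[.
Definition closed_upper : set (R * R) := [set: R] `*` `[0, +oo[.

Definition ddx (f : R * R -> R) : R * R -> R := 'D_((1, 0) : R * R) f.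
Definition ddt (f : R * R -> R) : R * R -> R := 'D_((0, 1) : R * R) f.

Definition lebesgue_pos : set R -> \bar R :=
  mrestr lebesgue_measure (measurable_itv `]0 : R, +oo[).

(* 2 m U_t = U_xx in the sense of distributions on R x (0, oo). *)
Definition distributional_solution (m : {measure set R -> \bar R})
    (U : R * R -> R) : Prop :=
  forall phi, test_function open_upper phi ->
    - 2 * \int[(m \x lebesgue_measure)%E]_(p in open_upper) (U p * ddt phi p) =
    \int[(lebesgue_measure \x lebesgue_measure)%E]_(p in open_upper)
      (U p * ddx (ddx phi) p).

(* U(x, t) = o(h(x)) as |x| -> oo, locally uniformly in t >= 0. *)
Definition littleo_locally_uniformly (U : R * R -> R) (h : R -> R) : Prop :=
  forall T eps : R, 0 < eps ->
    (\forall x \near +oo, forall t, 0 <= t <= T ->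
       `|U (x, t)| <= eps * `|h x|) /\
    (\forall x \near -oo, forall t, 0 <= t <= T ->
       `|U (x, t)| <= eps * `|h x|).

End space_time.

(* Main.v *)
From HB Require Import structures.
Require Import Defs.
From mathcomp Require Import all_boot all_order all_algebra.
From mathcomp Require Import all_classical all_reals all_analysis.
From mathcomp Require Import measurable_realfun ring lra zify.
Import Order.TTheory GRing.Theory Num.Theory.
Import numFieldNormedType.Exports.

Set Implicit Arguments.
Unset Strict Implicit.
Unset Printing Implicit Defensive.

Local Open Scope classical_set_scope.
Local Open Scope ring_scope.

(* U_t turns out to be a continuous function on R x (0, oo), whence
   U_xx = 2 U_t (m x lambda) and U_xx(., t) = 2 U_t(., t) m.

   Mollified tensor products as test functions turn the equation into the exact
   identity, for 0 < t1 <= t2,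
     int_t1^t2 (U(x+d,s) - 2 U(x,s) + U(x-d,s)) ds
       = 2 int (d - |y-x|)^+ (U(y,t2) - U(y,t1)) m(dy).
   For time averages of U this is, on a grid of mesh d, a semi-discrete heat
   equation with masses m_j and a defect that vanishes with d.  A Caccioppoli
   estimate and an estimate of the time derivative, weighted by the masses, bound
   the L^2 norm in time of an increment of length h by O(sqrt h) times local L^2
   norms, at grid points that carry mass.  Since the local L^2 norms in time are
   almost convex in x, the bound holds between any two regions that carry mass,
   hence everywhere, as supp m is unbounded in both directions.  Three such gains
   and a Marchaud inequality bound the L^2 norm of the time derivative; for
   increments of time averages this makes the difference quotients of U in time
   uniformly Hoelder continuous of order 1/2, so they converge locally
   uniformly. *)

(** The obstacle is that [m] is arbitrary: it may have atoms, gaps or a singular part, and a priori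
    [U_t] is only a distribution. Testing with a time derivative gives information only where there
    is mass. Elsewhere a solution [w] is affine in [x], so that the integral of [w^2] in time is
    convex in [x]; this carries bounds across the gaps. One gain has order 1/2 for the following
    reason. Let [z] be the integral of [w] over [[t, t + h]]. Caccioppoli makes the integral of
    [z_x^2] of order [h^2]. Testing [2 m z_t = z_xx] with [z_t] bounds the integral of [m z_t^2] by
    that energy, through the cutoff in time, and by the commutator [z_x z_t] with the cutoff in
    space, of order [h]. Now [z_t] is the increment of [w]. Two gains would give the critical order
    1; three give order 3/2, and the sum over dyadic steps in the Marchaud inequality converges.
    Time averages of [U] have a continuous time derivative. Its modulus of continuity only makes the
    defect on the grid vanish with the mesh, so the final constants depend neither on it nor on the
    length of averaging. *)

(** * Continuous functions and their integrals *)

(* A record, so that [done] does not unfold the notion of continuity. *)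
Record cts {R : realType} {T : topologicalType} (f : T -> R) : Prop :=
  Cts { ctsP : continuous f }.

Section ContinuousAlgebra.
Context {R : realType} {T : topologicalType}.
Implicit Types f g : T -> R.

Lemma contD f g : cts f -> cts g -> cts (fun t => f t + g t).
Proof. by move=> [cf] [cg]; split=> t; apply: cvgD; [exact: cf|exact: cg]. Qed.

Lemma contN f : cts f -> cts (fun t => - f t).
Proof. by move=> [cf]; split=> t; apply: cvgN; exact: cf. Qed.

Lemma contM f g : cts f -> cts g -> cts (fun t => f t * g t).
Proof. by move=> [cf] [cg]; split=> t; apply: cvgM; [exact: cf|exact: cg]. Qed.

Lemma cont_cst (c : R) : cts (fun _ : T => c).
Proof. by split=> t; exact: cvg_cst. Qed.

Lemma contX f n : cts f -> cts (fun t => f t ^+ n).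
Proof.
move=> cf; elim: n => [|n IH].
  by rewrite (_ : (fun _ => _) = fun=> 1)//; exact: cont_cst.
rewrite (_ : (fun _ => _) = fun t => f t * f t ^+ n); first exact: contM.
by apply/funext => t; rewrite exprS.
Qed.

Lemma contabs f : cts f -> cts (fun t => `|f t|).
Proof.
move=> [cf]; split=> t; apply: (@continuous_comp _ _ _ f (@Num.norm R R)).
  exact: cf.
exact: norm_continuous.
Qed.

Lemma contmax f g : cts f -> cts g -> cts (fun t => Num.max (f t) (g t)).
Proof.
move=> cf cg.
have -> : (fun t => Num.max (f t) (g t)) =
          (fun t => (f t + g t + `|f t - g t|) * 2^-1).
  by apply/funext => t; rewrite maxr_absE.
apply: contM; last exact: cont_cst.
apply: contD; first exact: contD.
by apply: contabs; apply: contD => //; exact: contN.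
Qed.

Lemma cont_sum (I : Type) (r : seq I) (P : pred I) (F : I -> T -> R) :
  (forall i, cts (F i)) -> cts (fun t => \sum_(i <- r | P i) F i t).
Proof.
move=> cF; elim: r => [|i r IH].
  rewrite (_ : (fun _ => _) = fun=> 0); first exact: cont_cst.
  by apply/funext => t; rewrite big_nil.
rewrite (_ : (fun _ => _) = fun t => (if P i then F i t else 0) +
    \sum_(i <- r | P i) F i t); last first.
  by apply/funext => t; rewrite big_cons; case: (P i); rewrite ?add0r.
by apply: contD => //; case: (P i) => //; exact: cont_cst.
Qed.

Lemma cont_comp {S : topologicalType} (h : S -> T) f :
  continuous h -> cts f -> cts (fun s => f (h s)).
Proof.
move=> ch [cf]; split=> s; apply: (@continuous_comp _ _ _ h f).
  exact: ch.
exact: cf.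
Qed.
End ContinuousAlgebra.

Lemma cont_id {R : realType} : cts (fun t : R => t).
Proof. by split=> t; exact: cvg_id. Qed.

Lemma cont_fst {R : realType} {U : topologicalType} : cts (fun p : R * U => p.1).
Proof. by split=> t; exact: cvg_fst. Qed.

Lemma cont_snd {R : realType} {T : topologicalType} : cts (fun p : T * R => p.2).
Proof. by split=> t; exact: cvg_snd. Qed.

Lemma cont_comp1 {R : realType} {S : topologicalType} (h : S -> R) (f : R -> R) :
  cts h -> cts f -> cts (fun s => f (h s)).
Proof. by move=> [ch]; exact: cont_comp. Qed.

Lemma continuous_pair {T U V : topologicalType} (f : T -> U) (g : T -> V) :
  continuous f -> continuous g -> continuous (fun t => (f t, g t)).
Proof. by move=> cf cg t; apply: cvg_pair; [exact: cf|exact: cg]. Qed.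

Lemma cont_comp2 {R : realType} {S : topologicalType} (h k : S -> R) (f : R -> R -> R) :
  cts h -> cts k -> cts (fun p => f p.1 p.2) -> cts (fun s => f (h s) (k s)).
Proof.
move=> [ch] [ck] cf.
apply: (@cont_comp _ (R * R)%type _ (fun s => (h s, k s)) (fun p => f p.1 p.2)) => //.
exact: continuous_pair.
Qed.

Lemma is_derive_cont {R : realType} (f f' : R -> R) :
  (forall t : R, is_derive t 1 f (f' t)) -> cts f.
Proof.
move=> df; split=> t.
by apply/differentiable_continuous/derivable1_diffP; have := df t => -[].
Qed.

(** Continuity by structure. The [match] specialises the continuity of a family, or the joint
    continuity of a function of two variables, to compositions and slices; a joint hypothesis is
    found only when stated with [p.1] and [p.2]. *)
Ltac cont := repeat first [ assumption | exact: cont_cst | exact: cont_id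
  | exact: cont_fst | exact: cont_snd
  | (match goal with
     | H : forall i, cts (?F i) |- cts (?F _) => exact: H
     | H : forall i, cts (?F i) |- cts (fun t => ?F ?i t) => exact: (H i)
     | H : forall i, cts (?F i) |- cts (fun t => ?F ?i (@?h t)) => 
       apply: (@cont_comp1 _ _ h (F i)) 
     | H : cts (fun p => ?f p.1 p.2) |- cts (fun t => ?f (@?h t) (@?k t)) =>
       apply: (@cont_comp2 _ _ h k f)
     | H : cts (fun p => ?f p.1 p.2) |- cts (?f ?h) =>
       apply: (@cont_comp2 _ _ (fun=> h) id f)
     | H : cts ?f |- cts (fun t => ?f (@?h t)) => apply: (@cont_comp1 _ _ h f)
     end)
  | apply: contD | apply: contN | apply: contM | apply: contX | apply: contabs
  | apply: contmax | (apply: cont_sum => ?) ].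

Definition itg {R : realType} (c e : R) (f : R -> R) : R :=
  \int[lebesgue_measure]_(t in `[c, e]) f t.

(** [itg] vanishes on reversed bounds, so at most one of the two terms is nonzero: this is the
    oriented integral from 0, a primitive on the whole line. *)
HB.lock Definition prim {R : realType} (f : R -> R) (t : R) : R :=
  itg 0 t f - itg t 0 f.

Section TimeIntegral.
Context {R : realType}.
Implicit Types (f g : R -> R) (c e t h : R).
Notation mu := (@lebesgue_measure R).

Lemma itg_integrable f c e : cts f -> mu.-integrable `[c, e] (EFin \o f).
Proof.
move=> cf; apply: continuous_compact_integrable; first exact: segment_compact.
exact/continuous_subspaceT/ctsP.
Qed.

Lemma itgD f g c e : cts f -> cts g ->
  itg c e (fun t => f t + g t) = itg c e f + itg c e g.
Proof. by move=> cf cg; apply: RintegralD => //; exact: itg_integrable. Qed.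

Lemma itgB f g c e : cts f -> cts g ->
  itg c e (fun t => f t - g t) = itg c e f - itg c e g.
Proof. by move=> cf cg; apply: RintegralB => //; exact: itg_integrable. Qed.

Lemma itgZ k f c e : cts f -> itg c e (fun t => k * f t) = k * itg c e f.
Proof. by move=> cf; apply: RintegralZl => //; exact: itg_integrable. Qed.

Lemma itg_cst k c e : c <= e -> itg c e (fun=> k) = k * (e - c).
Proof.
move=> ce; rewrite /itg Rintegral_cst//= lebesgue_measure_itv/= lte_fin.
by case: ltgtP ce => // ->; rewrite ?subrr ?mulr0.
Qed.

Lemma itg_sum n (F : nat -> R -> R) c e : (forall i, cts (F i)) ->
  itg c e (fun t => \sum_(i < n) F i t) = \sum_(i < n) itg c e (F i).
Proof.
move=> cF; elim: n => [|n IH].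
  rewrite big_ord0 /itg; under eq_Rintegral do rewrite big_ord0.
  by rewrite /Rintegral integral0.
rewrite big_ord_recr/= -IH -itgD; [|by cont..].
by apply: eq_Rintegral => t _; rewrite big_ord_recr.
Qed.

Lemma itg_le f g c e : cts f -> cts g ->
  (forall t, c <= t <= e -> f t <= g t) -> itg c e f <= itg c e g.
Proof.
move=> cf cg fg; apply: le_Rintegral; [by []|exact: itg_integrable..|].
by move=> t; rewrite /= in_itv/=; exact: fg.
Qed.

Lemma itg_ge0 f c e : (forall t, c <= t <= e -> 0 <= f t) -> 0 <= itg c e f.
Proof. by move=> f0; apply: Rintegral_ge0 => t; rewrite /= in_itv/=; exact: f0. Qed.

Lemma itg_abs f c e : cts f -> `|itg c e f| <= itg c e (fun t => `|f t|).
Proof. by move=> cf; apply: le_normr_Rintegral => //; exact: itg_integrable. Qed.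

Lemma eq_itg f g c e : (forall t, c <= t <= e -> f t = g t) -> itg c e f = itg c e g.
Proof. by move=> fg; apply: eq_Rintegral => t; rewrite inE/= in_itv/=; exact: fg. Qed.

Lemma itg_split f c t e : cts f -> c <= t <= e ->
  itg c e f = itg c t f + itg t e f.
Proof.
move=> cf /andP[ct te].
have := @Rintegral_itvB R f (BLeft c) (BRight e) t (itg_integrable _ _ cf).
rewrite !bnd_simp => /(_ ct te)/eqP; rewrite subr_eq addrC => /eqP.
rewrite Rintegral_itv_obnd_cbnd//.
apply: (@integrableS _ _ _ mu `[t, e]) => //; last exact: itg_integrable.
by move=> x; rewrite /= !in_itv/= => /andP[/ltW -> ->].
Qed.

Lemma itg_point f c : itg c c f = 0.
Proof. by rewrite /itg set_itv1 Rintegral_set1. Qed.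

Lemma itg_empty f c e : e <= c -> itg c e f = 0.
Proof.
rewrite le_eqVlt => /predU1P[->|ec]; first exact: itg_point.
by rewrite /itg set_itv_ge ?Rintegral_set0// bnd_simp -ltNge.
Qed.

Lemma primE f a t : cts f -> a <= 0 -> a <= t ->
  prim f t = itg a t f - itg a 0 f.
Proof.
move=> cf a0 at'; rewrite prim.unlock; have [t0|t0] := leP 0 t.
  by rewrite (@itg_empty _ t 0)// (@itg_split f a 0 t)// ?a0// subr0 addrC addKr.
rewrite (@itg_empty _ 0 t) 1?ltW// (@itg_split f a t 0)// ?at' ?ltW//.
by rewrite opprD addrA subrr.
Qed.

Lemma prim_is_derive f t : cts f -> is_derive t 1 (prim f) (f t).
Proof.
move=> cf; pose a : R := - (`|t| + 1).
have a0 : a < 0 by rewrite /a oppr_lt0 ltr_wpDl.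
have at' : a < t.
  by rewrite /a; have := ler_norm (- t); rewrite normrN; lra.
have tt1 : t < t + 1 by rewrite ltrDl.
have D : is_derive t 1 (fun x => itg a x f) (f t).
  have [ccf] := cf.
  have [dF] := @continuous_FTC1_closed R f a t (t + 1) tt1 (itg_integrable _ _ cf) at' (ccf t).
  rewrite derive1E -/(itg _ _ _) => F'.
  exact: (DeriveDef dF F').
have H : is_derive t 1 (fun x => itg a x f - itg a 0 f) (f t).
  by rewrite -[f t]subr0; exact: is_deriveB.
apply: near_eq_is_derive H.
near=> x; apply/esym; apply: primE => //; first exact: ltW.
by apply: ltW; near: x; exact: lt_nbhsr.
Unshelve. all: by end_near. Qed.

Lemma itg_prim f c e : cts f -> c <= e -> itg c e f = prim f e - prim f c.
Proof.
move=> cf ce; pose a := Num.min c 0.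
have ac : a <= c by rewrite ge_min lexx.
have a0 : a <= 0 by rewrite ge_min lexx orbT.
rewrite (primE cf a0 (le_trans ac ce)) (primE cf a0 ac).
by rewrite (@itg_split f a c e)// ?ac//; lra.
Qed.

Lemma itg_FTC F f c e : (forall t : R, is_derive t 1 F (f t)) -> cts f -> c <= e ->
  itg c e f = F e - F c.
Proof.
move=> dF cf; rewrite le_eqVlt => /predU1P[->|ce]; first by rewrite itg_point subrr.
rewrite /itg /Rintegral (@continuous_FTC2 R f F)//.
- exact/continuous_subspaceT/ctsP.
- have [cF] := is_derive_cont dF.
  split; first by move=> x _; have := dF x => -[].
    exact: cvg_at_right_filter (cF c).
  exact: cvg_at_left_filter (cF e).
- by move=> x _; rewrite derive1E; have := dF x => -[].
Qed.

Lemma itg_subint f c e c' e' : cts f -> (forall t, c <= t <= e -> 0 <= f t) ->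
  c <= c' -> e' <= e -> itg c' e' f <= itg c e f.
Proof.
move=> cf f0 cc' ee'.
have [e'c'|c'e'] := leP e' c'; first by rewrite itg_empty// itg_ge0.
rewrite (@itg_split f c c' e)// ?cc' ?(le_trans (ltW c'e'))//.
rewrite (@itg_split f c' e' e)// ?ee' ?(ltW c'e')//.
have H1 : 0 <= itg e' e f by apply: itg_ge0 => t tt; apply: f0; lra.
have H2 : 0 <= itg c c' f by apply: itg_ge0 => t tt; apply: f0; lra.
lra.
Qed.

Lemma prim_cont f : cts f -> cts (prim f).
Proof. by move=> cf; apply: is_derive_cont => t; exact: prim_is_derive. Qed.

Lemma is_derive_translate f f' h : (forall t : R, is_derive t 1 f (f' t)) ->
  forall t : R, is_derive t 1 (fun t => f (t + h)) (f' (t + h)).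
Proof.
move=> df t.
rewrite -[f' _]mulr1; apply: (@is_derive1_comp R f (fun t => t + h)).
have := is_deriveD (is_derive_id t (1 : R)) (is_derive_cst h t (1 : R)).
by rewrite addr0.
Qed.

Lemma itg_shift f c e h : cts f -> c <= e ->
  itg c e (fun t => f (t + h)) = itg (c + h) (e + h) f.
Proof.
move=> cf ce; rewrite [RHS]itg_prim ?lerD2r//.
apply: (@itg_FTC (fun t => prim f (t + h))) => //; last by cont.
by apply: is_derive_translate => t; exact: prim_is_derive.
Qed.

Lemma prim_mono f c e : cts f -> c <= e -> (forall t, c <= t <= e -> 0 <= f t) ->
  prim f c <= prim f e.
Proof. by move=> cf ce f0; rewrite -subr_ge0 -itg_prim// itg_ge0. Qed.

(* From the nonnegativity of the integral of (f - s)^2, for s the mean of f. *)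
Lemma itg_sqr_le f c e : cts f -> c <= e ->
  (itg c e f) ^+ 2 <= (e - c) * itg c e (fun t => f t ^+ 2).
Proof.
move=> cf; rewrite le_eqVlt => /predU1P[->|ce].
  by rewrite !itg_point subrr expr0n mul0r.
have ec : 0 < e - c by rewrite subr_gt0.
have [s sE] : exists s, itg c e f = s * (e - c).
  by exists (itg c e f / (e - c)); rewrite divfK ?gt_eqF.
have : 0 <= itg c e (fun t => (f t ^+ 2 - (2 * s) * f t) + s ^+ 2).
  apply: itg_ge0 => t _.
  by rewrite (_ : _ + _ = (f t - s) ^+ 2) ?sqr_ge0//; ring.
rewrite itgD ?itgB ?itgZ ?itg_cst ?(ltW ce); try by cont.
rewrite sE.
set I := itg _ _ _; move=> H.
rewrite (_ : (s * (e - c)) ^+ 2 = (e - c) * (s ^+ 2 * (e - c))); last by ring.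
rewrite ler_pM2l//; nra.
Qed.

(** Cauchy-Schwarz on each window of length [h] costs one factor [h]; the other appears because
    every time lies in windows starting from a set of length at most [h]. In terms of the
    nondecreasing primitive [E] of [f ^+ 2], the integral of [E (t + h) - E t] reduces to two end
    pieces of length [h]. *)
Lemma itg_window_sqr f c e h : cts f -> c <= e -> 0 <= h ->
  itg c e (fun t => (prim f (t + h) - prim f t) ^+ 2) <=
  h ^+ 2 * itg c (e + h) (fun t => f t ^+ 2).
Proof.
move=> cf ce h0; pose E := prim (fun t => f t ^+ 2).
have cf2 : cts (fun t => f t ^+ 2) by cont.
have cE : cts E by exact: prim_cont.
have cp := prim_cont cf.
have csh (g : R -> R) : cts g -> cts (fun t => g (t + h)).
  by move=> cg; cont.
apply: (@le_trans _ _ (itg c e (fun t => h * (E (t + h) - E t)))).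
  apply: itg_le; [by cont..|].
  move=> t _; have th : t <= t + h by rewrite lerDl.
  rewrite -(itg_prim cf th) -(itg_prim cf2 th).
  by apply: le_trans (itg_sqr_le cf th) _; rewrite addrAC subrr add0r.
have cEh := csh _ cE.
rewrite itgZ ?itgB; [|by cont..].
rewrite itg_shift//.
have mE x y : x <= y -> E x <= E y.
  by move=> xy; apply: prim_mono => // t _; exact: sqr_ge0.
rewrite (itg_prim cf2); last by rewrite (le_trans ce)// lerDl.
rewrite expr2 -mulrA; apply: ler_wpM2l => //.
rewrite (itg_prim cE) ?lerD2r// (itg_prim cE)//.
have h1 : itg e (e + h) E <= h * E (e + h).
  rewrite -[X in _ <= X * _](addrK e) [h + e]addrC [X in _ <= X]mulrC -itg_cst ?lerDl//.
  by apply: itg_le; [|exact: cont_cst|move=> t /andP[_ te]; exact: mE].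
have h2 : h * E c <= itg c (c + h) E.
  rewrite -[X in X * _](addrK c) [h + c]addrC [X in X <= _]mulrC -itg_cst ?lerDl//.
  by apply: itg_le; [exact: cont_cst| |move=> t /andP[ct _]; exact: mE].
rewrite (itg_prim cE) ?lerDl// in h1; rewrite (itg_prim cE) ?lerDl// in h2.
rewrite -/E mulrBr; lra.
Qed.

(** Minkowski's inequality in squared form: Young's inequality with the weights [1 + B / A] and
    [1 + A / B], for which the two bounds add up to a perfect square. *)
Lemma itg_sqr_add f g c e A B : cts f -> cts g -> 0 < A -> 0 < B ->
  itg c e (fun t => f t ^+ 2) <= A ^+ 2 -> itg c e (fun t => g t ^+ 2) <= B ^+ 2 ->
  itg c e (fun t => (f t + g t) ^+ 2) <= (A + B) ^+ 2.
Proof.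
move=> cf cg A0 B0 fA gB.
apply: (@le_trans _ _ (itg c e (fun t => (1 + B / A) * f t ^+ 2 + (1 + A / B) * g t ^+ 2))).
  apply: itg_le; [by cont..|] => t _.
  rewrite -subr_ge0.
  have -> : (1 + B / A) * f t ^+ 2 + (1 + A / B) * g t ^+ 2 - (f t + g t) ^+ 2 =
     (B * f t - A * g t) ^+ 2 / (A * B) by field; rewrite !gt_eqF.
  by rewrite divr_ge0 ?sqr_ge0// mulr_ge0 ?ltW.
rewrite itgD ?itgZ; try by cont.
have -> : (A + B) ^+ 2 = (1 + B / A) * A ^+ 2 + (1 + A / B) * B ^+ 2.
  by field; rewrite !gt_eqF.
by apply: lerD; apply: ler_wpM2l => //; rewrite addr_ge0// divr_ge0 ?ltW.
Qed.

End TimeIntegral.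

(** * Energy estimates on a grid *)

Section SummationByParts.
Context {R : realType}.
Implicit Types (n : nat) (a f g : nat -> R).

(** The second difference centred at [j.+1]. With this shift the inner points of the grid
    [0, ..., n.+1] correspond to the indices [j < n]. *)
Definition lapl f j := f j.+2 - 2 * f j.+1 + f j.

Lemma sum_by_parts n a f : a 0%N = 0 -> a n.+1 = 0 ->
  \sum_(j < n) a j.+1 * lapl f j =
  - \sum_(j < n.+1) (a j.+1 - a j) * (f j.+1 - f j).
Proof.
move=> a0 an.
have H k : \sum_(j < k) a j.+1 * lapl f j +
   \sum_(j < k.+1) (a j.+1 - a j) * (f j.+1 - f j) =
   a k.+1 * (f k.+1 - f k) - a 0%N * (f 1%N - f 0%N).
  elim: k => [|k IH]; first by rewrite big_ord0 big_ord_recr big_ord0/=; ring.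
  by rewrite big_ord_recr (big_ord_recr k.+1)/= addrACA IH /lapl; ring.
by have := H n; rewrite a0 an; lra.
Qed.

(** The second difference of [f ^+ 2] is [2 f (lapl f)] plus the squares of the two adjacent slopes.
    Multiplying by [a] and moving the second difference onto [a] leaves only these boundary terms,
    as [a] vanishes at both ends. *)
Lemma sum_edge_energy n a f : a 0%N = 0 -> a n.+1 = 0 ->
  \sum_(j < n.+1) (a j + a j.+1) * (f j.+1 - f j) ^+ 2 =
  - 2 * (\sum_(j < n) a j.+1 * (f j.+1 * lapl f j)) +
  \sum_(j < n) lapl a j * f j.+1 ^+ 2 + a 1%N * f 0%N ^+ 2 + a n * f n.+1 ^+ 2.
Proof.
move=> a0 an.
have H k : \sum_(j < k.+1) (a j + a j.+1) * (f j.+1 - f j) ^+ 2 =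
  - 2 * (\sum_(j < k) a j.+1 * (f j.+1 * lapl f j)) +
  \sum_(j < k) lapl a j * f j.+1 ^+ 2 +
  (2 * a k.+1 * f k.+1 * (f k.+1 - f k) - (a k.+1 - a k) * f k.+1 ^+ 2) -
  (2 * a 0%N * f 0%N * (f 1%N - f 0%N) - (a 1%N - a 0%N) * f 0%N ^+ 2).
  elim: k => [|k IH]; first by rewrite big_ord_recr !big_ord0/=; ring.
  by rewrite big_ord_recr/= IH !(big_ord_recr k)/= /lapl; ring.
by rewrite H a0 an; ring.
Qed.

(* A slope exceeding the total defect S would stay positive up to q. *)
Lemma almost_convex_le f (b : nat -> R) (d S F : R) p q : 0 <= d ->
  (forall j, 0 <= b j) ->
  (forall j, (p <= j)%N -> (j.+1 < q)%N -> - (d * b j) <= lapl f j) ->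
  (forall k, (p <= k)%N -> (k < q)%N -> \sum_(p <= j < k) b j <= S) ->
  0 <= S -> f p <= F -> f q <= F ->
  forall i, (p <= i <= q)%N -> f i <= F + (q - p)%:R * d * S.
Proof.
move=> d0 b0 lf bS S0 fp fq i /andP[pi iq].
rewrite leNgt; apply/negP => Hi.
(* Otherwise every slope from [p] to [i] is at most [d * S], and [f i] cannot exceed its bound. *)
have [j pj [ji sj]] : exists2 j, (p <= j)%N & (j < i)%N /\ d * S < f j.+1 - f j.
  apply: contrapT => /forall2NP H.
  have {}H j : (p <= j)%N -> (j < i)%N -> f j.+1 - f j <= d * S.
    move=> pj ji; case: (H j) => [//|/not_andP[//|/negP]].
    by rewrite -leNgt.
  have G k : (p <= k <= i)%N -> f k <= F + (k - p)%:R * (d * S).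
    elim: k => [|k IH] /andP[pk ki].
      have -> : p = 0%N by lia.
      by move: pk fp; rewrite leqn0 => /eqP ->; rewrite mul0r addr0.
    have [pk'|kp] := leqP p k.
      have := IH (introT andP (conj pk' (ltnW ki))).
      have := H k pk' ki.
      rewrite subSn// -natr1 mulrDl mul1r; lra.
    have -> : k.+1 = p by lia.
    by rewrite subnn mul0r addr0.
  have := G i; rewrite pi leqnn => /(_ isT).
  have : (i - p)%:R * (d * S) <= (q - p)%:R * d * S.
    rewrite -mulrA; apply: ler_wpM2r; first exact: mulr_ge0.
    by rewrite ler_nat; lia.
  lra.

have slope k : (j <= k)%N -> (k < q)%N ->
    f j.+1 - f j - d * \sum_(j <= l < k) b l <= f k.+1 - f k.
  elim: k => [|k IH] jk kq.
    by move: jk; rewrite leqn0 => /eqP ->; rewrite big_geq// mulr0 subr0.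
  have [jk'|kj] := leqP j k; last first.
    have -> : k.+1 = j by lia.
    by rewrite big_geq// mulr0 subr0.
  have := IH jk' (ltnW kq); rewrite big_nat_recr//= mulrDr.
  have := lf k (leq_trans pj jk') kq; rewrite /lapl; lra.
have pos k : (j <= k)%N -> (k < q)%N -> 0 <= f k.+1 - f k.
  move=> jk kq; apply: le_trans (slope k jk kq).
  have : \sum_(j <= l < k) b l <= S.
    apply: le_trans (bS k (leq_trans pj jk) kq).
    by rewrite [leRHS](@big_cat_nat _ _ _ j)//= lerDr sumr_ge0.
  move=> /(ler_wpM2l d0); lra.
(* Hence [f i <= f q <= F], which contradicts [Hi]. *)
have mono k : (i <= k <= q)%N -> f i <= f k.
  elim: k => [|k IH] /andP[ik kq].
    by move: ik; rewrite leqn0 => /eqP ->.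
  have [ik'|ki] := leqP i k; last by have -> : k.+1 = i by lia.
  have := IH (introT andP (conj ik' (ltnW kq))).
  have := pos k (ltnW (leq_trans ji ik')) kq; lra.
have := mono q; rewrite iq leqnn => /(_ isT).
have : 0 <= (q - p)%:R * d * S by rewrite !mulr_ge0.
lra.
Qed.
End SummationByParts.

Ltac ge0 := repeat first [ done | exact: sqr_ge0 | exact: ltW
  | (rewrite subr_ge0; done) | (rewrite subr_ge0; exact: ltW)
  | (rewrite invr_ge0) | apply: mulr_ge0 | apply: addr_ge0 | apply: exprn_ge0 ].

(** * Integration by parts and cutoffs in time *)

Section Derivatives.
Context {R : realType}.
Implicit Types f g : R -> R.

Lemma is_derive_mul f g f' g' : (forall t : R, is_derive t 1 f (f' t)) ->
  (forall t : R, is_derive t 1 g (g' t)) ->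
  forall t : R, is_derive t 1 (fun t => f t * g t) (f t * g' t + g t * f' t).
Proof. by move=> df dg t; have := is_deriveM (df t) (dg t). Qed.

Lemma is_derive_sub f g f' g' : (forall t : R, is_derive t 1 f (f' t)) ->
  (forall t : R, is_derive t 1 g (g' t)) ->
  forall t : R, is_derive t 1 (fun t => f t - g t) (f' t - g' t).
Proof. by move=> df dg t; have := is_deriveB (df t) (dg t). Qed.

Lemma itgN f c e : cts f -> itg c e (fun t => - f t) = - itg c e f.
Proof.
by move=> cf; rewrite -mulN1r -itgZ//; apply: eq_itg => t _; rewrite mulN1r.
Qed.

Lemma itg_by_parts_sqr (eta eta' f f' : R -> R) c e : c <= e ->
  (forall t : R, is_derive t 1 eta (eta' t)) -> cts eta' ->
  (forall t : R, is_derive t 1 f (f' t)) -> cts f' ->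
  eta c = 0 -> eta e = 0 ->
  itg c e (fun t => eta t * (2 * (f t * f' t))) =
  - itg c e (fun t => eta' t * f t ^+ 2).
Proof.
move=> ce deta ceta' df cf' ec ee.
have ceta := is_derive_cont deta; have cf := is_derive_cont df.
have dF := is_derive_mul deta (is_derive_mul df df).
have := itg_FTC dF _ ce; rewrite ec ee !mul0r subrr => H.
have cF : cts (fun t => eta t * (f t * f' t + f t * f' t) + f t * f t * eta' t) by cont.
apply/eqP; rewrite -addr_eq0 -itgD; [|by cont..].
by rewrite -[X in _ == X](H cF); apply/eqP/eq_itg => t _; ring.
Qed.

(** A cutoff in time that vanishes at [c] and [e]. A quadratic polynomial is enough, since the
    estimates involve only the cutoff and its first derivative. *)
Definition window (c e t : R) := (t - c) * (e - t).
Definition dwindow (c e t : R) := c + e - 2 * t.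

Lemma window_is_derive c e (t : R) : is_derive t 1 (window c e) (dwindow c e t).
Proof.
have d1 : forall t : R, is_derive t 1 (fun t : R => t - c) 1.
  by move=> s; have := is_deriveB (is_derive_id s (1 : R)) (is_derive_cst c s (1 : R)); rewrite subr0.
have d2 : forall t : R, is_derive t 1 (fun t : R => e - t) (- 1).
  by move=> s; have := is_deriveB (is_derive_cst e s (1 : R)) (is_derive_id s (1 : R)); rewrite sub0r.
have := is_derive_mul d1 d2 t; rewrite /dwindow.
by rewrite (_ : (t - c) * -1 + (e - t) * 1 = c + e - 2 * t)//; ring.
Qed.

Lemma window_cont c e : cts (window c e).
Proof. by apply: is_derive_cont => t; exact: window_is_derive. Qed.

Lemma dwindow_cont c e : cts (dwindow c e).
Proof. by rewrite /dwindow; cont. Qed.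

Lemma window_bounds c e T t : e - c <= T -> c <= t <= e ->
  0 <= window c e t <= T ^+ 2 /\ `|dwindow c e t| <= T.
Proof.
rewrite /window /dwindow => eT /andP[ct te]; split.
  rewrite mulr_ge0 ?subr_ge0//= expr2; apply: ler_pM; lra.
by rewrite ler_norml; apply/andP; split; lra.
Qed.

Lemma window_ge c e tau t : 0 <= tau -> c + tau <= t <= e - tau -> tau ^+ 2 <= window c e t.
Proof. by move=> t0 /andP[ct te]; rewrite /window expr2; apply: ler_pM; lra. Qed.

Lemma itg_window_ge f c e tau : cts f -> 0 <= tau ->
  (forall t, c <= t <= e -> 0 <= f t) ->
  tau ^+ 2 * itg (c + tau) (e - tau) f <= itg c e (fun t => window c e t * f t).
Proof.
move=> cf t0 f0; have cw := window_cont c e.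
rewrite -itgZ//.
apply: (@le_trans _ _ (itg (c + tau) (e - tau) (fun t => window c e t * f t))).
  apply: itg_le; [by cont..|] => t tt; apply: ler_wpM2r; last exact: window_ge.
  by apply: f0; lra.
apply: itg_subint; [by cont| |lra..].
move=> t tt; apply: mulr_ge0; last exact: f0.
by have [/andP[]] := window_bounds (lexx _) tt.
Qed.

Lemma itg_wsqr_le (eta f : R -> R) H c e : cts eta -> cts f ->
  (forall t, c <= t <= e -> eta t <= H) ->
  itg c e (fun t => eta t * f t ^+ 2) <= H * itg c e (fun t => f t ^+ 2).
Proof.
move=> ceta cf eH; rewrite -itgZ; last by cont.
by apply: itg_le; [by cont..|] => t tt; apply: ler_wpM2r; [exact: sqr_ge0|exact: eH].
Qed.
End Derivatives.

Section GridEnergy.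
Context {R : realType} (n : nat) (d : R) (d0 : 0 < d).
Let L := n.+1%:R * d.

(** The cutoff in space: [x (L - x)] at [x = j d], where the grid covers [[0, L]]. Its concavity
    gives the term with its second difference a sign. *)
Definition chi (j : nat) : R := (j%:R * d) * (n.+1%:R * d - j%:R * d).

Let mul_natd i j : (i <= j)%N -> i%:R * d <= j%:R * d.
Proof. by move=> ij; apply: ler_wpM2r; [exact: ltW|rewrite ler_nat]. Qed.

Lemma chi_ge0 j : (j <= n.+1)%N -> 0 <= chi j.
Proof.
move=> jn; rewrite /chi; apply: mulr_ge0; first by rewrite mulr_ge0// ltW.
by rewrite subr_ge0 mul_natd.
Qed.

Lemma chi_le j : (j <= n.+1)%N -> chi j <= L ^+ 2.
Proof.
move=> jn; have jL : j%:R * d <= L by exact: mul_natd.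
have j0 : 0 <= j%:R * d by rewrite mulr_ge0// ltW.
by rewrite /chi expr2; apply: ler_pM; rewrite -/L; lra.
Qed.

Lemma lapl_chi j : lapl chi j = - (2 * d ^+ 2).
Proof. by rewrite /lapl /chi -!natr1; ring. Qed.

Lemma chi0 : chi 0 = 0. Proof. by rewrite /chi mul0r mul0r. Qed.
Lemma chin : chi n.+1 = 0. Proof. by rewrite /chi subrr mulr0. Qed.

Let L_ge0 : 0 <= L. Proof. by rewrite mulr_ge0// ltW. Qed.
Let Ld : L = n%:R * d + d. Proof. by rewrite /L -natr1; ring. Qed.

(** The slope of [chi] is at most [d * L]. Squaring the cutoff thus bounds its slope by the cutoff
    itself, and the commutator it produces is absorbed by the energy weighted with [chi]. *)
Lemma chi_slope j : (j <= n)%N ->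
  `|chi j.+1 ^+ 2 - chi j ^+ 2| <= d * L * (chi j + chi j.+1).
Proof.
move=> jn; rewrite (_ : _ - _ = (chi j.+1 - chi j) * (chi j + chi j.+1)); last by ring.
have c0 := chi_ge0 (leqW jn); have c1 : 0 <= chi j.+1 by apply: chi_ge0.
rewrite normrM (ger0_norm (addr_ge0 c0 c1)); apply: ler_wpM2r; first exact: addr_ge0.
have -> : chi j.+1 - chi j = d * (L - 2 * (j%:R * d) - d).
  by rewrite /chi -/L -[j.+1%:R]natr1; ring.
rewrite normrM (gtr0_norm d0); apply: ler_wpM2l; first exact: ltW.
have jd : j%:R * d <= n%:R * d by exact: mul_natd.
have jd0 : 0 <= j%:R * d by rewrite mulr_ge0// ltW.
have Lj : j%:R * d + d <= L by rewrite Ld lerD2r.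
by clear Ld; move: L L_ge0 Lj d0 => l l0 lj d1; rewrite ler_norml; apply/andP; split; lra.
Qed.

(** Concavity of [chi] allows dropping the term with [lapl chi]; in the boundary terms [chi 1] and
    [chi n] are at most [d * L]. *)
Lemma sum_edge_le (f : nat -> R) :
  \sum_(j < n.+1) (chi j + chi j.+1) * (f j.+1 - f j) ^+ 2 <=
  - 2 * (\sum_(j < n) chi j.+1 * (f j.+1 * lapl f j)) +
  d * L * (f 0%N ^+ 2 + f n.+1 ^+ 2).
Proof.
rewrite sum_edge_energy ?chi0 ?chin//.
have : \sum_(j < n) lapl chi j * f j.+1 ^+ 2 <= 0.
  apply: sumr_le0 => j _; rewrite lapl_chi mulNr oppr_le0.
  by rewrite mulr_ge0 ?sqr_ge0// mulr_ge0// sqr_ge0.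
have nd : 0 <= n%:R * d by rewrite mulr_ge0// ltW.
have c1 : chi 1 <= d * L.
  rewrite /chi -/L mul1r; apply: ler_wpM2l; first exact: ltW.
  by have := d0; lra.
have cn : chi n <= d * L.
  rewrite /chi -/L (_ : L - n%:R * d = d); last by rewrite Ld; ring.
  rewrite mulrC; apply: ler_wpM2l; first exact: ltW.
  by rewrite Ld; have := d0; lra.
have := ler_wpM2r (sqr_ge0 (f 0%N)) c1; have := ler_wpM2r (sqr_ge0 (f n.+1)) cn.
lra.
Qed.

(* Caccioppoli inequality on the grid. *)
Lemma edge_energy_bound (w w' : nat -> R -> R) (m dl : nat -> R) (r : nat -> R -> R)
    (eta eta' : R -> R) (c e H N B M dlt : R) : c <= e ->
  (forall i (t : R), is_derive t 1 (w i) (w' i t)) -> (forall i, cts (w' i)) ->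
  (forall j, cts (r j)) -> (forall j, 0 <= m j) ->
  (forall j t, (j < n)%N -> c <= t <= e ->
     lapl (w ^~ t) j = d * (2 * (m j * w' j.+1 t) + r j t)) ->
  (forall j t, (j < n)%N -> c <= t <= e -> `|r j t| <= dl j) ->
  (forall i t, (i <= n.+1)%N -> c <= t <= e -> `|w i t| <= B) ->
  (forall i, (i <= n.+1)%N -> itg c e (fun t => w i t ^+ 2) <= N) ->
  (forall t : R, is_derive t 1 eta (eta' t)) -> cts eta' ->
  eta c = 0 -> eta e = 0 ->
  (forall t, c <= t <= e -> 0 <= eta t <= H /\ `|eta' t| <= H) ->
  \sum_(j < n) m j <= M -> \sum_(j < n) dl j <= dlt -> 0 <= B -> 0 <= H ->
  itg c e (fun t => eta t * \sum_(j < n.+1) (chi j + chi j.+1) * (w j.+1 t - w j t) ^+ 2)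
  <= d * (2 * L * H * N + 2 * L ^+ 2 * H * M * N + 2 * L ^+ 2 * H * B * dlt * (e - c)).
Proof.
move=> ce dw cw' cr m0 eqn rdl wB wN deta ceta' ec ee eH mM dlM B0 H0.
have ceta := is_derive_cont deta.
have cw i : cts (w i) by exact: is_derive_cont (dw i).
have N0 : 0 <= N by apply: le_trans (wN 0%N _) => //; apply: itg_ge0 => t _; exact: sqr_ge0.
(* After use of the equation: the term with [w w'], whose time derivative the cutoff [eta] will take
   over by parts, the defect, and the lateral boundary terms. *)
pose rhs t := d * (\sum_(j < n) (2 * chi j.+1 * m j) * (- (eta t * (2 * (w j.+1 t * w' j.+1 t))))
   + \sum_(j < n) (2 * chi j.+1) * (- (eta t * (w j.+1 t * r j t)))
   + L * (eta t * w 0%N t ^+ 2 + eta t * w n.+1 t ^+ 2)).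
apply: (@le_trans _ _ (itg c e rhs)).
  apply: itg_le; [by cont|by rewrite /rhs; cont|] => t tt.
  have [/andP[e0 _] _] := eH t tt.
  apply: le_trans (ler_wpM2l e0 (sum_edge_le (w ^~ t))) _.
  rewrite le_eqVlt; apply/orP; left; apply/eqP.
  under eq_bigr => j _ do rewrite (eqn j t (ltn_ord j) tt).
  rewrite /rhs mulrDr !mulr_sumr -big_split/= [in RHS]mulrDr mulr_sumr.
  congr (_ + _); last by ring.
  by apply: eq_bigr => j _; ring.
have cj (F : nat -> R -> R) (a : nat -> R) : (forall j, cts (F j)) ->
  itg c e (fun t => \sum_(j < n) a j * F j t) = \sum_(j < n) a j * itg c e (F j).
  move=> cF; rewrite (@itg_sum _ n (fun j t => a j * F j t)); last by move=> i; cont.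
  by apply: eq_bigr => j _; rewrite itgZ.
rewrite /rhs itgZ; last by cont.
apply: ler_wpM2l; first exact: ltW.
rewrite itgD; [|by cont..]; rewrite itgD; [|by cont..].
rewrite (cj (fun j t => - (eta t * (2 * (w j.+1 t * w' j.+1 t)))) (fun j => 2 * chi j.+1 * m j)); last by move=> j; cont.
rewrite (cj (fun j t => - (eta t * (w j.+1 t * r j t))) (fun j => 2 * chi j.+1)); last by move=> j; cont.
have chb j : (j < n)%N -> 0 <= chi j.+1 <= L ^+ 2.
  by move=> jn; rewrite chi_ge0 ?chi_le// ltnS ltnW.
rewrite [leRHS](_ : _ = 2 * L ^+ 2 * H * M * N + 2 * L ^+ 2 * H * B * dlt * (e - c) +
  2 * L * H * N); last by ring.
apply: lerD; [apply: lerD|].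
- apply: (@le_trans _ _ (\sum_(j < n) (2 * L ^+ 2 * H * N) * m j)).
    apply: ler_sum => j _; have mj := m0 j; have /andP[c0 cL] := chb j (ltn_ord j).
    rewrite (_ : itg _ _ _ = itg c e (fun t => eta' t * w j.+1 t ^+ 2)); last first.
      rewrite -[RHS]opprK -(itg_by_parts_sqr ce deta ceta' (dw j.+1) (cw' j.+1) ec ee).
      by rewrite -itgN//; cont.
    have h1 : itg c e (fun t => eta' t * w j.+1 t ^+ 2) <= H * N.
      apply: le_trans (ler_wpM2l H0 (wN j.+1 _)); last by rewrite ltnS ltnW.
      apply: itg_wsqr_le => // t tt; have [_] := eH t tt.
      by apply: le_trans; exact: ler_norm.
    have a0 : 0 <= 2 * chi j.+1 * m j by ge0.
    apply: le_trans (ler_wpM2l a0 h1) _.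
    have HN : 0 <= 2 * (H * N) * m j by ge0.
    have := ler_wpM2l HN cL; lra.
  rewrite -mulr_sumr [leRHS](_ : _ = 2 * L ^+ 2 * H * N * M); last by ring.
  by apply: ler_wpM2l => //; ge0.
- apply: (@le_trans _ _ (\sum_(j < n) (2 * L ^+ 2 * H * B * (e - c)) * dl j)).
    apply: ler_sum => j _; have mj := m0 j; have /andP[c0 cL] := chb j (ltn_ord j).
    have dj0 : 0 <= dl j by apply: le_trans (rdl j c (ltn_ord j) _); rewrite ?lexx ?ce.
    have h1 : itg c e (fun t => - (eta t * (w j.+1 t * r j t))) <= (H * (B * dl j)) * (e - c).
      rewrite -itg_cst//; apply: itg_le; [by cont|by cont|] => t tt.
      have [/andP[e0 eHt] _] := eH t tt.
      apply: le_trans (ler_norm _) _; rewrite normrN !normrM ger0_norm//.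
      by apply: ler_pM => //; apply: ler_pM => //; [apply: wB => //; rewrite ltnS ltnW|exact: rdl].
    have a0 : 0 <= 2 * chi j.+1 by ge0.
    apply: le_trans (ler_wpM2l a0 h1) _.
    have HN : 0 <= 2 * (H * (B * dl j) * (e - c)) by ge0.
    have := ler_wpM2l HN cL; lra.
  rewrite -mulr_sumr [leRHS](_ : _ = 2 * L ^+ 2 * H * B * (e - c) * dlt); last by ring.
  by apply: ler_wpM2l => //; ge0.
- rewrite itgZ; last by cont.
  rewrite itgD; [|by cont..].
  have b i : (i <= n.+1)%N -> itg c e (fun t => eta t * w i t ^+ 2) <= H * N.
    move=> ni; apply: le_trans (ler_wpM2l H0 (wN i ni)).
    by apply: itg_wsqr_le => // t tt; have [/andP[]] := eH t tt.
  have := ler_wpM2l L_ge0 (lerD (b 0%N (leq0n _)) (b n.+1 (leqnn _))); lra.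
Qed.
End GridEnergy.

Section GridDerivative.
Context {R : realType} (n : nat) (d : R) (d0 : 0 < d).
Let L := n.+1%:R * d.
Notation chi := (chi n d).
Let L_ge0 : 0 <= L. Proof. by rewrite mulr_ge0// ltW. Qed.

Lemma itg_lin k (F : nat -> R -> R) (a : nat -> R) c e : (forall j, cts (F j)) ->
  itg c e (fun t => \sum_(j < k) a j * F j t) = \sum_(j < k) a j * itg c e (F j).
Proof.
move=> cF; rewrite (@itg_sum _ k (fun j t => a j * F j t)); last by move=> i; cont.
by apply: eq_bigr => j _; rewrite itgZ.
Qed.

(** The weights balance the two terms in the application: summed over the grid, [a ^+ 2] is of order
    [1 / d] and [b ^+ 2] of order [d * h ^+ 2], so both terms become of order [d * h]. *)
Lemma young (h a b : R) : 0 < h -> d * (a * b) <= h * d ^+ 2 / 2 * a ^+ 2 + b ^+ 2 / (2 * h).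
Proof.
move=> h0; rewrite -subr_ge0.
have -> : h * d ^+ 2 / 2 * a ^+ 2 + b ^+ 2 / (2 * h) - d * (a * b) =
  (h * d * a - b) ^+ 2 / (2 * h) by field; rewrite gt_eqF.
by ge0.
Qed.

(** Discrete product rule: the increment of [chi ^+ 2 * g] is the mean of [chi ^+ 2] times that of
    [g], plus the increment of [chi ^+ 2] times the mean of [g]. When [g] is the time derivative of
    [z], the former gives the derivative of [(z1 - z0) ^+ 2]; the latter is the commutator, bounded
    by [chi_slope] and [young]. *)
Lemma sqr_edge_cross j (g0 g1 z0 z1 h : R) : (j <= n)%N -> 0 < h ->
  - ((chi j.+1 ^+ 2 * g1 - chi j ^+ 2 * g0) * (z1 - z0)) <=
  (chi j ^+ 2 + chi j.+1 ^+ 2) / 4 * - (2 * ((z1 - z0) * (g1 - g0))) +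
  L * (h * d ^+ 2 * L ^+ 2 * ((g0 ^+ 2 + g1 ^+ 2) / 2) +
     (2 * h)^-1 * ((chi j + chi j.+1) * (z1 - z0) ^+ 2)).
Proof.
move=> jn h0.
have c0 := chi_ge0 d0 (leqW jn); have c1 : 0 <= chi j.+1 by apply: chi_ge0.
have cL0 : chi j <= L ^+ 2 := chi_le d0 (leqW jn); have cL1 : chi j.+1 <= L ^+ 2 by apply: chi_le.
have [gm gmE] : exists gm, gm = (g0 + g1) / 2 by eexists.
have -> : - ((chi j.+1 ^+ 2 * g1 - chi j ^+ 2 * g0) * (z1 - z0)) =
  (chi j ^+ 2 + chi j.+1 ^+ 2) / 4 * - (2 * ((z1 - z0) * (g1 - g0))) +
  - ((chi j.+1 ^+ 2 - chi j ^+ 2) * gm * (z1 - z0)) by rewrite gmE; field.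
apply: lerD => //; apply: le_trans (ler_norm _) _.
rewrite normrN !normrM.
apply: (@le_trans _ _ (d * L * (chi j + chi j.+1) * `|gm| * `|z1 - z0|)).
  by apply: ler_wpM2r => //; apply: ler_wpM2r => //; exact: chi_slope.
rewrite (_ : _ * _ * `|gm| * _ = L * (chi j + chi j.+1) * (d * (`|gm| * `|z1 - z0|))); last by ring.
have Lc : 0 <= L * (chi j + chi j.+1) by ge0.
apply: le_trans (ler_wpM2l Lc (young `|gm| `|z1 - z0| h0)) _.
rewrite !real_normK ?num_real// -[leLHS]mulrA; apply: ler_wpM2l => //.
rewrite mulrDr; apply: lerD; last first.
  by rewrite le_eqVlt; apply/orP; left; apply/eqP; ring.
have gg : gm ^+ 2 <= (g0 ^+ 2 + g1 ^+ 2) / 2.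
  rewrite -subr_ge0 (_ : _ - _ = ((g0 - g1) / 2) ^+ 2) ?sqr_ge0//.
  by rewrite gmE; field.
have hd : 0 <= h * d ^+ 2 / 2 by ge0.
have := ler_pM (addr_ge0 c0 c1) (mulr_ge0 hd (sqr_ge0 gm)) (lerD cL0 cL1) (ler_wpM2l hd gg).
by move=> /le_trans; apply; rewrite le_eqVlt; apply/orP; left; apply/eqP; field.
Qed.

(** The equation is tested with [chi ^+ 2 * g], where [g] is the time derivative of [z]. Summation
    by parts produces the time derivative of the edge energy of [z], which moves onto [eta], and a
    commutator. Since the edge energy is assumed to be of order [h ^+ 2], the commutator dominates
    and is of order [h]. *)
Lemma time_derivative_bound (z g : nat -> R -> R) (m dl : nat -> R) (r : nat -> R -> R)
    (eta eta' : R -> R) (c e H G B h Y dlt : R) : c <= e -> 0 < h ->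
  (forall i (t : R), is_derive t 1 (z i) (g i t)) -> (forall i, cts (g i)) ->
  (forall j, cts (r j)) -> (forall j, 0 <= m j) ->
  (forall j t, (j < n)%N -> c <= t <= e ->
     lapl (z ^~ t) j = d * (2 * (m j * g j.+1 t) + r j t)) ->
  (forall j t, (j < n)%N -> c <= t <= e -> `|r j t| <= dl j) ->
  (forall i t, (i <= n.+1)%N -> c <= t <= e -> `|g i t| <= B) ->
  (forall i, (i <= n.+1)%N -> itg c e (fun t => g i t ^+ 2) <= G) ->
  itg c e (fun t => \sum_(j < n.+1) (chi j + chi j.+1) * (z j.+1 t - z j t) ^+ 2)
    <= d * h ^+ 2 * Y ->
  (forall t : R, is_derive t 1 eta (eta' t)) -> cts eta' ->
  eta c = 0 -> eta e = 0 ->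
  (forall t, c <= t <= e -> 0 <= eta t <= H /\ `|eta' t| <= H) ->
  \sum_(j < n) dl j <= dlt -> 0 <= B -> 0 <= H ->
  2 * itg c e (fun t => eta t * \sum_(j < n) chi j.+1 ^+ 2 * (m j * g j.+1 t ^+ 2))
  <= H * (L ^+ 2 * h ^+ 2 * Y / 4 + L * (h * L ^+ 3 * G + h * Y / 2) +
     L ^+ 4 * B * dlt * (e - c)).
Proof.
move=> ce h0 dz cg cr m0 eqn rdl gB gG zY deta ceta' ec ee eH dlM B0 H0.
have ceta := is_derive_cont deta.
have cz i : cts (z i) by exact: is_derive_cont (dz i).
pose Ez t := \sum_(j < n.+1) (chi j + chi j.+1) * (z j.+1 t - z j t) ^+ 2.
have cEz : cts Ez by rewrite /Ez; cont.
pose rhs t :=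
  \sum_(j < n.+1) ((chi j ^+ 2 + chi j.+1 ^+ 2) / 4) *
     (- (eta t * (2 * ((z j.+1 t - z j t) * (g j.+1 t - g j t)))))
  + H * L * (\sum_(j < n.+1) (h * d ^+ 2 * L ^+ 2) * ((g j t ^+ 2 + g j.+1 t ^+ 2) / 2)
     + (2 * h)^-1 * Ez t)
  + d * (\sum_(j < n) L ^+ 4 * (H * (B * dl j))).
have crhs : cts rhs by rewrite /rhs; cont.
have d2 : 0 <= d * 2 by rewrite mulr_ge0 ?ltW.
have ech j : (j < n)%N -> (j.+1 <= n.+1)%N by move=> jn; rewrite ltnS ltnW.
have : itg c e (fun t => (d * 2) * (eta t * \sum_(j < n) chi j.+1 ^+ 2 * (m j * g j.+1 t ^+ 2)))
       <= itg c e rhs.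
  apply: itg_le; [by cont|by []|] => t tt.
  have [/andP[e0 eHt] _] := eH t tt.
  have -> : (d * 2) * (eta t * \sum_(j < n) chi j.+1 ^+ 2 * (m j * g j.+1 t ^+ 2)) =
    eta t * (\sum_(j < n) (chi j.+1 ^+ 2 * g j.+1 t) * lapl (z ^~ t) j) +
    d * (\sum_(j < n) - (eta t * (chi j.+1 ^+ 2 * (g j.+1 t * r j t)))).
    rewrite !mulr_sumr -big_split/=; apply: eq_bigr => j _.
    by rewrite eqn//; ring.
  rewrite (@sum_by_parts _ n (fun j => chi j ^+ 2 * g j t)); last 2 first.
  - by rewrite chi0 expr0n mul0r.
  - by rewrite chin expr0n mul0r.
  rewrite /rhs; apply: lerD; last first.
    apply: ler_wpM2l; first exact: ltW.
    apply: ler_sum => j _; apply: le_trans (ler_norm _) _.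
    have c0 : 0 <= chi j.+1 by apply: chi_ge0 => //; exact: ech.
    rewrite normrN (normrM (eta t)) (normrM (chi _ ^+ 2)) (normrM (g _ _)).
    rewrite (ger0_norm e0) (ger0_norm (sqr_ge0 _)).
    rewrite mulrCA; apply: ler_pM; [by ge0..| |].
      by rewrite (_ : 4 = 2 * 2)%N// exprM lerXn2r ?nnegrE ?sqr_ge0//; apply: chi_le => //; exact: ech.
    apply: ler_pM; [by ge0|by ge0|by []|].
    by apply: ler_pM => //; [apply: gB => //; exact: ech|exact: rdl].
  rewrite /Ez mulr_sumr -sumrN mulr_sumr -big_split/= mulr_sumr -big_split/=.
  apply: ler_sum => j _.
  have jn : (j <= n)%N by rewrite -ltnS.
  have c0 : 0 <= chi j by apply: chi_ge0 => //; exact: leqW.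
  have c1 : 0 <= chi j.+1 by exact: chi_ge0.
  have := ler_wpM2l e0 (sqr_edge_cross (g j t) (g j.+1 t) (z j t) (z j.+1 t) jn h0).
  rewrite mulrN => /le_trans; apply.
  set Q := L * _.
  have Q0 : 0 <= Q.
    rewrite /Q; apply: mulr_ge0 => //; apply: addr_ge0; first by ge0.
    by apply: mulr_ge0; [ge0|ge0].
  rewrite mulrDr; apply: lerD; first by rewrite le_eqVlt; apply/orP; left; apply/eqP; ring.
  apply: le_trans (ler_wpM2r Q0 eHt) _.
  by rewrite le_eqVlt; apply/orP; left; apply/eqP; rewrite /Q; ring.
rewrite itgZ; last by cont.
move=> main; rewrite -(ler_pM2l d0) mulrA; apply: le_trans main _.
rewrite /rhs itgD; [|by cont..]; rewrite itgD; [|by cont..].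
rewrite itg_cst// itgZ; last by cont.
rewrite itgD; [|by cont..]; rewrite (itgZ (2 * h)^-1)//.
rewrite (itg_lin n.+1 (F := fun j t => - (eta t * (2 * ((z j.+1 t - z j t) * (g j.+1 t - g j t)))))
  (fun j => (chi j ^+ 2 + chi j.+1 ^+ 2) / 4)); last by move=> j; cont.
rewrite (itg_lin n.+1 (F := fun j t => (g j t ^+ 2 + g j.+1 t ^+ 2) / 2)
  (fun j => h * d ^+ 2 * L ^+ 2)); last by move=> j; cont.
rewrite [leRHS](_ : _ = H * L ^+ 2 / 4 * (d * h ^+ 2 * Y) +
   H * L * (L * (d * h * L ^+ 2 * G) + (2 * h)^-1 * (d * h ^+ 2 * Y)) +
   d * (L ^+ 4 * (H * (B * dlt)) * (e - c))); last by field; rewrite gt_eqF.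
apply: lerD; [apply: lerD|].
- apply: (@le_trans _ _ (H * L ^+ 2 / 4 * itg c e Ez)); last first.
    by apply: ler_wpM2l => //; ge0.
  rewrite (itg_lin n.+1 (F := fun j t => (z j.+1 t - z j t) ^+ 2)
    (fun j => chi j + chi j.+1)); last by move=> j; cont.
  rewrite mulr_sumr; apply: ler_sum => j _.
  have jn : (j <= n)%N by rewrite -ltnS.
  have c0 : 0 <= chi j by apply: chi_ge0 => //; exact: leqW.
  have c1 : 0 <= chi j.+1 by exact: chi_ge0.
  have cL0 : chi j <= L ^+ 2 := chi_le d0 (leqW jn); have cL1 : chi j.+1 <= L ^+ 2 by apply: chi_le.
  rewrite itgN; last by cont.
  rewrite (itg_by_parts_sqr ce deta ceta' (is_derive_sub (dz j.+1) (dz j)) _ ec ee) ?opprK; last by cont.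
  set I := itg c e (fun t => (z j.+1 t - z j t) ^+ 2).
  have I0 : 0 <= I by apply: itg_ge0 => t _; exact: sqr_ge0.
  have h1 : itg c e (fun t => eta' t * (z j.+1 t - z j t) ^+ 2) <= H * I.
    apply: itg_wsqr_le; [by []|by cont|] => t tt; have [_] := eH t tt.
    by apply: le_trans; exact: ler_norm.
  have cc : 0 <= (chi j ^+ 2 + chi j.+1 ^+ 2) / 4 by ge0.
  apply: le_trans (ler_wpM2l cc h1) _.
  have HI : 0 <= H * I / 4 by ge0.
  have h2 : chi j ^+ 2 + chi j.+1 ^+ 2 <= L ^+ 2 * (chi j + chi j.+1).
    rewrite mulrDr; apply: lerD; rewrite expr2; exact: ler_wpM2r.
  have := ler_wpM2l HI h2; lra.
- apply: ler_wpM2l; first by ge0.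
  apply: lerD; last by apply: ler_wpM2l => //; ge0.
  apply: (@le_trans _ _ (\sum_(j < n.+1) (h * d ^+ 2 * L ^+ 2 * G))).
    apply: ler_sum => j _; apply: ler_wpM2l; first by ge0.
    have cgj := cg j; have cgj1 := cg j.+1.
    have -> : itg c e (fun t => (g j t ^+ 2 + g j.+1 t ^+ 2) / 2) =
       2^-1 * (itg c e (fun t => g j t ^+ 2) + itg c e (fun t => g j.+1 t ^+ 2)).
      rewrite -itgD; [|by cont..]; rewrite -itgZ; last by cont.
      by apply: eq_itg => t _; rewrite mulrC.
    have := gG j (ltnW (ltn_ord j)); have := gG j.+1 (ltn_ord j); lra.
  rewrite sumr_const card_ord -mulr_natl /L.
  by rewrite le_eqVlt; apply/orP; left; apply/eqP; ring.
- rewrite -mulrA; apply: ler_wpM2l; first exact: ltW.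
  apply: ler_wpM2r; first by ge0.
  rewrite -mulr_sumr; apply: ler_wpM2l; first by ge0.
  rewrite -mulr_sumr; apply: ler_wpM2l; first by ge0.
  by rewrite -mulr_sumr; apply: ler_wpM2l.
Qed.
End GridDerivative.

Section GridWeightedGain.
Context {R : realType}.

Lemma primB (f g : R -> R) t : cts f -> cts g ->
  prim (fun t => f t - g t) t = prim f t - prim g t.
Proof. by move=> cf cg; rewrite prim.unlock !itgB//; ring. Qed.

(** A minimiser of [F] lies below the weighted mean. In this way an estimate weighted by the masses
    yields one at a single grid point. *)
Lemma weighted_min_le (m F : nat -> R) k1 k2 : (forall j, 0 <= m j) -> (k1 < k2)%N ->
  exists2 j, (k1 <= j < k2)%N &
    F j * \sum_(k1 <= l < k2) m l <= \sum_(k1 <= l < k2) m l * F l.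
Proof.
move=> m0 k12.
have [j jk jmin] : exists2 j, (k1 <= j < k2)%N & forall l, (k1 <= l < k2)%N -> F j <= F l.
  elim: k2 k12 => [//|k IH]; rewrite ltnS leq_eqVlt => /predU1P[->|k1k].
    by exists k; [lia|move=> l lk; have -> : l = k by lia].
  have [j jk jmin] := IH k1k.
  have [Fjk|Fkj] := leP (F j) (F k).
    exists j; first by lia.
    by move=> l lk; have [->//|lk'] := eqVneq l k; apply: jmin; lia.
  exists k; first by lia.
  move=> l lk; have [->//|lk'] := eqVneq l k.
  by apply: le_trans (ltW Fkj) _; apply: jmin; lia.
exists j => //; rewrite mulr_sumr big_nat_cond [leRHS]big_nat_cond.
apply: ler_sum => l; rewrite andbT => lk; rewrite mulrC.
by apply: ler_wpM2l => //; exact: jmin.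
Qed.

Lemma sum_nat_sub_le (F : nat -> R) n k1 k2 : (forall j, 0 <= F j) -> (k2 <= n)%N ->
  \sum_(k1 <= l < k2) F l <= \sum_(j < n) F j.
Proof.
move=> F0 kn; rewrite -(big_mkord xpredT F) /=.
have [k12|k21] := leqP k1 k2; last first.
  by rewrite big_geq ?sumr_ge0// ltnW.
rewrite [leRHS](@big_cat_nat _ _ _ k1)//=; last exact: leq_trans kn.
rewrite [X in _ + X](@big_cat_nat _ _ _ k2)//=.
by rewrite addrCA lerDl addr_ge0// sumr_ge0.
Qed.

(** The semi-discrete heat equation. As in [lapl], the mass [m j] and the defect [r j] belong to the
    inner point [j.+1]. The factor is [d] and not [d ^+ 2], so that [m j] is a mass and not a
    density: its sums remain bounded as the mesh tends to 0. *)
Record grid_solution (n : nat) (d c e : R) (w w' : nat -> R -> R)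
    (m dl : nat -> R) (r : nat -> R -> R) (B N : R) : Prop := GridSolution {
  gs_deriv : forall i (t : R), is_derive t 1 (w i) (w' i t) ;
  gs_cont' : forall i, cts (w' i) ;
  gs_contr : forall j, cts (r j) ;
  gs_mass : forall j, 0 <= m j ;
  gs_eqn : forall j t, (j < n)%N -> c <= t <= e ->
     lapl (w ^~ t) j = d * (2 * (m j * w' j.+1 t) + r j t) ;
  gs_defect : forall j t, (j < n)%N -> c <= t <= e -> `|r j t| <= dl j ;
  gs_bound : forall i t, (i <= n.+1)%N -> c <= t <= e -> `|w i t| <= B ;
  gs_norm : forall i, (i <= n.+1)%N -> itg c e (fun t => w i t ^+ 2) <= N }.

Lemma grid_diff_norm (w : nat -> R -> R) i (c e tau h N : R) : (forall i, cts (w i)) -> 0 < h <= tau ->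
  c + 2 * tau <= e - 2 * tau -> itg c e (fun t => w i t ^+ 2) <= N ->
  itg (c + 2 * tau) (e - 2 * tau) (fun t => (w i (t + h) - w i t) ^+ 2) <= 4 * N.
Proof.
move=> cw /andP[h0 ht] ce wN; have cwi := cw i.
have cw2 : cts (fun t => w i t ^+ 2) by cont.
apply: (@le_trans _ _ (itg (c + 2 * tau) (e - 2 * tau)
    (fun t => 2 * w i (t + h) ^+ 2 + 2 * w i t ^+ 2))).
  apply: itg_le; [by cont..|] => t _.
  by rewrite -subr_ge0 (_ : _ - _ = (w i (t + h) + w i t) ^+ 2) ?sqr_ge0//; ring.
rewrite itgD; [|by cont..]; rewrite !itgZ; [|by cont..].
rewrite (itg_shift h cw2 ce).
have b c' e' : c <= c' -> e' <= e -> itg c' e' (fun t => w i t ^+ 2) <= N.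
  move=> cc ee; apply: le_trans wN; apply: itg_subint => //.
  by move=> t _; exact: sqr_ge0.
have := b (c + 2 * tau) (e - 2 * tau); have := b (c + 2 * tau + h) (e - 2 * tau + h).
have -> : c <= c + 2 * tau + h by lra.
have -> : e - 2 * tau + h <= e by lra.
have -> : c <= c + 2 * tau by lra.
have -> : e - 2 * tau <= e by lra.
by move=> /(_ isT isT) b1 /(_ isT isT) b2; lra.
Qed.

(** The Caccioppoli inequality for [w] bounds the edge energy of the window integrals [z], and
    [time_derivative_bound] for [z] then bounds the increments [g] of [w]. Each time cutoff costs a
    margin [tau], and a third one is spent on windows of length [h <= tau]. *)
Lemma grid_weighted_gain n (d c e : R) w w' m dl r (B N L H M dlt tau h QA : R) :
  0 < d -> n.+1%:R * d = L -> 0 < tau -> 0 < h <= tau -> c + 4 * tau <= e - 4 * tau ->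
  H = (e - c) ^+ 2 + (e - c) -> 0 <= B ->
  @grid_solution n d c e w w' m dl r B N ->
  \sum_(j < n) m j <= M -> \sum_(j < n) dl j <= dlt ->
  QA = 2 * L * H * N + 2 * L ^+ 2 * H * M * N + 2 * L ^+ 2 * H * B * dlt * (e - c) ->
  2 * tau ^+ 2 * (\sum_(j < n) chi n d j.+1 ^+ 2 * (m j *
     itg (c + 3 * tau) (e - 3 * tau) (fun t => (w j.+1 (t + h) - w j.+1 t) ^+ 2)))
  <= H * (L ^+ 2 * h ^+ 2 * (QA / tau ^+ 2) / 4
       + L * (h * L ^+ 3 * (4 * N) + h * (QA / tau ^+ 2) / 2)
       + L ^+ 4 * (2 * B) * (h * dlt) * (e - c)).
Proof.
move=> d0 nL t0 /andP[h0 ht] ce HE B0 [dw cw' cr m0 eqn rdl wB wN] mM dlM QAE.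
have cw i : cts (w i) by exact: is_derive_cont (dw i).
have ce0 : c <= e by lra.
have T0 : 0 <= e - c by lra.
have H0 : 0 <= H by rewrite HE; ge0.
have t2 : 0 < tau ^+ 2 by rewrite exprn_gt0.
have wbd (c' e' t : R) : c <= c' -> e' <= e -> c' <= t <= e' ->
    0 <= window c' e' t <= H /\ `|dwindow c' e' t| <= H.
  move=> cc ee tt; have eT : e' - c' <= e - c by lra.
  have [/andP[w0 w1] w2] := window_bounds eT tt.
  rewrite w0/= HE; split; first by apply: le_trans w1 _; rewrite lerDl.
  by apply: le_trans w2 _; rewrite lerDr sqr_ge0.
pose E t := \sum_(j < n.+1) (chi n d j + chi n d j.+1) * (w j.+1 t - w j t) ^+ 2.
have cE : cts E by rewrite /E; cont.
have E0 t : 0 <= E t.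
  apply: sumr_ge0 => j _; apply: mulr_ge0; last exact: sqr_ge0.
  by apply: addr_ge0; apply: chi_ge0 => //; exact: ltnW.
have stepA : tau ^+ 2 * itg (c + tau) (e - tau) E <= d * QA.
  apply: le_trans (itg_window_ge cE (ltW t0) _) _; first by move=> t _.
  rewrite QAE -nL.
  apply: (edge_energy_bound d0 ce0 dw cw' cr m0 eqn rdl wB wN
    (window_is_derive c e) (dwindow_cont c e)) => //.
  - by rewrite /window subrr mul0r.
  - by rewrite /window subrr mulr0.
  - by move=> t tt; exact: wbd.
pose z i t := prim (w i) (t + h) - prim (w i) t.
pose g i t := w i (t + h) - w i t.
pose s j t := prim (r j) (t + h) - prim (r j) t.
have cp (f : R -> R) : cts f -> cts (prim f) by exact: prim_cont.
have dz i (t : R) : is_derive t 1 (z i) (g i t).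
  have dp (u : R) : is_derive u 1 (prim (w i)) (w i u) by exact: prim_is_derive.
  exact: (is_derive_sub (is_derive_translate h dp) dp t).
have cg i : cts (g i) by rewrite /g; have := cw i => ?; cont.
have cs j : cts (s j) by rewrite /s; have := cp _ (cr j) => ?; cont.
have itgz (f : R -> R) (t : R) : cts f -> prim f (t + h) - prim f t = itg t (t + h) f.
  by move=> cf; rewrite itg_prim// lerDl ltW.
set c2 := c + 2 * tau; set e2 := e - 2 * tau.
have c2e2 : c2 <= e2 by rewrite /c2 /e2; lra.
(* Integrating the equation of [w] over a window of length [h] turns the term with [w'] into the
   increment [g]. *)
have seqn j t : (j < n)%N -> c2 <= t <= e2 ->
    lapl (z ^~ t) j = d * (2 * (m j * g j.+1 t) + s j t).
  move=> jn tt; rewrite /lapl /z /s /g.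
  have th : t <= t + h by rewrite lerDl ltW.
  rewrite !itgz// -(itg_FTC (dw j.+1) (cw' j.+1) th).
  have -> : itg t (t + h) (w j.+2) - 2 * itg t (t + h) (w j.+1) + itg t (t + h) (w j)
     = itg t (t + h) (fun u => lapl (w ^~ u) j).
    have cw0 := cw j; have cw1 := cw j.+1; have cw2 := cw j.+2.
    rewrite -itgZ; last by cont.
    rewrite -itgB; [|by cont..]; rewrite -itgD; [|by cont..].
    by apply: eq_itg.
  have cw1 := cw' j.+1; have cr1 := cr j.
  rewrite -!itgZ; [|by cont..]; rewrite -itgD; [|by cont..]; rewrite -itgZ; last by cont.
  apply: eq_itg => u /andP[tu uth]; rewrite eqn//.
  by move: tt => /andP[]; rewrite /c2 /e2 => *; lra.
have sdl j t : (j < n)%N -> c2 <= t <= e2 -> `|s j t| <= h * dl j.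
  move=> jn tt; rewrite /s itgz//; have crj := cr j.
  have th : t <= t + h by rewrite lerDl ltW.
  apply: le_trans (itg_abs _ _ crj) _.
  have -> : h * dl j = dl j * (t + h - t) by ring.
  rewrite -itg_cst//; apply: itg_le; [by cont|by cont|] => u /andP[tu uth].
  by apply: rdl => //; move: tt => /andP[]; rewrite /c2 /e2 => *; lra.
have gB i t : (i <= n.+1)%N -> c2 <= t <= e2 -> `|g i t| <= 2 * B.
  move=> ni /andP[]; rewrite /c2 /e2 => ct te; apply: le_trans (ler_normB _ _) _.
  have -> : 2 * B = B + B by ring.
  by apply: lerD; apply: wB => //; lra.
have gN i : (i <= n.+1)%N -> itg c2 e2 (fun t => g i t ^+ 2) <= 4 * N.
  by move=> ni; apply: grid_diff_norm => //; [rewrite h0|exact: wN].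
have zY : itg c2 e2 (fun t => \sum_(j < n.+1) (chi n d j + chi n d j.+1) * (z j.+1 t - z j t) ^+ 2)
    <= d * h ^+ 2 * (QA / tau ^+ 2).
  have cz i : cts (z i) by exact: is_derive_cont (dz i).
  apply: (@le_trans _ _ (h ^+ 2 * itg (c + tau) (e - tau) E)); last first.
    rewrite [leRHS](_ : _ = h ^+ 2 * ((d * QA) / tau ^+ 2)); last by field; rewrite gt_eqF.
    apply: ler_wpM2l; first exact: sqr_ge0.
    by rewrite ler_pdivlMr// mulrC.
  rewrite /E (itg_lin n.+1 (F := fun j t => (z j.+1 t - z j t) ^+ 2)
     (fun j => chi n d j + chi n d j.+1)); last by move=> j; cont.
  rewrite (itg_lin n.+1 (F := fun j t => (w j.+1 t - w j t) ^+ 2)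
     (fun j => chi n d j + chi n d j.+1)); last by move=> j; cont.
  rewrite mulr_sumr; apply: ler_sum => j _; rewrite mulrCA; apply: ler_wpM2l.
    by apply: addr_ge0; apply: chi_ge0 => //; exact: ltnW.
  have cwj := cw j; have cwj1 := cw j.+1.
  have cdw : cts (fun t => w j.+1 t - w j t) by cont.
  have -> : (fun t => (z j.+1 t - z j t) ^+ 2) = fun t =>
     (prim (fun t => w j.+1 t - w j t) (t + h) - prim (fun t => w j.+1 t - w j t) t) ^+ 2.
    by apply/funext => t; rewrite /z !primB//; congr (_ ^+ 2); ring.
  apply: le_trans (itg_window_sqr cdw c2e2 (ltW h0)) _.
  apply: ler_wpM2l; first exact: sqr_ge0.
  apply: itg_subint; [by cont|by move=> t _; exact: sqr_ge0| |]; rewrite /c2 /e2; lra.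
have sM : \sum_(j < n) h * dl j <= h * dlt by rewrite -mulr_sumr; apply: ler_wpM2l => //; exact: ltW.
have c2c : c <= c2 by rewrite /c2; lra.
have e2e : e2 <= e by rewrite /e2; lra.
have B20 : 0 <= 2 * B by ge0.
have stepB := @time_derivative_bound R n d d0 z g m (fun j => h * dl j) s
  (window c2 e2) (dwindow c2 e2) c2 e2 H (4 * N) (2 * B) h (QA / tau ^+ 2) (h * dlt)
  c2e2 h0 dz cg cs m0 seqn sdl gB gN zY (window_is_derive c2 e2) (dwindow_cont c2 e2).
rewrite nL in stepB.
have w1 : window c2 e2 c2 = 0 by rewrite /window subrr mul0r.
have w2 : window c2 e2 e2 = 0 by rewrite /window subrr mulr0.
have {}stepB := stepB w1 w2 (fun t => @wbd c2 e2 t c2c e2e) sM B20 H0.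
apply: (@le_trans _ _ (H * (L ^+ 2 * h ^+ 2 * (QA / tau ^+ 2) / 4 +
   L * (h * L ^+ 3 * (4 * N) + h * (QA / tau ^+ 2) / 2) + L ^+ 4 * (2 * B) * (h * dlt) * (e2 - c2)))).
  apply: le_trans stepB; rewrite -mulrA; apply: ler_wpM2l => //.
  pose G t := \sum_(j < n) chi n d j.+1 ^+ 2 * (m j * g j.+1 t ^+ 2).
  have cG : cts G by rewrite /G; cont.
  have := itg_window_ge cG (ltW t0) (c := c2) (e := e2).
  have -> : c2 + tau = c + 3 * tau by rewrite /c2; ring.
  have -> : e2 - tau = e - 3 * tau by rewrite /e2; ring.
  have G0 t : c2 <= t <= e2 -> 0 <= G t.
    by move=> _; apply: sumr_ge0 => j _; apply: mulr_ge0; ge0.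
  move=> /(_ G0); apply: le_trans; apply: ler_wpM2l; first exact: ltW.
  rewrite /G (itg_lin n (F := fun j t => m j * g j.+1 t ^+ 2) (fun j => chi n d j.+1 ^+ 2)); last by move=> j; cont.
  apply: ler_sum => j _; apply: ler_wpM2l; first exact: sqr_ge0.
  by have := cg j.+1 => ?; rewrite itgZ//; cont.
apply: ler_wpM2l => //; rewrite lerD2l; apply: ler_wpM2l; last by lra.
have dl0 : 0 <= dlt.
  apply: le_trans dlM; apply: sumr_ge0 => j _.
  by apply: le_trans (rdl j c (ltn_ord j) _); rewrite // lexx.
by have hh := ltW h0; have L0 : 0 <= L ^+ 4 by [rewrite (_ : 4 = 2 * 2)%N// exprM sqr_ge0]; ge0.
Qed.
End GridWeightedGain.

Section GridGain.
Context {R : realType}.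

(** Almost convexity in [x] of the localised norm. The second difference of [g ^+ 2] is
    [2 g (lapl g)] plus squares, which are dropped; the equation makes the first part a time
    derivative of [m g ^+ 2], moved onto the window, and a defect. The lower bound thus involves the
    norm of [g] only in a product with the mass. *)
Lemma lapl_window_energy n (d c e : R) g g' m dl r (B N H : R) j :
  0 < d -> c <= e -> 0 <= B ->
  (forall t, c <= t <= e -> 0 <= window c e t <= H /\ `|dwindow c e t| <= H) ->
  @grid_solution R n d c e g g' m dl r B N -> (j < n)%N ->
  - (d * (2 * H * (m j * itg c e (fun t => g j.+1 t ^+ 2)) + 2 * H * B * (e - c) * dl j)) <=
  lapl (fun i => itg c e (fun t => window c e t * g i t ^+ 2)) j.
Proof.
move=> d0 ce B0 wH [dg cg' cr m0 eqn rdl gB gN] jn.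
have cg i : cts (g i) by exact: is_derive_cont (dg i).
have cw := window_cont c e; have cdw := dwindow_cont c e.
have g0 := cg j; have g1 := cg j.+1; have g2 := cg j.+2; have g1' := cg' j.+1.
have H0 : 0 <= H.
  have [/andP[w0 wh] _] : 0 <= window c e c <= H /\ `|dwindow c e c| <= H.
    by apply: wH; rewrite lexx.
  exact: le_trans wh.
have dl0 : 0 <= dl j by apply: le_trans (rdl j c jn _); rewrite // lexx.
have -> : lapl (fun i => itg c e (fun t => window c e t * g i t ^+ 2)) j =
    itg c e (fun t => window c e t * g j.+2 t ^+ 2 - 2 * (window c e t * g j.+1 t ^+ 2)
      + window c e t * g j t ^+ 2).
  rewrite /lapl itgD; [|by cont..]; rewrite itgB; [|by cont..].
  by rewrite [in RHS]itgZ//; cont.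
pose lo t := d * (2 * m j * (window c e t * (2 * (g j.+1 t * g' j.+1 t)))) +
             d * (- (2 * (H * (B * dl j)))).
apply: (@le_trans _ _ (itg c e lo)); last first.
  apply: itg_le; [by rewrite /lo; cont|by cont|] => t tt.
  have [/andP[w0 wh] _] := wH t tt.
  have -> : window c e t * g j.+2 t ^+ 2 - 2 * (window c e t * g j.+1 t ^+ 2) + window c e t * g j t ^+ 2
    = window c e t * (2 * (g j.+1 t * lapl (g ^~ t) j)) +
      window c e t * ((g j.+2 t - g j.+1 t) ^+ 2 + (g j.+1 t - g j t) ^+ 2).
    by rewrite /lapl; ring.
  have sq : 0 <= window c e t * ((g j.+2 t - g j.+1 t) ^+ 2 + (g j.+1 t - g j t) ^+ 2) by ge0.
  apply: le_trans (_ : _ <= window c e t * (2 * (g j.+1 t * lapl (g ^~ t) j))) _; last by lra.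
  rewrite eqn// /lo.
  have -> : window c e t * (2 * (g j.+1 t * (d * (2 * (m j * g' j.+1 t) + r j t)))) =
    d * (2 * m j * (window c e t * (2 * (g j.+1 t * g' j.+1 t)))) +
    d * (2 * (window c e t * (g j.+1 t * r j t))) by ring.
  rewrite lerD2l; apply: ler_wpM2l; first exact: ltW.
  rewrite lerNl -mulrN; apply: ler_wpM2l => //.
  apply: le_trans (ler_norm _) _; rewrite normrN (normrM (window _ _ _)) (normrM (g _ _)) (ger0_norm w0).
  apply: ler_pM => //; apply: ler_pM => //; last exact: rdl.
  by apply: gB => //; rewrite ltnS ltnW.
rewrite /lo itgD; [|by cont..]; rewrite itg_cst// !itgZ; [|by cont..].
rewrite (itg_by_parts_sqr ce (window_is_derive c e) cdw (dg j.+1) (cg' j.+1)); last 2 first.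
- by rewrite /window subrr mul0r.
- by rewrite /window subrr mulr0.
have h1 : itg c e (fun t => dwindow c e t * g j.+1 t ^+ 2) <= H * itg c e (fun t => g j.+1 t ^+ 2).
  by apply: itg_wsqr_le => // t tt; have [_] := wH t tt; apply: le_trans; exact: ler_norm.
have dm : 0 <= d * (2 * m j) by have := m0 j => mj; ge0.
have := ler_wpM2l dm h1; lra.
Qed.

(** In each of the two blocks of mass at least [mu], the weighted gain provides one grid point with
    a small norm of the increment. Between these points the norm is almost convex, and its total
    convexity defect is again controlled by the weighted gain. The constant is chosen before the
    grid and the solution, so it survives the limit of vanishing mesh. *)
Lemma grid_gain (L M mu kap tau c e : R) : 0 < L -> 0 <= M -> 0 < mu -> 0 < kap -> 0 < tau ->
  c + 4 * tau <= e - 4 * tau ->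
  exists2 C, 0 <= C & forall n d w w' m dl r B N dlt h k1 k2 k3 k4,
  0 < d -> n.+1%:R * d = L -> 0 < h <= tau -> 0 <= B ->
  @grid_solution R n d c e w w' m dl r B N ->
  \sum_(j < n) m j <= M -> \sum_(j < n) dl j <= dlt ->
  (k1 < k2)%N -> (k2 <= k3)%N -> (k3 < k4)%N -> (k4 <= n)%N ->
  (forall j, (k1 <= j < k4)%N -> kap <= chi n d j.+1 ^+ 2) ->
  mu <= \sum_(k1 <= j < k2) m j -> mu <= \sum_(k3 <= j < k4) m j ->
  forall i, (k2 <= i <= k3.+1)%N ->
  itg (c + 4 * tau) (e - 4 * tau) (fun t => (w i (t + h) - w i t) ^+ 2)
    <= C * (h * N + B * dlt).
Proof.
move=> L0 M0 mu0 kap0 t0 ce.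
pose T := e - c; have T0 : 0 <= T by rewrite /T; lra.
pose H := T ^+ 2 + T; have H0 : 0 <= H by rewrite /H; ge0.
have t2 : 0 < tau ^+ 2 by rewrite exprn_gt0.
pose a1 := 2 * L * H + 2 * L ^+ 2 * H * M; have a10 : 0 <= a1 by rewrite /a1; ge0.
pose a2 := 2 * L ^+ 2 * H * T; have a20 : 0 <= a2 by rewrite /a2; ge0.
pose ca := a1 + tau * a2; have ca0 : 0 <= ca by rewrite /ca; ge0.
have L4 : 0 <= L ^+ 4 by apply: exprn_ge0; exact: ltW.
pose CB := H * ((L ^+ 2 * tau / tau ^+ 2 / 4 + L / tau ^+ 2 / 2) * ca + 4 * L ^+ 4 +
   2 * L ^+ 4 * T * tau).
have CB0 : 0 <= CB by rewrite /CB; ge0.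
pose CC := CB / (2 * tau ^+ 2); have CC0 : 0 <= CC by rewrite /CC; ge0.
pose CS := 2 * H * (CC / kap) + 8 * H * T; have CS0 : 0 <= CS by rewrite /CS; ge0.
exists ((H * (CC / (kap * mu)) + L * CS) / tau ^+ 2); first by ge0.
move=> n d w w' m dl r B N dlt h k1 k2 k3 k4 d0 nL h0t B0 gs mM dlM k12 k23 k34 k4n kapP mu1 mu2 i ik.
have /andP[h0 ht] := h0t.
pose QA := 2 * L * H * N + 2 * L ^+ 2 * H * M * N + 2 * L ^+ 2 * H * B * dlt * (e - c).
have gain := grid_weighted_gain d0 nL t0 h0t ce (erefl H) B0 gs mM dlM (erefl QA).
have [dw cw' cr m0 eqn rdl wB wN] := gs.
have cw k : cts (w k) by exact: is_derive_cont (dw k).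
have N0 : 0 <= N by apply: le_trans (wN 0%N _) => //; apply: itg_ge0 => t _; exact: sqr_ge0.
have dl0 j : (j < n)%N -> 0 <= dl j.
  by move=> jn; apply: le_trans (rdl j c jn _); rewrite // lexx/=; clear -ce t0; lra.
have dlt0 : 0 <= dlt by apply: le_trans dlM; apply: sumr_ge0 => j _; exact: dl0.
set X := h * N + B * dlt.
have X0 : 0 <= X by rewrite /X; ge0.
set c3 := c + 3 * tau; set e3 := e - 3 * tau.
have c3e3 : c3 <= e3 by rewrite /c3 /e3; clear -ce t0; lra.
pose g k t := w k (t + h) - w k t.
pose g' k t := w' k (t + h) - w' k t.
pose s j t := r j (t + h) - r j t.
pose K k := itg c3 e3 (fun t => g k t ^+ 2).
have K0 k : 0 <= K k by apply: itg_ge0 => t _; exact: sqr_ge0.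
have gainX : \sum_(j < n) chi n d j.+1 ^+ 2 * (m j * K j.+1) <= CC * X.
  rewrite /CC mulrAC ler_pdivlMr ?mulr_gt0// mulrC; apply: le_trans gain _.
  rewrite /CB -[leRHS]mulrA; apply: ler_wpM2l => //.
  have hQA : h * QA <= ca * X.
    have -> : h * QA = a1 * (h * N) + h * (a2 * (B * dlt)) by rewrite /QA /a1 /a2 /T; ring.
    have -> : ca * X = a1 * X + tau * (a2 * X) by rewrite /ca; ring.
    apply: lerD.
      by apply: ler_wpM2l => //; rewrite /X lerDl; ge0.
    apply: ler_pM; [by ge0|by ge0|by []|].
    by apply: ler_wpM2l => //; rewrite /X lerDr; ge0.
  have QA0 : 0 <= QA by rewrite /QA; ge0.
  rewrite [leLHS](_ : _ = (L ^+ 2 * h / tau ^+ 2 / 4 + L / tau ^+ 2 / 2) * (h * QA)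
     + 4 * L ^+ 4 * (h * N) + 2 * L ^+ 4 * T * h * (B * dlt)); last first.
    by rewrite /T; field; rewrite gt_eqF.
  rewrite [leRHS](_ : _ = (L ^+ 2 * tau / tau ^+ 2 / 4 + L / tau ^+ 2 / 2) * (ca * X)
     + 4 * L ^+ 4 * X + 2 * L ^+ 4 * T * tau * X); last by ring.
  apply: lerD; [apply: lerD|].
  - apply: ler_pM; [by ge0|by ge0| |exact: hQA].
    rewrite lerD2r; apply: ler_wpM2r => //; apply: ler_wpM2r; first by ge0.
    by apply: ler_wpM2l; first by ge0.
  - by apply: ler_wpM2l; [ge0|rewrite /X lerDl; ge0].
  - apply: ler_pM; [by ge0|by ge0| |by rewrite /X lerDr; ge0].
    by apply: ler_wpM2l => //; ge0.
have gs2 : @grid_solution R n d c3 e3 g g' m (fun j => 2 * dl j) s (2 * B) (4 * N).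
  have cs := is_derive_translate h.
  split.
  - by move=> k t; exact: (is_derive_sub (is_derive_translate h (dw k)) (dw k) t).
  - by move=> k; have := cw' k; rewrite /g' => ?; cont.
  - by move=> j; have := cr j; rewrite /s => ?; cont.
  - exact: m0.
  - move=> j t jn /andP[]; rewrite /c3 /e3 => tc te.
    have e1 : lapl (w ^~ (t + h)) j = d * (2 * (m j * w' j.+1 (t + h)) + r j (t + h)) by apply: eqn => //; clear -h0 ht tc te t0; lra.
    have e2 : lapl (w ^~ t) j = d * (2 * (m j * w' j.+1 t) + r j t) by apply: eqn => //; clear -h0 ht tc te t0; lra.
    rewrite /g' /s [RHS](_ : _ = d * (2 * (m j * w' j.+1 (t + h)) + r j (t + h)) -
       d * (2 * (m j * w' j.+1 t) + r j t)); last by ring.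
    by rewrite -e1 -e2 /lapl /g; ring.
  - move=> j t jn /andP[]; rewrite /c3 /e3 => tc te; apply: le_trans (ler_normB _ _) _.
    by rewrite mulr2n mulrDl mul1r; apply: lerD; apply: rdl => //; clear -h0 ht tc te t0; lra.
  - move=> k t kn /andP[]; rewrite /c3 /e3 => tc te; apply: le_trans (ler_normB _ _) _.
    by rewrite mulr2n mulrDl mul1r; apply: lerD; apply: wB => //; clear -h0 ht tc te t0; lra.
  - move=> k kn; have ck := cw k.
    have ce2 : c + 2 * tau <= e - 2 * tau by clear -ce t0; lra.
    apply: le_trans (grid_diff_norm cw h0t ce2 (wN k kn)).
    apply: itg_subint; [by rewrite /g; cont|by move=> t _; exact: sqr_ge0| |]; rewrite /c3 /e3; clear -t0; lra.
have cg k : cts (g k) by have := cw k; rewrite /g => ?; cont.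
have wbd t : c3 <= t <= e3 -> 0 <= window c3 e3 t <= H /\ `|dwindow c3 e3 t| <= H.
  move=> tt; have eT : e3 - c3 <= T by rewrite /e3 /c3 /T; clear -t0; lra.
  have [/andP[w0 w1] w2] := window_bounds eT tt.
  rewrite w0/= /H; split; first by apply: le_trans w1 _; rewrite lerDl.
  by apply: le_trans w2 _; rewrite lerDr sqr_ge0.
pose f k := itg c3 e3 (fun t => window c3 e3 t * g k t ^+ 2).
have fK k : f k <= H * K k.
  by apply: itg_wsqr_le => //; [exact: window_cont|move=> t tt; have [/andP[]] := wbd t tt].
have B20 : 0 <= 2 * B by ge0.
have flap j := @lapl_window_energy n d c3 e3 g g' m (fun j => 2 * dl j) s (2 * B) (4 * N) H j d0 c3e3 B20 wbd gs2.
have massK a b : (k1 <= a)%N -> (b <= k4)%N -> kap * \sum_(a <= j < b) m j * K j.+1 <= CC * X.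
  move=> ka bk; apply: le_trans gainX.
  apply: (@le_trans _ _ (\sum_(a <= j < b) chi n d j.+1 ^+ 2 * (m j * K j.+1))).
    rewrite mulr_sumr big_nat_cond [leRHS]big_nat_cond; apply: ler_sum => j; rewrite andbT => jab.
    apply: ler_wpM2r; first by apply: mulr_ge0.
    by apply: kapP; clear -jab ka bk; lia.
  apply: (sum_nat_sub_le (F := fun j => chi n d j.+1 ^+ 2 * (m j * K j.+1))); last exact: leq_trans k4n.
  by move=> j; apply: mulr_ge0; [exact: sqr_ge0|exact: mulr_ge0].
have sel a b : (k1 <= a)%N -> (b <= k4)%N -> (a < b)%N -> mu <= \sum_(a <= j < b) m j ->
    exists2 j, (a <= j < b)%N & f j.+1 <= H * (CC / (kap * mu)) * X.
  move=> ka bk ab muab; have [j jab jmin] := weighted_min_le (fun j => K j.+1) m0 ab.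
  exists j => //; apply: le_trans (fK _) _; rewrite -mulrA; apply: ler_wpM2l => //.
  rewrite mulrAC ler_pdivlMr ?mulr_gt0// mulrCA.
  apply: le_trans (massK a b ka bk); apply: ler_wpM2l; first exact: ltW.
  by apply: le_trans jmin; apply: ler_wpM2l.
(* One good point in each block; [i] lies between [j1.+1] and [j2.+1]. *)
have [j1 j1k f1] := sel k1 k2 (leqnn _) (leq_trans k23 (ltnW k34)) k12 mu1.
have [j2 j2k f2] := sel k3 k4 (leq_trans (ltnW k12) k23) (leqnn _) k34 mu2.
(* The convexity defect of [f]. The default 0 makes it nonnegative beyond the grid, where nothing is
   known about [dl]. *)
pose b j := if (j < n)%N then 2 * H * (m j * K j.+1) + 2 * H * (2 * B) * (e3 - c3) * (2 * dl j) else 0.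
have b0 j : 0 <= b j.
  rewrite /b; case: ifP => // jn; have mj := m0 j; have dj := dl0 j jn; have Kj := K0 j.+1.
  by ge0.
have bS k : (j1.+1 <= k)%N -> (k < j2.+1)%N -> \sum_(j1.+1 <= j < k) b j <= CS * X.
  move=> jk kj.
  have -> : \sum_(j1.+1 <= j < k) b j = 2 * H * \sum_(j1.+1 <= j < k) m j * K j.+1
     + (2 * H * (2 * B) * (e3 - c3) * 2) * \sum_(j1.+1 <= j < k) (if (j < n)%N then dl j else 0).
    rewrite !mulr_sumr -big_split/= big_nat_cond [RHS]big_nat_cond.
    apply: eq_bigr => j; rewrite andbT => jjk.
    by have jn : (j < n)%N by [clear -jjk kj j2k k4n; lia]; rewrite /b jn; ring.
  have -> : CS * X = 2 * H * (CC / kap * X) + 8 * H * T * X by rewrite /CS; ring.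
  apply: lerD.
    apply: ler_wpM2l; first by ge0.
    by rewrite mulrAC ler_pdivlMr// mulrC; apply: massK; clear -j1k j2k kj; lia.
  apply: (@le_trans _ _ (2 * H * (2 * B) * (e3 - c3) * 2 * dlt)).
    apply: ler_wpM2l; first by ge0.
    apply: (@le_trans _ _ (\sum_(j < n) (if (j < n)%N then dl j else 0))).
      apply: (sum_nat_sub_le (F := fun j => if (j < n)%N then dl j else 0)); last by clear -kj j2k k4n; lia.
      by move=> j; case: ifP => // /dl0.
    by under eq_bigr => j _ do rewrite ltn_ord.
  apply: (@le_trans _ _ (8 * H * T * (B * dlt))); last first.
    by apply: ler_wpM2l; [ge0|rewrite /X lerDr; ge0].
  rewrite [leLHS](_ : _ = 8 * H * (B * dlt) * (e3 - c3)); last by ring.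
  rewrite [leRHS](_ : _ = 8 * H * (B * dlt) * T); last by ring.
  by apply: ler_wpM2l; [ge0|rewrite /e3 /c3 /T; clear -t0; lra].
have iq : (j1.+1 <= i <= j2.+1)%N by clear -ik j1k j2k; lia.
have CSX : 0 <= CS * X by exact: mulr_ge0.
have conv : forall j, (j1.+1 <= j)%N -> (j.+1 < j2.+1)%N -> - (d * b j) <= lapl f j.
  move=> j _ jj; have jn : (j < n)%N by clear -jj j2k k4n; lia.
  by rewrite /b jn; exact: flap.
have := almost_convex_le (ltW d0) b0 conv bS CSX f1 f2 iq.
move=> fi; rewrite mulrAC ler_pdivlMr// mulrC.
apply: (@le_trans _ _ (f i)).
  have cgi := cg i; have := @itg_window_ge R (fun t => g i t ^+ 2) c3 e3 tau.
  have -> : c3 + tau = c + 4 * tau by rewrite /c3; ring.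
  have -> : e3 - tau = e - 4 * tau by rewrite /e3; ring.
  by apply; [cont|exact: ltW|move=> t _; exact: sqr_ge0].
apply: le_trans fi _.
have -> : (H * (CC / (kap * mu)) + L * CS) * X = H * (CC / (kap * mu)) * X + L * (CS * X) by ring.
apply: lerD => //; apply: ler_wpM2r => //; rewrite -nL; apply: ler_wpM2r; first exact: ltW.
by rewrite ler_nat; clear -j2k k4n; lia.
Qed.
End GridGain.

(** * Local gain of regularity in time *)

Lemma dist_split {R : realType} (u v w r d : R) :
  `|u - v| < r / 2 -> `|v - w| <= d -> d < r / 2 -> `|u - w| < r.
Proof. by have := ler_normD (u - v) (v - w); rewrite addrA subrK; lra. Qed.

Lemma dist_half {R : realType} (u v w r : R) :
  `|u - v| < r / 2 -> `|u - w| < r / 2 -> `|v - w| <= r.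
Proof.
by have := ler_normD (v - u) (u - w); rewrite addrA subrK (distrC v u); lra.
Qed.

(** Only [x] is confined to the segment, and [y] may leave it. Compactness is therefore applied to
    neighbourhoods of the points of the rectangle, with [d] tending to 0 from the right, and not to
    the restriction of [F]. *)
Lemma uniform_cont_fst {R : realType} (F : R -> R -> R) (a b c e eps : R) :
  cts (fun p => F p.1 p.2) -> 0 < eps ->
  exists2 d, 0 < d & forall x y t, a <= x <= b -> c <= t <= e -> `|x - y| <= d ->
    `|F x t - F y t| <= eps.
Proof.
move=> [cF] e0.
have /compact_near_coveringP H := compact_setX (@segment_compact R a b) (@segment_compact R c e).
have e20 : 0 < eps / 2 by rewrite divr_gt0.
have := H R (0^'+) (fun d p => forall y, `|p.1 - y| <= d -> `|F p.1 p.2 - F y p.2| <= eps) _.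
case.
  move=> [x t] _ /=.
  have /cvgrPdist_lt /(_ _ e20) [[U V] /= [Ux Vt] UV] := cF (x, t).
  move/nbhs_ballP : Ux => [r /= r0 rU].
  exists (ball x (r / 2) `*` V, [set d | d < r / 2]); first split => //=.
  - exists (ball x (r / 2), V) => //; split => //=.
    by apply/nbhs_ballP; exists (r / 2) => //=; rewrite divr_gt0.
  - by apply: nbhs_right_lt; rewrite divr_gt0.
  move=> [[x' t'] d] [/= [xx' Vt'] dr] y xy.
  move: xx' dr xy; rewrite /ball/= => xx' dr xy.
  have B z : `|x - z| < r -> `|F x t - F z t'| < eps / 2.
    move=> xz; have := UV (z, t'); apply; split => //=.
    by apply: rU; rewrite /ball/=.
  apply: dist_half (B x' _) (B y _); last exact: dist_split xx' xy dr.
  by apply: lt_trans xx' _; lra.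
move=> r r0 rP; have d0 : 0 < r / 2 by rewrite divr_gt0.
exists (r / 2) => // x y t xab tce xy.
have br : ball_ [eta Num.Def.normr] 0 r (r / 2).
  by rewrite /= sub0r normrN gtr0_norm//; move: (r0) => /=; lra.
by apply: (rP (r / 2) br d0 (x, t)) => //=; rewrite !in_itv.
Qed.

Lemma bounded_rect {R : realType} (F : R -> R -> R) (a b c e : R) :
  cts (fun p => F p.1 p.2) ->
  exists2 B, 0 <= B & forall x t, a <= x <= b -> c <= t <= e -> `|F x t| <= B.
Proof.
move=> [cF].
have K := compact_setX (@segment_compact R a b) (@segment_compact R c e).
have /compact_bounded[M [_ mrt]] := continuous_compact (continuous_subspaceT cF) K.
exists (`|M| + 1) => [|x t xab tce]; first by rewrite addr_ge0.
apply: (mrt (`|M| + 1)); first by rewrite ltr_pwDr// ler_norm.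
by exists (x, t).
Qed.

(** * Integration against the speed measure and its discretisation by tents *)

Section LocallyFinite.
Context {R : realType} (m : {measure set R -> \bar R}).
Hypothesis m_locfin : locally_finite [set: R] m.

Lemma segment_finite (A B : R) : (m [set` `[A, B]] < +oo)%E.
Proof.
have /choice[f fP] : forall x : R, exists U, open_nbhs x U /\ (m U < +oo)%E.
  by move=> x; have [U ? ?] := m_locfin (x := x) I; exists U.
have := @segment_compact R A B; rewrite compact_cover.
move=> /(_ R setT f) [i _|x _|X _ Xc]; first by have [[]] := fP i.
  by exists x => //; have [[]] := fP x.
have fin (s : seq R) : measurable (\big[setU/set0]_(i <- s) f i) /\
    (m (\big[setU/set0]_(i <- s) f i) < +oo)%E.
  elim: s => [|x s [ms fs]]; first by rewrite big_nil measure0.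
  have [[ox _] fx] := fP x; have mx := open_measurable ox.
  rewrite big_cons; split; first exact: measurableU.
  by apply: le_lt_trans (measureU2 _ _ _) _ => //; rewrite lte_add_pinfty.
have [mX fX] := fin (finmap.enum_fset X).
apply: le_lt_trans fX; apply: le_measure; rewrite ?inE//.
by move=> x /Xc; rewrite /cover bigcup_fset.
Qed.

Lemma m_integrable (f : R -> R) (A B : R) : cts f -> m.-integrable `[A, B] (EFin \o f).
Proof.
move=> [cf]; apply: measurable_bounded_integrable => //.
- exact: segment_finite.
- by apply: measurable_funTS; exact: continuous_measurable_fun.
have /compact_bounded := continuous_compact (continuous_subspaceT cf) (@segment_compact R A B).
by move=> [M [Mr mrt]]; exists M; split => // M' /mrt h x Ax; apply: h; exists x.
Qed.

Definition mitg (A B : R) (f : R -> R) : R := \int[m]_(y in `[A, B]) f y.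

Lemma mitgD f g A B : cts f -> cts g ->
  mitg A B (fun y => f y + g y) = mitg A B f + mitg A B g.
Proof. by move=> cf cg; apply: RintegralD => //; exact: m_integrable. Qed.

Lemma mitgB f g A B : cts f -> cts g ->
  mitg A B (fun y => f y - g y) = mitg A B f - mitg A B g.
Proof. by move=> cf cg; apply: RintegralB => //; exact: m_integrable. Qed.

Lemma mitgZ k f A B : cts f -> mitg A B (fun y => k * f y) = k * mitg A B f.
Proof. by move=> cf; apply: RintegralZl => //; exact: m_integrable. Qed.

Lemma mitg_le f g A B : cts f -> cts g ->
  (forall y, A <= y <= B -> f y <= g y) -> mitg A B f <= mitg A B g.
Proof.
move=> cf cg fg; apply: le_Rintegral; [by []|exact: m_integrable..|].
by move=> t; rewrite /= in_itv/=; exact: fg.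
Qed.

Lemma mitg_ge0 f A B : (forall y, A <= y <= B -> 0 <= f y) -> 0 <= mitg A B f.
Proof. by move=> f0; apply: Rintegral_ge0 => t; rewrite /= in_itv/=; exact: f0. Qed.

Lemma mitg_abs f A B : cts f -> `|mitg A B f| <= mitg A B (fun y => `|f y|).
Proof. by move=> cf; apply: le_normr_Rintegral => //; exact: m_integrable. Qed.

Lemma eq_mitg f g A B : (forall y, A <= y <= B -> f y = g y) -> mitg A B f = mitg A B g.
Proof. by move=> fg; apply: eq_Rintegral => t; rewrite inE/= in_itv/=; exact: fg. Qed.

Lemma mitg_cst k A B : mitg A B (fun=> k) = k * fine (m [set` `[A, B]]).
Proof. by rewrite /mitg Rintegral_cst. Qed.

Lemma mitg_sum n (F : nat -> R -> R) k1 A B : (forall i, cts (F i)) ->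
  mitg A B (fun t => \sum_(k1 <= i < n) F i t) = \sum_(k1 <= i < n) mitg A B (F i).
Proof.
move=> cF; have [k1n|nk1] := leqP k1 n; last first.
  rewrite big_geq ?(ltnW nk1)// -[RHS](mul0r (fine (m [set` `[A, B]]))) -mitg_cst.
  by apply: eq_mitg => y _; rewrite big_geq ?(ltnW nk1).
elim: n k1n => [|n IH] k1n.
  rewrite big_geq// -[RHS](mul0r (fine (m [set` `[A, B]]))) -mitg_cst.
  by apply: eq_mitg => y _; rewrite big_geq.
move: k1n; rewrite leq_eqVlt => /predU1P[->|k1n].
  rewrite big_geq// -[RHS](mul0r (fine (m [set` `[A, B]]))) -mitg_cst.
  by apply: eq_mitg => y _; rewrite big_geq.
rewrite big_nat_recr//= -IH// -mitgD//; last by cont.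
by apply: eq_mitg => t _; rewrite big_nat_recr.
Qed.

Lemma mitg_supp f A B A' B' : cts f -> A <= A' -> B' <= B ->
  (forall y, ~~ (A' <= y <= B') -> f y = 0) -> mitg A B f = mitg A' B' f.
Proof.
move=> cf AA BB f0; rewrite /mitg Rintegral_mkcond [RHS]Rintegral_mkcond.
congr (Rintegral _ _ _); apply/funext => y; rewrite !patchE !mem_setE !in_itv/=.
have [yAB|] := boolP (A' <= y <= B'); last by move/f0 => ->; rewrite !if_same.
by case/andP: yAB => Ay yB; rewrite (le_trans AA Ay) (le_trans yB BB).
Qed.

(** A tent of slope 1, whose second distributional derivative is the sum of unit masses at [d] and
    [- d] minus twice the unit mass at 0. Pairing [U_xx] with it gives a second difference of step
    [d]. *)
Definition hat (d u : R) : R := Num.max (d - `|u|) 0.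

(** Solutions of [2 m w_t = w_xx] with continuous [w_t], where the equation is tested with tents.
    The functions are defined for all real times, which keeps the calculus global, but the equation
    is required at positive times only. *)
Record sol (w wt : R -> R -> R) : Prop := Sol {
  sol_cont : cts (fun p => w p.1 p.2) ;
  sol_cont' : cts (fun p => wt p.1 p.2) ;
  sol_deriv : forall x t : R, is_derive t 1 (w x) (wt x t) ;
  sol_eqn : forall x d t A B, 0 < d -> 0 < t -> A <= x - d -> x + d <= B ->
    w (x + d) t - 2 * w x t + w (x - d) t =
    2 * mitg A B (fun y => hat d (y - x) * wt y t) }.
End LocallyFinite.

(** The form in which meshes and mollification lengths tend to 0 below; the restriction [w <= 1]
    allows squares of [w] to be absorbed as well. *)
Lemma le_of_le_addZ {R : realType} (I X K : R) :
  (forall w, 0 < w <= 1 -> I <= X + w * K) -> I <= X.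
Proof.
move=> H; apply/ler_addgt0Pr => eps e0.
pose w := Num.min 1 (eps / (`|K| + 1)).
have K1 : 0 < `|K| + 1 by rewrite ltr_wpDl.
have w0 : 0 < w by rewrite lt_min ltr01/= divr_gt0.
have w1 : w <= 1 by rewrite ge_min lexx.
have := H w; rewrite w0 w1 => /(_ isT)/le_trans; apply.
rewrite lerD2l; apply: (@le_trans _ _ (w * (`|K| + 1))).
  by apply: ler_wpM2l; [exact: ltW|have := ler_norm K; lra].
by rewrite -ler_pdivlMr// ge_min lexx orbT.
Qed.

Lemma grid_floor {R : realType} (d y : R) : 0 < d -> 0 <= y ->
  exists k : nat, k%:R * d <= y < k.+1%:R * d.
Proof.
move=> d0 y0; exists (Num.truncn (y / d)).
have := truncn_itv (divr_ge0 y0 (ltW d0)).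
by rewrite ler_pdivlMr// ltr_pdivrMr.
Qed.

Section Hat.
Context {R : realType} (m : {measure set R -> \bar R}).
Hypothesis m_locfin : locally_finite [set: R] m.

Lemma hat_cont (d x : R) : cts (fun y => hat d (y - x)).
Proof. by rewrite /hat; cont. Qed.

Lemma hat_ge0 (d u : R) : 0 <= hat d u.
Proof. by rewrite /hat le_max lexx orbT. Qed.

Lemma hat_eq0 (d u : R) : d <= `|u| -> hat d u = 0.
Proof. by move=> du; rewrite /hat max_r// subr_le0. Qed.

Lemma hatE (d u : R) : 0 <= d ->
  hat d u = Num.max (u + d) 0 - 2 * Num.max u 0 + Num.max (u - d) 0.
Proof.
move=> d0; rewrite /hat.
by have [u0|u0] := leP 0 u; [rewrite ger0_norm//|rewrite ltr0_norm//];
  rewrite !maxEle; repeat (case: ifP => ?); lra.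
Qed.

(** Each tent is a second difference of the positive part, so the sum telescopes to a difference of
    two first differences. Divided by [d], the tents form a partition of unity away from the
    ends. *)
Lemma sum_hat (a d y : R) k1 k2 : 0 <= d -> (k1 <= k2)%N ->
  let p j := Num.max (y - (a + j%:R * d)) 0 in
  \sum_(k1 <= j < k2) hat d (y - (a + j.+1%:R * d)) =
  (p k1 - p k1.+1) - (p k2 - p k2.+1).
Proof.
move=> d0 k12 p; pose f j := - (p j - p j.+1).
rewrite (_ : _ - _ = f k2 - f k1); last by rewrite /f; ring.
rewrite -(telescope_sumr _ k12); apply: eq_bigr => j _.
rewrite hatE// /f /p -[j.+2%:R]natr1 -[j.+1%:R]natr1.
rewrite (_ : y - (a + (j%:R + 1) * d) + d = y - (a + j%:R * d)); last by ring.
rewrite (_ : y - (a + (j%:R + 1) * d) - d = y - (a + (j%:R + 1 + 1) * d)); last by ring.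
by ring.
Qed.

Lemma sum_hat_le (a d y : R) k1 k2 : 0 <= d -> (k1 <= k2)%N ->
  \sum_(k1 <= j < k2) hat d (y - (a + j.+1%:R * d)) <= d.
Proof.
move=> d0 k12; rewrite sum_hat//.
have b j : 0 <= Num.max (y - (a + j%:R * d)) 0 - Num.max (y - (a + j.+1%:R * d)) 0 <= d.
  rewrite -natr1 mulrDl mul1r !maxEle; repeat (case: ifP => ?); lra.
by have := b k1; have := b k2; lra.
Qed.

Lemma sum_hat_eq (a d y : R) k1 k2 : 0 <= d -> (k1 < k2)%N ->
  a + k1.+1%:R * d <= y -> y <= a + k2%:R * d ->
  \sum_(k1 <= j < k2) hat d (y - (a + j.+1%:R * d)) = d.
Proof.
move=> d0 k12 y1 y2; rewrite sum_hat ?(ltnW k12)//.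
move: y1 y2; rewrite -!natr1 !mulrDl !mul1r !maxEle.
by repeat (case: ifP => ?); lra.
Qed.

Lemma mitg_subint (f : R -> R) A B A' B' : cts f -> (forall y, 0 <= f y) -> A <= A' -> B' <= B ->
  mitg m A' B' f <= mitg m A B f.
Proof.
move=> cf f0 AA BB; rewrite /mitg /Rintegral fine_le//.
- by apply: integrable_fin_num => //; exact: m_integrable.
- by apply: integrable_fin_num => //; exact: m_integrable.
apply: ge0_subset_integral => //.
- by have /integrableP[] := m_integrable m_locfin A B cf.
- by move=> y _; rewrite lee_fin.
- by move=> y; rewrite /= !in_itv/= => /andP[Ay yB]; rewrite (le_trans AA Ay) (le_trans yB BB).
Qed.

(** The share of the mass of [m] given to the grid point [a + j.+1%:R * d] by the partition of unity
    into tents. *)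
Definition hat_mass (a b d : R) (j : nat) := mitg m a b (fun y => hat d (y - (a + j.+1%:R * d))) / d.

Lemma hat_mass_ge0 a b d j : 0 < d -> 0 <= hat_mass a b d j.
Proof.
by move=> d0; rewrite /hat_mass divr_ge0 ?(ltW d0)// mitg_ge0// => y _; exact: hat_ge0.
Qed.

Lemma sum_hat_mass a b d k1 k2 : 0 < d ->
  \sum_(k1 <= j < k2) hat_mass a b d j =
  mitg m a b (fun y => \sum_(k1 <= j < k2) hat d (y - (a + j.+1%:R * d))) / d.
Proof.
move=> d0; rewrite (@mitg_sum R m m_locfin k2 (fun j y => hat d (y - (a + j.+1%:R * d)))).
  by rewrite mulr_suml.
by move=> i; exact: hat_cont.
Qed.

Lemma sum_hat_mass_le a b d n : 0 < d ->
  \sum_(j < n) hat_mass a b d j <= fine (m [set` `[a, b]]).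
Proof.
move=> d0; rewrite -(big_mkord xpredT (hat_mass a b d)) sum_hat_mass//.
rewrite ler_pdivrMr// mulrC -mitg_cst; apply: mitg_le => //.
- by apply: cont_sum => i; exact: hat_cont.
- exact: cont_cst.
- by move=> y _; apply: sum_hat_le => //; exact: ltW.
Qed.

Lemma sum_hat_mass_ge a b d k1 k2 l1 l2 : 0 < d -> (k1 < k2)%N -> a <= l1 -> l2 <= b ->
  a + k1.+1%:R * d <= l1 -> l2 <= a + k2%:R * d ->
  fine (m [set` `[l1, l2]]) <= \sum_(k1 <= j < k2) hat_mass a b d j.
Proof.
move=> d0 k12 al lb kl lk; rewrite sum_hat_mass// ler_pdivlMr// mulrC -mitg_cst.
have cs : cts (fun y => \sum_(k1 <= j < k2) hat d (y - (a + j.+1%:R * d))).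
  by apply: cont_sum => i; exact: hat_cont.
apply: le_trans (mitg_subint cs _ al lb); last by move=> y; apply: sumr_ge0 => j _; exact: hat_ge0.
apply: mitg_le => //; first exact: cont_cst.
move=> y /andP[ly yl]; rewrite sum_hat_eq//; [exact: ltW|exact: le_trans ly|exact: le_trans lk].
Qed.

(** Replacing [wt y] by its value at the centre of the tent costs at most the oscillation of [wt] at
    scale [d] times the mass of the tent. Summed over the grid, the defect is thus a multiple of
    [om] times the total mass. *)
Lemma sol_defect w wt a b c e d om j : sol m w wt -> 0 < c -> 0 < d ->
  a <= a + j.+1%:R * d - d -> a + j.+1%:R * d + d <= b ->
  (forall x y t, a <= x <= b -> c <= t <= e -> `|x - y| <= d -> `|wt x t - wt y t| <= om) ->
  forall t, c <= t <= e ->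
  `|(w (a + j.+1%:R * d + d) t - 2 * w (a + j.+1%:R * d) t + w (a + j.+1%:R * d - d) t) / d
    - 2 * (hat_mass a b d j * wt (a + j.+1%:R * d) t)| <= 2 * om * hat_mass a b d j.
Proof.
move=> [cw cwt dw eqn] c0 d0; set x := a + _ * d => xa xb mod t tt.
have t0 : 0 < t by case/andP: tt => ct _; exact: lt_le_trans ct.
have cwtt : cts (fun y => wt y t) by cont.
have ch := hat_cont d x.
rewrite (eqn x d t a b)// /hat_mass -/x.
set h := fun y => hat d (y - x).
have -> : 2 * mitg m a b (fun y => h y * wt y t) / d - 2 * (mitg m a b h / d * wt x t)
   = 2 / d * mitg m a b (fun y => h y * wt y t - wt x t * h y).
  rewrite mitgB//; [|by apply: contM|by apply: contM => //; exact: cont_cst].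
  by rewrite mitgZ//; ring.
rewrite normrM gtr0_norm ?divr_gt0//.
rewrite (_ : 2 * om * _ = 2 / d * (om * mitg m a b h)); last by ring.
apply: ler_wpM2l; first by rewrite divr_ge0 ?ltW.
have c1 : cts (fun y => h y * wt y t - wt x t * h y).
  by apply: contD; [exact: contM|apply: contN; apply: contM => //; exact: cont_cst].
apply: le_trans (mitg_abs _ _ _ c1) _ => //.
rewrite -mitgZ//; apply: mitg_le => //; first exact: contabs.
  by apply: contM => //; exact: cont_cst.
move=> y yab; rewrite mulrC -mulrBl normrM (ger0_norm (hat_ge0 _ _)).
have [yx|yx] := leP `|y - x| d.
  by apply: ler_wpM2r; [exact: hat_ge0|exact: mod].
by rewrite /h hat_eq0 ?mulr0// ltW.
Qed.
End Hat.

Lemma ltn_mulr_nat {R : realType} (d : R) (i j : nat) : 0 < d -> i%:R * d < j%:R * d -> (i < j)%N.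
Proof. by move=> d0; rewrite ltr_pM2r// ltr_nat. Qed.

(** The layers [[l1, l2]] and [[l3, l4]] keep a distance 1/2 from the ends and from [[al, be]], and
    the mesh is at most 1/8. This leaves room to round [k1, k3] down and [k2, k4] up, so that the
    tents of a block sum to [d] on its layer, while all points stay 1/4 away from the ends, where
    [chi] is at least 1/16. *)
Lemma grid_layers {R : realType} (a l1 l2 al be l3 l4 b d : R) n :
  0 < d -> d <= 8^-1 -> n.+1%:R * d = b - a ->
  a + 2^-1 <= l1 -> l1 <= l2 -> l2 + 2^-1 <= al -> al <= be -> be + 2^-1 <= l3 ->
  l3 <= l4 -> l4 + 2^-1 <= b ->
  exists k1 k2 k3 k4, [/\ [/\ (k1 < k2)%N, (k2 <= k3)%N, (k3 < k4)%N & (k4 <= n)%N],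
    (forall j, (k1 <= j < k4)%N -> 16^-1 ^+ 2 <= chi n d j.+1 ^+ 2),
    a + k1.+1%:R * d <= l1 /\ l2 <= a + k2%:R * d,
    a + k3.+1%:R * d <= l3 /\ l4 <= a + k4%:R * d &
    forall x, al <= x <= be -> exists2 i, (k2 <= i <= k3.+1)%N &
      a + i%:R * d <= x < a + i%:R * d + d].
Proof.
move=> d0 d8 nL al1 l12 l2a alb bl3 l34 l4b.
have S (k : nat) : k.+1%:R * d = k%:R * d + d by rewrite -natr1 mulrDl mul1r.
have fl y : d <= y -> exists k : nat, k.+1%:R * d <= y < k.+2%:R * d.
  move=> dy; have y0 : 0 <= y - d by lra.
  by have [k /andP[k1 k2]] := grid_floor d0 y0; exists k; move: k1 k2; rewrite !S; lra.
have [k1 /andP[k1a k1b]] : exists k : nat, k.+1%:R * d <= l1 - a < k.+2%:R * d by apply: fl; lra.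
have [k2 /andP[k2a k2b]] : exists k : nat, k.+1%:R * d <= l2 - a < k.+2%:R * d by apply: fl; lra.
have [k3 /andP[k3a k3b]] : exists k : nat, k.+1%:R * d <= l3 - a < k.+2%:R * d by apply: fl; lra.
have [k4 /andP[k4a k4b]] : exists k : nat, k.+1%:R * d <= l4 - a < k.+2%:R * d by apply: fl; lra.
exists k1, k2.+2, k3, k4.+2; split.
- split.
  + by apply: ltnW; apply: (ltn_mulr_nat d0); lra.
  + rewrite -ltnS -(ltn_add2r 1) !addn1; apply: (ltn_mulr_nat d0); move: k2a k3b; rewrite !S; lra.
  + by apply: ltnW; apply: (ltn_mulr_nat d0); lra.
  + by apply: (ltn_mulr_nat d0); move: k4a nL; rewrite !S; lra.
- move=> j /andP[kj jk].
  have lo : 4^-1 <= j.+1%:R * d.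
    have : k1%:R * d <= j%:R * d by rewrite ler_pM2r// ler_nat.
    by move: k1b; rewrite !S; lra.
  have hi : j.+1%:R * d <= b - a - 4^-1.
    have : j.+1%:R * d <= k4.+2%:R * d by rewrite ler_pM2r// ler_nat.
    by move: k4a; rewrite !S; lra.
  rewrite lerXn2r ?nnegrE// /chi nL; first by apply: mulr_ge0; lra.
  have -> : 16^-1 = 4^-1 * 4^-1 :> R by field.
  by apply: ler_pM; lra.
- by split; lra.
- by split; lra.
- move=> x /andP[ax xb]; have xa : 0 <= x - a by lra.
  have [i /andP[i1 i2]] := grid_floor d0 xa.
  exists i; last by move: i2; rewrite S; lra.
  apply/andP; split.
    by rewrite -ltnS; apply: (ltn_mulr_nat d0); move: k2a; rewrite !S in i2 *; lra.
  by rewrite -ltnS; apply: (ltn_mulr_nat d0); move: k3b; rewrite !S; lra.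
Qed.

Section SolGain.
Context {R : realType} (m : {measure set R -> \bar R}).
Hypothesis m_locfin : locally_finite [set: R] m.

(** [grid_gain] in the limit of vanishing mesh. The bound [B] and the moduli of continuity depend on
    the solution, but they only occur in terms that tend to 0, so [C] does not depend on [w]. *)
Lemma sol_gain_layers (a l1 l2 al be l3 l4 b tau c e : R) :
  a + 2^-1 <= l1 -> l1 <= l2 -> l2 + 2^-1 <= al -> al <= be -> be + 2^-1 <= l3 ->
  l3 <= l4 -> l4 + 2^-1 <= b ->
  0 < fine (m [set` `[l1, l2]]) -> 0 < fine (m [set` `[l3, l4]]) ->
  0 < c -> 0 < tau -> c + 4 * tau <= e - 4 * tau ->
  exists2 C, 0 <= C & forall w wt N h x, sol m w wt ->
    (forall x, a <= x <= b -> itg c e (fun t => w x t ^+ 2) <= N) ->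
    0 < h <= tau -> al <= x <= be ->
    itg (c + 4 * tau) (e - 4 * tau) (fun t => (w x (t + h) - w x t) ^+ 2) <= C * (h * N).
Proof.
move=> al1 l12 l2a alb bl3 l34 l4b ml mr c0 t0 ce.
pose M := fine (m [set` `[a, b]]); have M0 : 0 <= M by exact: fine_ge0.
pose L := b - a; have L0 : 0 < L by rewrite /L; lra.
pose mu := Num.min (fine (m [set` `[l1, l2]])) (fine (m [set` `[l3, l4]])).
have mu0 : 0 < mu by rewrite lt_min ml mr.
have kap0 : 0 < 16^-1 ^+ 2 :> R by rewrite exprn_gt0.
have [C C0 gain] := grid_gain L0 M0 mu0 kap0 t0 ce.
exists (2 * C); first exact: mulr_ge0.
move=> w wt N h x sw wN ht xab; have [cw cwt dw eqn] := sw; have /andP[h0 htau] := ht.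
have [B B0 wB] := bounded_rect a b c e cw.
pose T := e - c; have T0 : 0 <= T by rewrite /T; lra.
(* The constant collects the defect, [2 * C * (B * (2 * om * M))], and the passage from [x] to a
   grid point, [8 * om ^+ 2] per unit of time. *)
apply: (@le_of_le_addZ _ _ _ (4 * C * B * M + 8 * T)) => om /andP[om0 om1].
have [d1 d10 mod1] := uniform_cont_fst a b c e cw om0.
have [d2 d20 mod2] := uniform_cont_fst a b c e cwt om0.
pose dl := Num.min (Num.min d1 d2) 8^-1.
have dl0 : 0 < dl by rewrite !lt_min d10 d20/= invr_gt0.
have [n /andP[_ nlt]] := grid_floor dl0 (ltW L0).
pose d := L / n.+1%:R.
have n0 : 0 < n.+1%:R :> R by [].
have d0 : 0 < d by rewrite divr_gt0.
have ddl : d <= dl by rewrite /d ler_pdivrMr// mulrC; exact: ltW.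
have [dd1 dd2 d8] : [/\ d <= d1, d <= d2 & d <= 8^-1].
  by move: ddl; rewrite !le_min => /andP[/andP[]].
have nL : n.+1%:R * d = L by rewrite /d mulrC divfK ?gt_eqF.
have {}mod1 x' y t : a <= x' <= b -> c <= t <= e -> `|x' - y| <= d -> `|w x' t - w y t| <= om.
  by move=> *; apply: mod1 => //; exact: le_trans dd1.
have {}mod2 x' y t : a <= x' <= b -> c <= t <= e -> `|x' - y| <= d -> `|wt x' t - wt y t| <= om.
  by move=> *; apply: mod2 => //; exact: le_trans dd2.
have [k1 [k2 [k3 [k4 [[k12 k23 k34 k4n] kapP [k1l k2l] [k3l k4l] xP]]]]] :=
  grid_layers d0 d8 nL al1 l12 l2a alb bl3 l34 l4b.
have [i ik /andP[ix xi]] := xP x xab.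
pose X j := a + j%:R * d.
have S (k : nat) : k.+1%:R * d = k%:R * d + d by rewrite -natr1 mulrDl mul1r.
have Xab j : (j <= n.+1)%N -> a <= X j <= b.
  move=> jn; have : j%:R * d <= n.+1%:R * d by rewrite ler_pM2r// ler_nat.
  have : 0 <= j%:R * d by rewrite mulr_ge0// ltW.
  by rewrite nL /L /X; clear; lra.
pose r j t := (w (X j.+1 + d) t - 2 * w (X j.+1) t + w (X j.+1 - d) t) / d
    - 2 * (hat_mass m a b d j * wt (X j.+1) t).
have dwX j : forall t : R, is_derive t 1 (w (X j)) (wt (X j) t) by exact: dw.
have gs : grid_solution n d c e (fun j => w (X j)) (fun j => wt (X j)) (hat_mass m a b d)
    (fun j => 2 * om * hat_mass m a b d j) r B N.
  split.
  - exact: dwX.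
  - by move=> j; cont.
  - by move=> j; rewrite /r; cont.
  - by move=> j; exact: hat_mass_ge0.
  - move=> j t jn tt; rewrite /lapl /r.
    have -> : X j.+1 + d = X j.+2 by rewrite /X (S j.+1); ring.
    have -> : X j.+1 - d = X j by rewrite /X S; ring.
    by field; rewrite gt_eqF.
  - move=> j t jn tt; have /andP[aj jb] := Xab j (leqW (ltnW jn)).
    have /andP[aj2 jb2] := Xab j.+2 jn.
    apply: (sol_defect m_locfin sw c0 d0 _ _ mod2 tt).
      by move: aj; rewrite /X S; clear; lra.
    by move: jb2; rewrite /X (S j.+1); clear; lra.
  - by move=> j t jn; apply: wB; exact: Xab.
  - by move=> j jn; apply: wN; exact: Xab.
have mM : \sum_(j < n) hat_mass m a b d j <= M by exact: sum_hat_mass_le.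
have dM : \sum_(j < n) 2 * om * hat_mass m a b d j <= 2 * om * M.
  by rewrite -mulr_sumr; apply: ler_wpM2l => //; rewrite mulr_ge0// ltW.
have a_l1 : a <= l1 by clear -al1; lra.
have l2_b : l2 <= b by clear -l2a alb bl3 l34 l4b; lra.
have a_l3 : a <= l3 by clear -al1 l12 l2a alb bl3; lra.
have l4_b : l4 <= b by clear -l4b; lra.
have mu1 : mu <= \sum_(k1 <= j < k2) hat_mass m a b d j.
  apply: le_trans (sum_hat_mass_ge m_locfin d0 k12 a_l1 l2_b k1l k2l).
  by rewrite ge_min lexx.
have mu2 : mu <= \sum_(k3 <= j < k4) hat_mass m a b d j.
  apply: le_trans (sum_hat_mass_ge m_locfin d0 k34 a_l3 l4_b k3l k4l).
  by rewrite ge_min lexx orbT.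
have main := gain n d _ _ _ _ _ B N (2 * om * M) h k1 k2 k3 k4 d0 nL ht B0 gs mM dM k12 k23 k34 k4n
  kapP mu1 mu2 i ik.
set c4 := c + 4 * tau in main *; set e4 := e - 4 * tau in main *.
have c4e4 : c4 <= e4 by [].
have cx := cw; have cwx y : cts (w y) by cont.
apply: (@le_trans _ _ (itg c4 e4 (fun t => 2 * (w (X i) (t + h) - w (X i) t) ^+ 2 + 8 * om ^+ 2))).
  apply: itg_le; [by cont|by cont|] => t /andP[ct te].
  set u := w x (t + h) - w x t; set v := w (X i) (t + h) - w (X i) t.
  have xab' : a <= x <= b.
    by move: xab; clear -al1 l12 l2a alb bl3 l34 l4b; lra.
  have xX : `|x - X i| <= d.
    by rewrite ler_norml /X; clear -ix xi; apply/andP; split; lra.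
  have tce : c <= t <= e by move: ct te; rewrite /c4 /e4; clear -t0; lra.
  have thce : c <= t + h <= e by move: ct te; rewrite /c4 /e4; clear -t0 h0 htau; lra.
  have m1 := mod1 x (X i) t xab' tce xX; have m2 := mod1 x (X i) (t + h) xab' thce xX.
  have uv : `|u - v| <= 2 * om.
    rewrite (_ : u - v = (w x (t + h) - w (X i) (t + h)) - (w x t - w (X i) t)); last first.
      by rewrite /u /v; ring.
    by apply: le_trans (ler_normB _ _) _; clear -m1 m2; lra.
  have uv2 : (u - v) ^+ 2 <= 4 * om ^+ 2.
    rewrite -[X in X <= _]real_normK ?num_real// (_ : 4 * _ = (2 * om) ^+ 2); last by ring.
    by rewrite lerXn2r ?nnegrE//; rewrite mulr_ge0// ltW.
  have := sqr_ge0 (u - 2 * v); clear -uv2; clearbody u v.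
  have -> : u ^+ 2 = 2 * v ^+ 2 + 2 * (u - v) ^+ 2 - (u - 2 * v) ^+ 2 by ring.
  lra.
rewrite itgD; [|by cont..]; rewrite itgZ; last by cont.
rewrite itg_cst//.
have e4c4 : e4 - c4 <= T by rewrite /e4 /c4 /T; clear -t0; lra.
have om2 : om ^+ 2 <= om by rewrite expr2 ger_pMr.
have -> : 2 * C * (h * N) + om * (4 * C * B * M + 8 * T) =
  2 * (C * (h * N + B * (2 * om * M))) + 8 * om * T by ring.
apply: lerD; first by apply: ler_wpM2l.
have e4c40 : 0 <= e4 - c4 by rewrite subr_ge0.
apply: ler_pM => //; first by rewrite mulr_ge0// sqr_ge0.
by apply: ler_wpM2l.
Qed.
End SolGain.

(** * Existence and continuity of the time derivative *)

Section Marchaud.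
Context {R : realType}.
Implicit Types f : R -> R.

Definition dif (h : R) f (t : R) : R := f (t + h) - f t.

Lemma dif_cont h f : cts f -> cts (dif h f).
Proof. by move=> cf; rewrite /dif; cont. Qed.

Lemma itg_subint_sqr f (c e c' e' : R) : cts f -> c <= c' -> e' <= e ->
  itg c' e' (fun t => f t ^+ 2) <= itg c e (fun t => f t ^+ 2).
Proof.
move=> cf cc ee; apply: itg_subint => //; first by cont.
by move=> t _; exact: sqr_ge0.
Qed.

(** With [E] the shift by [h] and [D = E - 1], the factorisation [E^2 - 1 = D (E + 1)] and
    [(E + 1)^2 = 4 + 4 D + D^2] express [D^2] by a quarter of the second difference of step [2 h]
    and third differences. Young's inequality with factors 3/2 and 3 yields the constants. What
    matters is that 3/32 is below 1/8, the factor by which [h ^+ 3] shrinks when [h] is halved. *)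
Lemma dif2_step f (h c e c' e' K Q : R) : cts f -> 0 < h -> c <= e -> c' <= c -> e + h <= e' ->
  itg c' e' (fun t => dif h (dif h (dif h f)) t ^+ 2) <= K ->
  itg c e (fun t => dif (2 * h) (dif (2 * h) f) t ^+ 2) <= Q ->
  itg c e (fun t => dif h (dif h f) t ^+ 2) <= 3 / 32 * Q + 3 * K.
Proof.
move=> cf h0 ce cc ee d3 d2.
set D3 := dif h (dif h (dif h f)) in d3.
have cD3 : cts D3 by do 3 apply: dif_cont.
set D2 := dif (2 * h) (dif (2 * h) f) in d2.
have cD2 : cts D2 by do 2 apply: dif_cont.
have cd2 : cts (dif h (dif h f)) by do 2 apply: dif_cont.
apply: (@le_trans _ _ (itg c e (fun t => 3 / 32 * D2 t ^+ 2 +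
   (9 / 4 * D3 t ^+ 2 + 3 / 4 * D3 (t + h) ^+ 2)))).
  apply: itg_le; [by cont|by cont|] => t _.
  have -> : dif h (dif h f) t = 4^-1 * D2 t - (3 / 4 * D3 t + 1 / 4 * D3 (t + h)).
    rewrite /D2 /D3 /dif.
    have -> : t + 2 * h + 2 * h = t + h + h + h + h by ring.
    have -> : t + 2 * h = t + h + h by ring.
    by field.
  rewrite -subr_ge0; move: (D2 t) (D3 t) (D3 (t + h)) => u v z.
  have -> : 3 / 32 * u ^+ 2 + (9 / 4 * v ^+ 2 + 3 / 4 * z ^+ 2) - (4^-1 * u - (3 / 4 * v + 1 / 4 * z)) ^+ 2
    = 2 * (u / 8 + (3 / 4 * v + 1 / 4 * z)) ^+ 2 + 9 / 16 * (v - z) ^+ 2 by field.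
  by ge0.
rewrite itgD; [|by cont..]; rewrite itgZ; last by cont.
apply: lerD; first by apply: ler_wpM2l.
have cD3s : cts (fun t => D3 t ^+ 2) by cont.
rewrite itgD; [|by cont..]; rewrite !itgZ; [|by cont..].
rewrite (itg_shift h cD3s ce).
have b1 := le_trans (itg_subint_sqr cD3 (_ : c' <= c + h) (_ : e + h <= e')) d3.
have b2 := le_trans (itg_subint_sqr cD3 (_ : c' <= c) (_ : e <= e')) d3.
have := b1 _ _; have := b2 _ _; clear -h0 cc ee; lra.
Qed.

(** The step is halved repeatedly. By [dif2_step] the second differences have norm of order [h] to
    the power 3/2. Halving the step changes a first difference quotient by half a second difference
    quotient, of order [sqrt h]; these changes form a geometric series, so the quotients stay
    bounded. *)
Lemma marchaud (tau c e c' e' c0 e0 K N : R) f f' :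
  (forall t : R, is_derive t 1 f (f' t)) -> cts f' ->
  0 < tau -> c <= e -> c' <= c -> e + tau <= e' -> c0 <= c -> e + 2 * tau <= e0 ->
  0 < N -> 0 <= K ->
  itg c0 e0 (fun t => f t ^+ 2) <= N ->
  (forall h, 0 < h <= tau ->
     itg c' e' (fun t => dif h (dif h (dif h f)) t ^+ 2) <= K * h ^+ 3) ->
  itg c e (fun t => f' t ^+ 2) <= 16 * N / tau ^+ 2 + 16 * tau * (18 * N / tau ^+ 3 + 12 * K).
Proof.
move=> df cf' t0 ce cc ee c0c ee0 N0 K0 fN d3.
have cf := is_derive_cont df.
pose h n : R := tau / 2 ^+ n.
have p2 n : 0 < 2 ^+ n :> R by rewrite exprn_gt0.
have h0 n : 0 < h n by rewrite divr_gt0.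
have hS n : h n = 2 * h n.+1 by rewrite /h exprS invfM; field; rewrite gt_eqF.
have hle n : h n <= tau.
  rewrite ler_pdivrMr//; apply: ler_peMr; first exact: ltW.
  by apply: exprn_ege1; rewrite ler1n.
have h00 : h 0%N = tau by rewrite /h expr0 divr1.
have fN' c1 e1 : c0 <= c1 -> e1 <= e0 -> itg c1 e1 (fun t => f t ^+ 2) <= N.
  by move=> *; apply: le_trans fN; exact: itg_subint_sqr.
have cff : cts (fun t => f t ^+ 2) by cont.
have tau3 : 0 < tau ^+ 3 by rewrite exprn_gt0.
(* The first term covers the step [tau], where the second difference is estimated by three values of
   [f]; the second one closes the recursion, as [3 / 4 * K2 + 3 * K <= K2]. *)
pose K2 := 18 * N / tau ^+ 3 + 12 * K.
have K20 : 0 < K2 by rewrite /K2 ltr_pwDl// ?divr_gt0 ?mulr_gt0// mulr_ge0.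
have Q2 n : itg c e (fun t => dif (h n) (dif (h n) f) t ^+ 2) <= K2 * h n ^+ 3.
  elim: n => [|n IH].
    rewrite h00; apply: (@le_trans _ _ (18 * N)); last first.
      rewrite (_ : K2 * tau ^+ 3 = 18 * N + 12 * K * tau ^+ 3); last first.
        by rewrite /K2; field; rewrite gt_eqF.
      by rewrite lerDl; apply: mulr_ge0; [exact: mulr_ge0|exact: ltW].
    have cd : cts (dif tau (dif tau f)) by do 2 apply: dif_cont.
    apply: (@le_trans _ _ (itg c e (fun t => 3 * f (t + 2 * tau) ^+ 2 + (12 * f (t + tau) ^+ 2 + 3 * f t ^+ 2)))).
      apply: itg_le; [by cont|by cont|] => t _.
      rewrite /dif (_ : t + tau + tau = t + 2 * tau); last by ring.
      rewrite -subr_ge0; move: (f (t + 2 * tau)) (f (t + tau)) (f t) => u v z.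
      have -> : 3 * u ^+ 2 + (12 * v ^+ 2 + 3 * z ^+ 2) - (u - v - (v - z)) ^+ 2
        = (u - z) ^+ 2 + (u + 2 * v) ^+ 2 + (2 * v + z) ^+ 2 by ring.
      by ge0.
    rewrite itgD; [|by cont..]; rewrite itgD; [|by cont..]; rewrite !itgZ; [|by cont..].
    rewrite !(itg_shift _ cff ce).
    have := fN' (c + 2 * tau) (e + 2 * tau); have := fN' (c + tau) (e + tau); have := fN' c e.
    by clear -t0 c0c ee0; lra.
  have hn := h0 n.+1.
  have := @dif2_step f (h n.+1) c e c' e' (K * h n.+1 ^+ 3) (K2 * h n ^+ 3) cf hn ce cc.
  rewrite -hS => /(_ _ _ IH)/le_trans; apply.
  - by have := hle n.+1; clear -ee; lra.
  - by apply: d3; rewrite hn hle.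
  rewrite hS (_ : (2 * h n.+1) ^+ 3 = 8 * h n.+1 ^+ 3); last by ring.
  have K12 : 12 * K <= K2 by rewrite /K2 lerDr ltW// divr_gt0// mulr_gt0.
  have h3 : 0 <= h n.+1 ^+ 3 by rewrite exprn_ge0// ltW.
  by have := ler_wpM2r h3 K12; clear -h3; lra.
pose s n := Num.sqrt (h n).
have s0 n : 0 < s n by rewrite sqrtr_gt0.
have s2 n : s n ^+ 2 = h n by rewrite sqr_sqrtr// ltW.
pose kap := Num.sqrt K2.
have kap0 : 0 < kap by rewrite sqrtr_gt0.
have kap2 : kap ^+ 2 = K2 by rewrite sqr_sqrtr// ltW.
(* A rational lower bound for the ratio [sqrt 2]; the induction for [Q1] needs at least 5/4. *)
have sS n : 14 / 10 * s n.+1 <= s n.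
  rewrite -(@ler_pXn2r _ 2%N) ?nnegrE ?mulr_ge0 ?ltW//.
  rewrite (_ : (14 / 10 * s n.+1) ^+ 2 = 196 / 100 * h n.+1); last by rewrite -s2; field.
  by rewrite s2 (hS n); have := h0 n.+1; clear; lra.
have sle n : s n <= s 0%N.
  elim: n => // n IH; apply: le_trans IH; apply: le_trans (sS n).
  by have := s0 n.+1; clear; lra.
pose rN := Num.sqrt N.
have rN0 : 0 < rN by rewrite sqrtr_gt0.
have rN2 : rN ^+ 2 = N by rewrite sqr_sqrtr// ltW.
pose A0 := 2 * rN / tau; have A00 : 0 < A0 by rewrite /A0 divr_gt0// mulr_gt0.
(* The bounds [A - 2 * kap * s n] on the quotients start at [A0], twice the norm of [f] divided by
   [tau], and increase towards [A]. *)
pose A := A0 + 2 * kap * s 0%N.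
have An n : 0 < A - 2 * kap * s n.
  have := ler_wpM2l (ltW kap0) (sle n); rewrite /A; move: A00; clear; lra.
have Q1 n : itg c e (fun t => dif (h n) f t ^+ 2) <= ((A - 2 * kap * s n) * h n) ^+ 2.
  elim: n => [|n IH].
    rewrite /A addrK h00 /A0 divfK ?gt_eqF// exprMn rN2.
    apply: (@le_trans _ _ (itg c e (fun t => 2 * f (t + tau) ^+ 2 + 2 * f t ^+ 2))).
      apply: itg_le; [by rewrite /dif; cont|by cont|] => t _.
      by rewrite /dif -subr_ge0 (_ : _ - _ = (f (t + tau) + f t) ^+ 2) ?sqr_ge0//; ring.
    rewrite itgD; [|by cont..]; rewrite !itgZ; [|by cont..].
    rewrite !(itg_shift _ cff ce).
    have := fN' (c + tau) (e + tau); have := fN' c e.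
    by clear -t0 c0c ee0; lra.
  have hn := h0 n.+1; have sn := s0 n.+1.
  have cd1 : cts (dif (h n) f) by exact: dif_cont.
  have cd2 : cts (dif (h n.+1) (dif (h n.+1) f)) by do 2 apply: dif_cont.
  have b1 : itg c e (fun t => (2^-1 * dif (h n) f t) ^+ 2) <= ((A - 2 * kap * s n) * h n.+1) ^+ 2.
    rewrite (_ : (fun t => _) = fun t => 4^-1 * dif (h n) f t ^+ 2); last first.
      by apply/funext => t; rewrite exprMn; congr (_ * _); field.
    rewrite itgZ; last by cont.
    by move: IH; rewrite (hS n); clear; lra.
  have b2 : itg c e (fun t => (- 2^-1 * dif (h n.+1) (dif (h n.+1) f) t) ^+ 2) <= (2^-1 * kap * s n.+1 * h n.+1) ^+ 2.
    rewrite (_ : (fun t => _) = fun t => 4^-1 * dif (h n.+1) (dif (h n.+1) f) t ^+ 2); last first.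
      by apply/funext => t; rewrite exprMn; congr (_ * _); field.
    rewrite itgZ; last by cont.
    rewrite (_ : (2^-1 * kap * s n.+1 * h n.+1) ^+ 2 = 4^-1 * (K2 * h n.+1 ^+ 3)).
      by apply: ler_wpM2l.
    transitivity (4^-1 * (kap ^+ 2 * (s n.+1 ^+ 2 * h n.+1 ^+ 2))); first by field.
    by rewrite kap2 s2; ring.
  have p1 : 0 < (A - 2 * kap * s n) * h n.+1 by rewrite mulr_gt0.
  have p2' : 0 < 2^-1 * kap * s n.+1 * h n.+1 by rewrite !mulr_gt0// invr_gt0.
  have := @itg_sqr_add R (fun t => 2^-1 * dif (h n) f t)
    (fun t => - 2^-1 * dif (h n.+1) (dif (h n.+1) f) t) c e _ _ _ _ p1 p2' b1 b2.
  rewrite (_ : (fun t => (_ + _) ^+ 2) = fun t => dif (h n.+1) f t ^+ 2); last first.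
    apply/funext => t; congr (_ ^+ 2); rewrite /dif (hS n).
    have -> : t + 2 * h n.+1 = t + h n.+1 + h n.+1 by ring.
    by field.
  have c1 : cts (fun t => 2^-1 * dif (h n) f t) by cont.
  have c2 : cts (fun t => - 2^-1 * dif (h n.+1) (dif (h n.+1) f) t).
    by apply: contM => //; exact: cont_cst.
  move=> /(_ c1 c2)/le_trans; apply.
  rewrite lerXn2r ?nnegrE//; [by rewrite addr_ge0// ltW|by rewrite mulr_ge0// ltW|].
  rewrite -mulrDl ler_pM2r//.
  by have := ler_wpM2l (ltW kap0) (sS n); have := mulr_gt0 kap0 sn; clear; lra.
have AA : 2 * A ^+ 2 <= 16 * N / tau ^+ 2 + 16 * tau * K2.
  apply: (@le_trans _ _ (4 * A0 ^+ 2 + 4 * (2 * kap * s 0%N) ^+ 2)).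
    rewrite -subr_ge0 /A; set u := 2 * kap * _.
    rewrite (_ : _ - _ = 2 * (A0 - u) ^+ 2); last by ring.
    by ge0.
  rewrite [X in 4 * X](_ : _ = 4 * N / tau ^+ 2); last by rewrite /A0 -rN2; field; rewrite gt_eqF.
  rewrite (_ : (2 * kap * s 0%N) ^+ 2 = 4 * (tau * K2)); last first.
    by rewrite -kap2 -h00 -(s2 0%N); ring.
  by rewrite le_eqVlt; apply/orP; left; apply/eqP; ring.
(* Continuity replaces [f'] by a difference quotient of small step, to which [Q1] applies. The
   modulus of [f'] does not enter the bound. *)
apply: le_trans AA; apply: (@le_of_le_addZ _ _ _ (2 * (e - c))) => om /andP[om0 om1].
have cF : cts (fun p : R * R => f' p.1) by apply: cont_comp1 => //; exact: cont_fst.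
have [d d0 mod] := @uniform_cont_fst R (fun x _ => f' x) c e 0 0 om cF om0.
have [n hnd] : exists n, h n <= d.
  exists (Num.truncn (tau / d)).+1.
  have td : 0 <= tau / d by rewrite divr_ge0// ltW.
  have /andP[_] := truncn_itv td; set k := (Num.truncn _).+1 => lt1.
  rewrite ler_pdivrMr// mulrC -ler_pdivrMr//; apply: le_trans (ltW lt1) _.
  by rewrite -natrX ler_nat ltnW// ltn_expl.
have hn := h0 n.
have cd1 : cts (dif (h n) f) by exact: dif_cont.
apply: (@le_trans _ _ (itg c e (fun t => 2 / h n ^+ 2 * dif (h n) f t ^+ 2 + 2 * om ^+ 2))).
  apply: itg_le; [by cont|by cont|] => t tce.
  have th : t <= t + h n by rewrite lerDl ltW.
  have cg : cts (fun u => f' u - f' t) by cont.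
  have E : f' t - dif (h n) f t / h n = - (itg t (t + h n) (fun u => f' u - f' t) / h n).
    rewrite itgB//; [|exact: cont_cst]; rewrite itg_cst// (itg_FTC df cf' th) /dif.
    by field; rewrite gt_eqF.
  have b : `|f' t - dif (h n) f t / h n| <= om.
    rewrite E normrN normrM [X in _ * X]gtr0_norm ?invr_gt0// ler_pdivrMr//.
    apply: le_trans (itg_abs _ _ cg) _.
    rewrite [leRHS](_ : _ = om * (t + h n - t)); last by ring.
    rewrite -itg_cst//; apply: itg_le; [by cont|exact: cont_cst|] => u /andP[tu uth].
    rewrite distrC; apply: (mod t u 0) => //; first by rewrite !lexx.
    by rewrite ler_norml; move: hnd; clear -tu uth h0; have := h0 n; lra.
  have b2 : (f' t - dif (h n) f t / h n) ^+ 2 <= om ^+ 2.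
    by rewrite -[X in X <= _]real_normK ?num_real// lerXn2r ?nnegrE// ltW.
  rewrite [2 / _ * _](_ : _ = 2 * (dif (h n) f t / h n) ^+ 2); last by field; rewrite gt_eqF.
  move: b2; move: (dif (h n) f t / h n) (f' t) => u v b2.
  have := sqr_ge0 (v - 2 * u).
  have -> : (v - 2 * u) ^+ 2 = 2 * u ^+ 2 + 2 * (v - u) ^+ 2 - v ^+ 2 by ring.
  by move: b2; clear; lra.
rewrite itgD; [|by cont..]; rewrite itgZ; last by cont.
rewrite itg_cst//.
apply: lerD.
  rewrite mulrAC ler_pdivrMr ?exprn_gt0//.
  rewrite -[leRHS]mulrA ler_pM2l// -exprMn.
  apply: le_trans (Q1 n) _; rewrite lerXn2r ?nnegrE//.
  - by rewrite mulr_ge0// ltW.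
  - by rewrite mulr_ge0 ?ltW// /A addr_gt0// !mulr_gt0.
  rewrite ler_pM2r// gerBl; by rewrite !mulr_ge0// ltW.
have om2 : om ^+ 2 <= om by rewrite expr2 ger_pMr.
have ec : 0 <= e - c by rewrite subr_ge0.
by have := ler_wpM2r ec om2; clear; lra.
Qed.
End Marchaud.

Section SolDeriv.
Context {R : realType} (m : {measure set R -> \bar R}).
Hypothesis m_locfin : locally_finite [set: R] m.
Hypothesis m_unbounded : forall b : R, 0 < b ->
  (msupp m `&` `]-oo, - b] !=set0) /\ (msupp m `&` `[b, +oo[ !=set0).

Lemma msupp_segment_gt0 (p r : R) : 0 < r -> msupp m p -> 0 < fine (m [set` `[p - r, p + r]]).
Proof.
move=> r0 mp; apply: fine_gt0; rewrite segment_finite// andbT.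
have op : open_nbhs p [set` `]p - r, p + r[].
  by split; [exact: interval_open|rewrite /= in_itv/=; apply/andP; split; lra].
apply: lt_le_trans (mp _ op) _; apply: le_measure; rewrite ?inE//.
exact: subset_itv_oo_cc.
Qed.

(** Support points [p] and [q] on either side of [[al, be]], at distance at least 3, provide the two
    layers with mass. The strip [ab] is fixed before the times and the solution, so the gain can be
    iterated on nested strips. *)
Lemma sol_gain (al be : R) : al <= be -> exists ab : R * R,
  [/\ ab.1 <= al, be <= ab.2 & forall tau c e, 0 < c -> 0 < tau -> c + 4 * tau <= e - 4 * tau ->
  exists2 C, 0 <= C & forall w wt N h x, sol m w wt ->
    (forall x, ab.1 <= x <= ab.2 -> itg c e (fun t => w x t ^+ 2) <= N) ->
    0 < h <= tau -> al <= x <= be ->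
    itg (c + 4 * tau) (e - 4 * tau) (fun t => dif h (w x) t ^+ 2) <= C * (h * N)].
Proof.
move=> albe; pose b0 := `|al| + `|be| + 3.
have b00 : 0 < b0 by rewrite /b0 ltr_wpDl// addr_ge0.
have [[p [mp pb]] [q [mq qb]]] := m_unbounded b00.
have half : 0 < 2^-1 :> R by rewrite invr_gt0.
have pal : p + 3 <= al.
  have : p <= - b0 by move: pb; rewrite /= in_itv.
  by rewrite /b0; have := ler_norm (- al); have := normr_ge0 be; rewrite normrN; lra.
have qbe : be + 3 <= q.
  have : b0 <= q by move: qb; rewrite /= in_itv/= andbT.
  by rewrite /b0; have := ler_norm be; have := normr_ge0 al; lra.
exists (p - 1, q + 1); split => /=; [by lra..|] => tau c e c0 t0 ce.
have mpp := msupp_segment_gt0 half mp; have mqq := msupp_segment_gt0 half mq.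
by apply: (@sol_gain_layers R m m_locfin (p - 1) (p - 2^-1) (p + 2^-1) al be (q - 2^-1) (q + 2^-1) (q + 1)) => //; lra.
Qed.

(** Linearity and invariance under forward time shifts; this is what allows the gain to be applied
    to increments again. *)
Lemma sol_dif w wt h : 0 <= h -> sol m w wt -> sol m (fun x => dif h (w x)) (fun x => dif h (wt x)).
Proof.
move=> h0 [cw cwt dw eqn]; split.
- by rewrite /dif; cont.
- by rewrite /dif; cont.
- by move=> x t; exact: (is_derive_sub (is_derive_translate h (dw x)) (dw x) t).
- move=> x d t A B d0 t0 Ax xB.
  have th : 0 < t + h by rewrite ltr_wpDr.
  have e1 := eqn x d (t + h) A B d0 th Ax xB; have e2 := eqn x d t A B d0 t0 Ax xB.
  rewrite /dif; transitivity ((w (x + d) (t + h) - 2 * w x (t + h) + w (x - d) (t + h)) -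
    (w (x + d) t - 2 * w x t + w (x - d) t)); first by ring.
  have ch := hat_cont d x.
  rewrite e1 e2 -mulrBr -mitgB//; [|by cont..].
  by congr (2 * _); apply: eq_mitg => y _; rewrite mulrBr.
Qed.

(** Each gain contributes a factor [h] to the squared norm, so the third differences satisfy the
    hypothesis of [marchaud]. The gains use a margin of [12 * tau]; the remaining [4 * tau] makes
    room for the shifts in [marchaud]. *)
Lemma sol_deriv_bound (al be : R) : al <= be -> exists ab : R * R,
  [/\ ab.1 <= al, be <= ab.2 & forall tau c e, 0 < c -> 0 < tau -> c + 16 * tau <= e - 16 * tau ->
  exists2 C, 0 <= C & forall w wt N x, sol m w wt -> 0 < N ->
    (forall x, ab.1 <= x <= ab.2 -> itg c e (fun t => w x t ^+ 2) <= N) ->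
    al <= x <= be ->
    itg (c + 16 * tau) (e - 16 * tau) (fun t => wt x t ^+ 2) <= C * N].
Proof.
move=> albe.
have [[a1 b1] /= [a1a bb1 gain1]] := sol_gain albe.
have a1b1 : a1 <= b1 by lra.
have [[a2 b2] /= [a2a bb2 gain2]] := sol_gain a1b1.
have a2b2 : a2 <= b2 by lra.
have [[a3 b3] /= [a3a bb3 gain3]] := sol_gain a2b2.
exists (a3, b3); split => /=; [by lra..|] => tau c e c0 t0 ce.
have [C3 C30 {}gain3] : exists2 C, 0 <= C & _ := gain3 tau c e c0 t0 ltac:(lra).
have c10 : 0 < c + 4 * tau by lra.
have [C2 C20 {}gain2] : exists2 C, 0 <= C & _ := gain2 tau (c + 4 * tau) (e - 4 * tau) c10 t0 ltac:(lra).
have c20 : 0 < c + 4 * tau + 4 * tau by lra.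
have [C1 C10 {}gain1] : exists2 C, 0 <= C & _ := gain1 tau (c + 4 * tau + 4 * tau) (e - 4 * tau - 4 * tau) c20 t0 ltac:(lra).
pose K := C1 * (C2 * C3).
have K0 : 0 <= K by rewrite /K !mulr_ge0.
exists (16 / tau ^+ 2 + 16 * tau * (18 / tau ^+ 3 + 12 * K)).
  by have tt := ltW t0; have := exprn_ge0 2 tt; have := exprn_ge0 3 tt => *; ge0.
move=> w wt N x sw N0 wN xab.
have s1 h : 0 < h -> sol m (fun x => dif h (w x)) (fun x => dif h (wt x)).
  by move=> h0; apply: sol_dif => //; exact: ltW.
have s2 h : 0 < h -> sol m (fun x => dif h (dif h (w x))) (fun x => dif h (dif h (wt x))).
  by move=> h0; apply: (@sol_dif (fun x => dif h (w x)) (fun x => dif h (wt x))); [exact: ltW|exact: s1].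
have d1 h y : 0 < h <= tau -> a2 <= y <= b2 -> _ := fun hh yy => gain3 w wt N h y sw wN hh yy.
have d2 h y : 0 < h <= tau -> a1 <= y <= b1 -> _ := fun hh yy => gain2 _ _ (C3 * (h * N)) h y
  (s1 h (proj1 (andP hh))) (fun y' => d1 h y' hh) hh yy.
have d3 h : 0 < h <= tau -> _ := fun hh => gain1 _ _ (C2 * (h * (C3 * (h * N)))) h x
  (s2 h (proj1 (andP hh))) (fun y' => d2 h y' hh) hh xab.
have [cw cwt dw eqn] := sw.
have xab3 : a3 <= x <= b3 by lra.
have cwtx : cts (wt x) by cont.
have KN : 0 <= K * N by rewrite mulr_ge0// ltW.
have := @marchaud R tau (c + 16 * tau) (e - 16 * tau) (c + 4 * tau + 4 * tau + 4 * tau)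
  (e - 4 * tau - 4 * tau - 4 * tau) c e (K * N) N (w x) (wt x) (dw x) cwtx t0.
move=> /(_ ltac:(clear -ce t0; lra) ltac:(clear -t0; lra) ltac:(clear -t0; lra) ltac:(clear -t0; lra) ltac:(clear -t0; lra) N0 KN (wN x xab3)).
have d3' h : 0 < h <= tau -> itg (c + 4 * tau + 4 * tau + 4 * tau) (e - 4 * tau - 4 * tau - 4 * tau)
      (fun t => dif h (dif h (dif h (w x))) t ^+ 2) <= K * N * h ^+ 3.
  by move=> hh; apply: le_trans (d3 h hh) _; rewrite /K le_eqVlt; apply/orP; left; apply/eqP; ring.
move=> /(_ d3')/le_trans; apply.
by rewrite le_eqVlt; apply/orP; left; apply/eqP; field; rewrite gt_eqF.
Qed.
End SolDeriv.

(** * Uniform Hoelder continuity of the difference quotients *)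

Section Holder.
Context {R : realType}.
Implicit Types f : R -> R.

Definition avg (s : R) f (t : R) : R := (prim f (t + s) - prim f t) / s.

Lemma avg_close f s t om : cts f -> 0 < s ->
  (forall u, t <= u <= t + s -> `|f u - f t| <= om) -> `|avg s f t - f t| <= om.
Proof.
move=> cf s0 H; have ts : t <= t + s by rewrite lerDl ltW.
have cg : cts (fun u => f u - f t) by cont.
have -> : avg s f t - f t = itg t (t + s) (fun u => f u - f t) / s.
  rewrite itgB//; last exact: cont_cst.
  by rewrite itg_cst// itg_prim// /avg; field; rewrite gt_eqF.
rewrite normrM [X in _ * X]gtr0_norm ?invr_gt0// ler_pdivrMr//.
apply: le_trans (itg_abs _ _ cg) _.
rewrite [leRHS](_ : _ = om * (t + s - t)); last by ring.
rewrite -itg_cst//; apply: itg_le; [by cont|exact: cont_cst|exact: H].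
Qed.

Lemma cont_mod f (c e om : R) : cts f -> 0 < om -> exists2 d, 0 < d &
  forall t u, c <= t <= e -> `|t - u| <= d -> `|f t - f u| <= om.
Proof.
move=> cf om0.
have cF : cts (fun p : R * R => f p.1) by apply: cont_comp1 => //; exact: cont_fst.
have [d d0 mod] := @uniform_cont_fst R (fun x _ => f x) c e 0 0 om cF om0.
by exists d => // t u tce; apply: (mod t u 0) => //; rewrite lexx.
Qed.

(** The average over length [s] has derivative [dif s f t / s], whose norm is at most [K];
    Cauchy-Schwarz gives the Hoelder bound for the average, uniformly in [s], and [s] tends to 0. *)
Lemma holder_of_sqr_dif f (K c e s0 : R) : cts f -> 0 <= K -> 0 < s0 ->
  (forall s, 0 < s <= s0 -> itg c e (fun t => dif s f t ^+ 2) <= K ^+ 2 * s ^+ 2) ->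
  forall t u, c <= t -> t <= u -> u <= e -> `|f u - f t| <= K * Num.sqrt (u - t).
Proof.
move=> cf K0 s00 H t u ct tu ue.
apply: (@le_of_le_addZ _ _ _ 2) => om /andP[om0 _].
have [d d0 mod] := @cont_mod f c e om cf om0.
pose s := Num.min s0 d; have s0' : 0 < s by rewrite lt_min s00.
have ss0 : s <= s0 by rewrite ge_min lexx.
have sd : s <= d by rewrite ge_min lexx orbT.
have close v : c <= v <= e -> `|avg s f v - f v| <= om.
  move=> vce; apply: avg_close => // w /andP[vw wv]; rewrite distrC; apply: mod => //.
  by rewrite ler_norml; clear -vw wv sd d0; lra.
have ut0 : 0 <= u - t by rewrite subr_ge0.
have main : `|avg s f u - avg s f t| <= K * Num.sqrt (u - t).
  have cd : cts (dif s f) by exact: dif_cont.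
  have E : avg s f u - avg s f t = itg t u (dif s f) / s.
    rewrite /dif itgB//; last by cont.
    rewrite itg_shift// !itg_prim ?lerD2r//.
    by rewrite /avg -mulrBl; congr (_ / _); ring.
  rewrite -(@ler_pXn2r _ 2%N) ?nnegrE ?mulr_ge0 ?sqrtr_ge0//.
  rewrite real_normK ?num_real// E exprMn exprMn sqr_sqrtr//.
  rewrite exprVn ler_pdivrMr ?exprn_gt0//.
  apply: le_trans (itg_sqr_le cd tu) _.
  have -> : K ^+ 2 * (u - t) * s ^+ 2 = (u - t) * (K ^+ 2 * s ^+ 2) by ring.
  apply: ler_wpM2l => //; apply: le_trans (H s _); last by rewrite s0'.
  exact: itg_subint_sqr.
have c1 : `|avg s f u - f u| <= om by apply: close; rewrite ue (le_trans ct tu).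
have c2 : `|avg s f t - f t| <= om by apply: close; rewrite ct (le_trans tu ue).
have -> : f u - f t = (avg s f u - avg s f t) - (avg s f u - f u) + (avg s f t - f t) by ring.
apply: le_trans (ler_normD _ _) _; apply: le_trans (lerD (ler_normB _ _) (lexx _)) _.
by move: main c1 c2; clear; lra.
Qed.

(** Averaging over length [b] the quotient of step [a] gives a mixed second difference of the
    primitive of [f], divided by [a * b], which is symmetric in [a] and [b]. Each quotient is close
    to its average by the Hoelder bound, so the two are close to each other without any
    differentiability of [f]. *)
Lemma diff_quot_cauchy f (K c e a b t : R) : cts f -> 0 < a -> 0 < b -> 0 <= K ->
  (forall d, d = a \/ d = b -> forall t u, c <= t -> t <= u -> u <= e ->
     `|dif d f u / d - dif d f t / d| <= K * Num.sqrt (u - t)) ->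
  c <= t -> t + a <= e -> t + b <= e ->
  `|dif a f t / a - dif b f t / b| <= K * (Num.sqrt a + Num.sqrt b).
Proof.
move=> cf a0 b0 K0 H ct tae tbe.
have cq d : cts (fun u => dif d f u / d) by rewrite /dif; cont.
have close p q : 0 < p -> 0 < q -> (p = a /\ q = b) \/ (p = b /\ q = a) ->
   `|avg q (fun u => dif p f u / p) t - dif p f t / p| <= K * Num.sqrt q.
  move=> p0 q0 pq; apply: (@avg_close (fun u => dif p f u / p)) => // u /andP[tu utq].
  apply: le_trans (H p _ t u _ _ _) _ => //.
  - by case: pq => -[-> _]; [left|right].
  - by apply: le_trans utq _; case: pq => -[_ ->].
  apply: ler_wpM2l => //; rewrite ler_psqrt ?nnegrE; [|by clear -tu; lra|exact: ltW].
  by clear -utq; lra.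
have avgE p q : 0 < p -> 0 < q -> avg q (fun u => dif p f u / p) t =
    (prim f (t + p + q) - prim f (t + q) - (prim f (t + p) - prim f t)) / (p * q).
  move=> p0 q0; have tq : t <= t + q by rewrite lerDl ltW.
  rewrite /avg -itg_prim//.
  have cd : cts (dif p f) by exact: dif_cont.
  rewrite (_ : (fun u => _) = fun u => p^-1 * dif p f u); last by apply/funext => u; rewrite mulrC.
  rewrite itgZ// /dif itgB//; last by cont.
  rewrite itg_shift// !itg_prim ?lerD2r//.
  have -> : t + q + p = t + p + q by ring.
  by field; rewrite !gt_eqF.
have comm : avg b (fun u => dif a f u / a) t = avg a (fun u => dif b f u / b) t.
  rewrite !avgE// (_ : t + b + a = t + a + b); last by ring.
  by field; rewrite !gt_eqF.
have c1 := close a b a0 b0 (or_introl (conj erefl erefl)).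
have c2 := close b a b0 a0 (or_intror (conj erefl erefl)).
rewrite comm in c1.
set X := avg a _ t in c1 c2.
have -> : dif a f t / a - dif b f t / b = (X - dif b f t / b) - (X - dif a f t / a) by ring.
apply: le_trans (ler_normB _ _) _; rewrite mulrDr; move: c1 c2; clear; lra.
Qed.
End Holder.

Section Average.
Context {R : realType} (m : {measure set R -> \bar R}).
Hypothesis m_locfin : locally_finite [set: R] m.
Hypothesis m_unbounded : forall b : R, 0 < b ->
  (msupp m `&` `]-oo, - b] !=set0) /\ (msupp m `&` `[b, +oo[ !=set0).

Variable u : R -> R -> R.
Hypothesis u_cont : cts (fun p => u p.1 p.2).
Hypothesis u_eqn : forall x d t1 t2 A B, 0 < d -> 0 < t1 -> t1 <= t2 -> A <= x - d -> x + d <= B ->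
  itg t1 t2 (fun s => u (x + d) s - 2 * u x s + u (x - d) s) =
  2 * mitg m A B (fun y => hat d (y - x) * (u y t2 - u y t1)).

Lemma avg_joint_cont (s : R) : 0 < s -> cts (fun p => avg s (u p.1) p.2).
Proof.
move=> s0; split => -[x0 t0]; apply/cvgrPdist_le => /= eps e0.
have e20 : 0 < eps / 2 by rewrite divr_gt0.
have cux x : cts (u x) by cont.
have ca : cts (avg s (u x0)).
  by rewrite /avg; have := prim_cont (cux x0) => ?; cont.
have [d1 d10 m1] := @cont_mod R (avg s (u x0)) t0 t0 (eps / 2) ca e20.
have [d2 d20 m2] := @uniform_cont_fst R u x0 x0 (t0 - d1) (t0 + d1 + s) (eps / 2) u_cont e20.
suff key (x t : R) : ball x0 d2 x -> ball t0 d1 t ->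
    `|avg s (u x0) t0 - avg s (u x) t| <= eps.
  exists (ball x0 d2, ball t0 d1); first by split; apply: nbhsx_ballx.
  by move=> [x t] [/= xx tt]; exact: key.
move=> xx tt.
have {}m1 : `|avg s (u x0) t0 - avg s (u x0) t| <= eps / 2.
  by apply: m1; [rewrite !lexx|exact: ltW].
have m3 : `|avg s (u x0) t - avg s (u x) t| <= eps / 2.
  have ts : t <= t + s by rewrite lerDl ltW.
  have -> : avg s (u x0) t - avg s (u x) t = itg t (t + s) (fun r => u x0 r - u x r) / s.
    have cu0 := cux x0; have cu1 := cux x.
    by rewrite itgB// !itg_prim// -mulrBl.
  have cg : cts (fun r => u x0 r - u x r) by cont.
  rewrite normrM [X in _ * X]gtr0_norm ?invr_gt0// ler_pdivrMr//.
  apply: le_trans (itg_abs _ _ cg) _.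
  rewrite [leRHS](_ : _ = eps / 2 * (t + s - t)); last by ring.
  rewrite -itg_cst//; apply: itg_le; [by cont|exact: cont_cst|] => r /andP[tr rt].
  apply: m2; [by rewrite !lexx| |exact: ltW].
  by move: tt; rewrite /ball/= ltr_norml; lra.
have := ler_normD (avg s (u x0) t0 - avg s (u x0) t) (avg s (u x0) t - avg s (u x) t).
by rewrite addrA subrK; move: m1 m3; lra.
Qed.

(** The time derivative of the average is a difference quotient of [u], which is continuous, and the
    time-integrated equation of [u] is exactly the equation of the average. *)
Lemma sol_avg (s : R) : 0 < s -> sol m (fun x => avg s (u x)) (fun x t => dif s (u x) t / s).
Proof.
move=> s0; have cux x : cts (u x) by cont.
split.
- exact: avg_joint_cont.
- by rewrite /dif; cont.
- move=> x t; have dp (r : R) : is_derive r 1 (prim (u x)) (u x r) by exact: prim_is_derive.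
  have := is_derive_mul (is_derive_sub (is_derive_translate s dp) dp) (fun r => is_derive_cst (s^-1) r 1) t.
  by rewrite mulr0 add0r mulrC.
move=> x d t A B d0 t0 Ax xB.
have ts : t <= t + s by rewrite lerDl ltW.
have := u_eqn d0 t0 ts Ax xB.
have c1 := cux (x + d); have c2 := cux x; have c3 := cux (x - d).
rewrite itgD; [|by cont..]; rewrite itgB; [|by cont..]; rewrite itgZ// !itg_prim//.
move=> E.
transitivity ((prim (u (x + d)) (t + s) - prim (u (x + d)) t -
  2 * (prim (u x) (t + s) - prim (u x) t) + (prim (u (x - d)) (t + s) - prim (u (x - d)) t)) / s).
  by rewrite /avg; field; rewrite gt_eqF.
rewrite E -mulrA; congr (2 * _); rewrite mulrC.
have ch := hat_cont d x.
rewrite -mitgZ//; last by cont.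
by apply: eq_mitg => y _; rewrite /dif; field; rewrite gt_eqF.
Qed.

(** [sol_deriv_bound] is used twice. Applied to the average [w], bounded by the supremum of [u]
    independently of [eps], it bounds the norm of [w_t]. Increments of [w] of length [s] therefore
    have norm of order [s], and applied to them it bounds the increments of [w_t] in the same way,
    as [holder_of_sqr_dif] requires. *)
Lemma diff_quot_holder (al be c e : R) : al <= be -> 0 < c -> c <= e ->
  exists2 K, 0 <= K & forall eps x t t', 0 < eps <= 1 -> al <= x <= be -> c <= t -> t <= t' -> t' <= e ->
    `|dif eps (u x) t' / eps - dif eps (u x) t / eps| <= K * Num.sqrt (t' - t).
Proof.
move=> albe c0 ce.
have [[a1 b1] /= [a1a bb1 D1]] := sol_deriv_bound m_locfin m_unbounded albe.
have a1b1 : a1 <= b1 by lra.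
have [[a2 b2] /= [a2a bb2 D2]] := sol_deriv_bound m_locfin m_unbounded a1b1.
pose tau := c / 64; have t0 : 0 < tau by rewrite divr_gt0.
pose c1 := c - 16 * tau; pose e1 := e + 16 * tau.
(* One [tau] beyond the margin [16 * tau]: the increments of length [s <= tau] on [[c1, e1]] use
   [w_t] up to [e1 + tau]. In all [33 * tau] is spent, less than [c = 64 * tau], so times remain
   positive. *)
pose c2 := c1 - 17 * tau; pose e2 := e1 + 17 * tau.
have tc : c = 64 * tau by rewrite /tau; field.
have c20 : 0 < c2 by rewrite /c2 /c1 tc; lra.
have c10 : 0 < c1 by rewrite /c1 tc; lra.
have w2 : c2 + 16 * tau <= e2 - 16 * tau by rewrite /c2 /e2 /c1 /e1; lra.
have w1 : c1 + 16 * tau <= e1 - 16 * tau by rewrite /c1 /e1; lra.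
have [C2 C20 {}D2] : exists2 C, 0 <= C & _ := D2 tau c2 e2 c20 t0 w2.
have [C1 C10 {}D1] : exists2 C, 0 <= C & _ := D1 tau c1 e1 c10 t0 w1.
have [B B0 uB] := bounded_rect a2 b2 c2 (e2 + 1) u_cont.
pose N := B ^+ 2 * (e2 - c2) + 1.
have c2e2 : c2 <= e2 by rewrite /c2 /e2 /c1 /e1; lra.
have N0 : 0 < N by rewrite /N ltr_wpDl// mulr_ge0 ?sqr_ge0// subr_ge0.
pose N1 := C2 * N + 1.
have N10 : 0 < N1 by rewrite /N1 ltr_wpDl// mulr_ge0// ltW.
exists (Num.sqrt (C1 * N1)); first exact: sqrtr_ge0.
move=> eps x t t' /andP[eps0 eps1] xab ct tt' te.
have cux y : cts (u y) by cont.
have sw := sol_avg eps0.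
have cq y : cts (fun r => dif eps (u y) r / eps) by have := cux y; rewrite /dif => ?; cont.
have step1 y : a1 <= y <= b1 ->
   itg (c2 + 16 * tau) (e2 - 16 * tau) (fun r => (dif eps (u y) r / eps) ^+ 2) <= C2 * N.
  move=> yab; apply: (D2 _ _ N y sw N0) => // z zab.
  have cav : cts (avg eps (u z)) by rewrite /avg; have := prim_cont (cux z) => ?; cont.
  apply: (@le_trans _ _ (itg c2 e2 (fun=> B ^+ 2))); last by rewrite itg_cst// /N lerDl.
  apply: itg_le; [by cont|exact: cont_cst|] => r /andP[r1 r2].
  rewrite -real_normK ?num_real// lerXn2r ?nnegrE//.
  have rr : r <= r + eps by rewrite lerDl ltW.
  rewrite /avg -itg_prim// normrM [X in _ * X]gtr0_norm ?invr_gt0// ler_pdivrMr//.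
  have cuz := cux z; apply: le_trans (itg_abs _ _ cuz) _.
  rewrite [leRHS](_ : _ = B * (r + eps - r)); last by ring.
  rewrite -itg_cst//; apply: itg_le; [by cont|exact: cont_cst|] => v /andP[v1 v2].
  by apply: uB => //; move: r1 r2 v1 v2 eps1; lra.
apply: (@holder_of_sqr_dif R (fun r => dif eps (u x) r / eps) (Num.sqrt (C1 * N1)) c e tau) => //.
move=> s /andP[s0 stau].
have cN1 : 0 <= C1 * N1 by rewrite mulr_ge0// ltW.
rewrite sqr_sqrtr// -mulrA.
have ss := sol_dif m_locfin (ltW s0) sw.
have s2 : 0 < s ^+ 2 by rewrite exprn_gt0.
have Ns : 0 < N1 * s ^+ 2 by rewrite mulr_gt0.
have -> : c = c1 + 16 * tau by rewrite /c1; ring.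
have -> : e = e1 - 16 * tau by rewrite /e1; ring.
apply: (D1 _ _ _ x ss Ns) => // y yab.
have c1e1 : c1 <= e1 by rewrite /c1 /e1; lra.
have cav : cts (avg eps (u y)) by rewrite /avg; have := prim_cont (cux y) => ?; cont.
have [_ _ dw _] := sw.
have -> : (fun r => dif s (avg eps (u y)) r ^+ 2) = fun r =>
   (prim (fun r => dif eps (u y) r / eps) (r + s) - prim (fun r => dif eps (u y) r / eps) r) ^+ 2.
  apply/funext => r; congr (_ ^+ 2).
  have rs : r <= r + s by rewrite lerDl ltW.
  by rewrite -itg_prim// (itg_FTC (dw y)).
apply: le_trans (itg_window_sqr (cq y) c1e1 (ltW s0)) _.
rewrite mulrC; apply: ler_wpM2r; first exact: ltW.
apply: le_trans (_ : _ <= C2 * N) _; last by rewrite /N1 lerDl.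
apply: le_trans (step1 y yab).
apply: itg_subint_sqr => //; rewrite /c2 /e2; first by lra.
by move: stau; lra.
Qed.
End Average.

Section SqrtCauchy.
Context {R : realType}.

Lemma sqrt_small (om : R) : 0 < om -> exists2 d, 0 < d <= 1 & forall s, 0 < s <= d -> Num.sqrt s <= om.
Proof.
move=> om0; exists (Num.min 1 (om ^+ 2)); first by rewrite lt_min ltr01 exprn_gt0//= ge_min lexx.
move=> s /andP[s0]; rewrite le_min => /andP[_ som].
have [s0' om0'] := (ltW s0, ltW om0).
by rewrite -(@ler_pXn2r _ 2%N) ?nnegrE ?sqrtr_ge0// sqr_sqrtr.
Qed.

Lemma sqrt_cauchy_cvg (q : R -> R) (K : R) : 0 <= K ->
  (forall a b : R, 0 < a <= 1 -> 0 < b <= 1 -> `|q a - q b| <= K * (Num.sqrt a + Num.sqrt b)) ->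
  forall a : R, 0 < a <= 1 -> `|q a - lim ((fun n => q n.+1%:R^-1) @ \oo)| <= K * Num.sqrt a.
Proof.
move=> K0 H a a01; set v := fun n => q n.+1%:R^-1.
have n01 n : 0 < (n.+1%:R^-1 : R) <= 1 by rewrite invr_gt0 ltr0Sn invf_le1// ler1n.
have small (om : R) : 0 < om -> exists N, forall n, (N <= n)%N -> Num.sqrt (n.+1%:R^-1 : R) <= om.
  move=> om0; have [d /andP[d0 _] dP] := sqrt_small om0.
  exists (Num.truncn d^-1) => n Nn; apply: dP; rewrite invr_gt0 ltr0Sn/= invf_ple ?posrE//.
  have di : 0 < d^-1 by rewrite invr_gt0.
  have /andP[_ lt1] := truncn_itv (ltW di).
  by apply: le_trans (ltW lt1) _; rewrite ler_nat.
have cv : cvgn v.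
  apply/cauchy_cvgP/cauchy_ballP => eps e0.
  have K1 : 0 < 2 * K + 1 by rewrite ltr_wpDl// mulr_ge0.
  have [N NP] := small (eps / (2 * (2 * K + 1))) (divr_gt0 e0 (mulr_gt0 (ltr0Sn R 1) K1)).
  pose tail := [set v n | n in [set n | (N <= n)%N]].
  exists (tail, tail); first by split; exists N => // n Nn; exists n.
  move=> _ /= [[n Nn <-] [k Nk <-]]; rewrite /ball/=; apply: le_lt_trans (H _ _ (n01 n) (n01 k)) _.
  apply: le_lt_trans (ler_wpM2l K0 (lerD (NP n Nn) (NP k Nk))) _.
  rewrite (_ : K * _ = eps * (K / (2 * K + 1))); last by field; rewrite gt_eqF.
  by rewrite gtr_pMr// ltr_pdivrMr// mul1r; move: K0; clear; lra.
apply: (@le_of_le_addZ _ _ _ (K + 1)) => om /andP[om0 _].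
have [N NP] := small om om0.
have /cvgrPdist_le /(_ _ om0) [N' _ N'P] := cv.
set n := maxn N N'.
have c1 := H a n.+1%:R^-1 a01 (n01 n).
have c2 : `|lim (v @ \oo) - v n| <= om by apply: N'P; exact: leq_maxr.
have c3 := NP n (leq_maxl _ _).
have -> : q a - lim (v @ \oo) = (q a - q n.+1%:R^-1) - (lim (v @ \oo) - v n) by rewrite /v; ring.
apply: le_trans (ler_normB _ _) _.
by have := ler_wpM2l K0 c3; move: c1 c2; clear; lra.
Qed.

Lemma is_derive_sqrt_rate (f : R -> R) (t D K : R) : 0 <= K ->
  (\forall s \near (0 : R), s != 0 -> `|(f (t + s) - f t) / s - D| <= K * Num.sqrt `|s|) ->
  is_derive t 1 f D.
Proof.
move=> K0 H.
have L : (fun h : R => h^-1 *: (f (h *: 1 + t) - f t)) @ 0^' --> D.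
  apply/cvgrPdist_le => om om0.
  have K1 : 0 < K + 1 by rewrite ltr_wpDl.
  have [d /andP[d0 _] dP] := sqrt_small (divr_gt0 om0 K1).
  near=> s.
  have s0 : s != 0 by near: s; exact: nbhs_dnbhs_neq.
  rewrite [s *: 1]mulr1 distrC [_ *: _]mulrC [s + t]addrC.
  have Hs : s != 0 -> `|(f (t + s) - f t) / s - D| <= K * Num.sqrt `|s|.
    by near: s; apply: nbhs_dnbhs.
  apply: le_trans (Hs s0) _.
  have sd : `|s| <= d.
    near: s; apply: nbhs_dnbhs; apply/nbhs_ballP; exists d => //= s.
    by rewrite /ball/= sub0r normrN => /ltW.
  have sq : Num.sqrt `|s| <= om / (K + 1) by apply: dP; rewrite normr_gt0 s0.
  apply: le_trans (ler_wpM2l K0 sq) _.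
  rewrite mulrCA ger_pMr// ler_pdivrMr// mul1r; move: K0; clear; lra.
split; first by apply: cvgP L.
exact: cvg_lim L.
Unshelve. all: by end_near. Qed.
End SqrtCauchy.

Section TimeRegularity.
Context {R : realType} (m : {measure set R -> \bar R}).
Hypothesis m_locfin : locally_finite [set: R] m.
Hypothesis m_unbounded : forall b : R, 0 < b ->
  (msupp m `&` `]-oo, - b] !=set0) /\ (msupp m `&` `[b, +oo[ !=set0).

Variable u : R -> R -> R.
Hypothesis u_cont : cts (fun p => u p.1 p.2).
Hypothesis u_eqn : forall x d t1 t2 A B, 0 < d -> 0 < t1 -> t1 <= t2 -> A <= x - d -> x + d <= B ->
  itg t1 t2 (fun s => u (x + d) s - 2 * u x s + u (x - d) s) =
  2 * mitg m A B (fun y => hat d (y - x) * (u y t2 - u y t1)).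

(** A limit along a fixed sequence of steps defines the function everywhere; it is the time
    derivative at positive times. *)
Definition dudt (x t : R) : R :=
  lim ((fun n => dif n.+1%:R^-1 (u x) t / n.+1%:R^-1) @ \oo).

Lemma dudt_rate (al be c e : R) : al <= be -> 0 < c -> c <= e ->
  exists2 K, 0 <= K &
    (forall eps x t, 0 < eps <= 1 -> al <= x <= be -> c <= t <= e ->
       `|dif eps (u x) t / eps - dudt x t| <= K * Num.sqrt eps) /\
    (forall eps x t t', 0 < eps <= 1 -> al <= x <= be -> c <= t -> t <= t' -> t' <= e ->
    `|dif eps (u x) t' / eps - dif eps (u x) t / eps| <= K * Num.sqrt (t' - t)).
Proof.
move=> albe c0 ce; have ce1 : c <= e + 1 by lra.
have [K K0 KP] := diff_quot_holder m_locfin m_unbounded u_cont u_eqn albe c0 ce1.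
exists K => //; split; last first.
  by move=> eps x t t' e01 xab ct tt' t'e; apply: KP => //; lra.
move=> eps x t e01 xab /andP[ct te].
apply: (@sqrt_cauchy_cvg R (fun s => dif s (u x) t / s) K K0) => // a b /andP[a0 a1] /andP[b0 b1].
have cux : cts (u x) by have := u_cont => ?; cont.
apply: (@diff_quot_cauchy R (u x) K c (e + 1)) => //; [|lra|lra].
by move=> d dab t1 t2 *; apply: KP => //; case: dab => ->; rewrite ?a0 ?b0.
Qed.

(** The rate is available for positive steps only. A negative step [s] is the positive step [- s]
    based at [t + s], and the Hoelder bound moves the base point back to [t]; the lower time [t / 2]
    leaves room for this. *)
Lemma dudt_is_derive x (t : R) : 0 < t -> is_derive t 1 (u x) (dudt x t).
Proof.
move=> t0; have c0 : 0 < t / 2 by rewrite divr_gt0.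
have ct : t / 2 <= t by lra.
have [K K0 [KP KH]] := dudt_rate (lexx x) c0 ct.
have xx : x <= x <= x by rewrite lexx.
apply: (@is_derive_sqrt_rate R (u x) t (dudt x t) (2 * K)); first exact: mulr_ge0.
near=> s => s0.
have s1 : `|s| <= Num.min 1 (t / 2).
  near: s; apply/nbhs_ballP; exists (Num.min 1 (t / 2)); first by rewrite /= lt_min ltr01 c0.
  by move=> s; rewrite /ball/= sub0r normrN => /ltW.
move: s1; rewrite le_min => /andP[s1 st].
have tt : t / 2 <= t <= t by rewrite ct lexx.
have sq0 : 0 <= Num.sqrt `|s| by exact: sqrtr_ge0.
have [sp|sn] := leP 0 s.
  rewrite (ger0_norm sp) in s1 st sq0 *.
  have sp' : 0 < s by rewrite lt_neqAle eq_sym s0.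
  have := KP s x t; rewrite sp' s1 => /(_ isT xx tt); rewrite /dif.
  by have := mulr_ge0 K0 sq0; lra.
rewrite (ltr0_norm sn) in s1 st sq0 *.
have sp' : 0 < - s <= 1 by rewrite oppr_gt0 sn.
have h1 := KP (- s) x t sp' xx tt.
have h2 := KH (- s) x (t + s) t sp' xx _ _ (lexx t).
have {}h2 := h2 ltac:(lra) ltac:(lra).
rewrite (_ : t - (t + s) = - s) in h2; last by ring.
have -> : (u x (t + s) - u x t) / s - dudt x t =
   (dif (- s) (u x) t / (- s) - dudt x t) - (dif (- s) (u x) t / (- s) - dif (- s) (u x) (t + s) / (- s)).
  by rewrite /dif addrK; field; rewrite ?oppr_eq0.
apply: le_trans (ler_normB _ _) _.
by move: h1 h2; clear; lra.
Unshelve. all: by end_near. Qed.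

(** By the rate, [dudt] is a locally uniform limit of difference quotients, which are jointly
    continuous. *)
Lemma dudt_cont x t : 0 < t -> {for (x, t), continuous (fun p => dudt p.1 p.2)}.
Proof.
move=> t0; have c0 : 0 < t / 2 by rewrite divr_gt0.
have [K K0 [KP _]] := @dudt_rate (x - 1) (x + 1) (t / 2) (t + 1) ltac:(lra) c0 ltac:(lra).
apply/cvgrPdist_le => eps e0.
have K1 : 0 < K + 1 by rewrite ltr_wpDl.
have om0 : 0 < eps / (4 * (K + 1)) by rewrite divr_gt0// mulr_gt0.
have [d /andP[d0 d1] dP] := sqrt_small om0.
have sq : Num.sqrt d <= eps / (4 * (K + 1)) by apply: dP; rewrite d0 lexx.
have Kd : K * Num.sqrt d <= eps / 4.
  apply: le_trans (ler_wpM2l K0 sq) _.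
  rewrite (_ : K * _ = eps / 4 * (K / (K + 1))); last by field; rewrite gt_eqF.
  by rewrite ger_pMr ?divr_gt0// ler_pdivrMr// mul1r; lra.
have cq : cts (fun p => dif d (u p.1) p.2 / d) by rewrite /dif; have := u_cont => ?; cont.
have [/(_ (x, t)) /cvgrPdist_le cq'] := cq.
have e20 : 0 < eps / 2 by rewrite divr_gt0.
have {cq'} [[U V] /= [Ux Vt] UV] := cq' _ e20.
have t20 : 0 < Num.min 1 (t / 2) by rewrite lt_min ltr01.
suff key (y s : R) : U y -> V s -> ball x 1 y -> ball t (Num.min 1 (t / 2)) s ->
    `|dudt x t - dudt y s| <= eps.
  exists (U `&` ball x 1, V `&` ball t (Num.min 1 (t / 2))).
    split => /=; apply: filterI => //; exact: nbhsx_ballx.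
  by move=> [y s] [/= [Uy xy] [Vs ts]]; exact: key.
move=> Uy Vs; rewrite /ball/= => xy; rewrite lt_min => /andP[ts1 ts2].
have := UV (y, s); rewrite /= => /(_ (conj Uy Vs)) h.
have d01 : 0 < d <= 1 by rewrite d0.
have h1 := KP d x t d01 ltac:(lra) ltac:(lra).
have h2 : `|dif d (u y) s / d - dudt y s| <= K * Num.sqrt d.
  apply: KP => //; first by move: xy; rewrite ltr_norml; lra.
  by move: ts1 ts2; rewrite !ltr_norml; lra.
have -> : dudt x t - dudt y s = (dif d (u x) t / d - dif d (u y) s / d) -
  (dif d (u x) t / d - dudt x t) + (dif d (u y) s / d - dudt y s) by ring.
apply: le_trans (ler_normD _ _) _; apply: le_trans (lerD (ler_normB _ _) (lexx _)) _.
lra.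
Qed.
End TimeRegularity.

(** * Test functions *)

Section Jets.
Context {R : realType}.

(** A smooth function presented together with all its derivatives, so that constructions act on
    explicit derivatives and not on iterates of the derivation operator. *)
Definition jet (F : nat -> R -> R) : Prop :=
  forall n (t : R), is_derive t 1 (F n) (F n.+1 t).

Lemma jet_cont F n : jet F -> cts (F n).
Proof. by move=> jF; exact: is_derive_cont (jF n). Qed.

Lemma jet_lin F G a b : jet F -> jet G -> jet (fun n t => a * F n t + b * G n t).
Proof.
move=> jF jG n t.
exact: is_deriveD (is_deriveZ a (jF n t)) (is_deriveZ b (jG n t)).
Qed.

Lemma jet_translate F h : jet F -> jet (fun n t => F n (t + h)).
Proof. by move=> jF n; exact: is_derive_translate. Qed.

Lemma jet_affine F a b : jet F -> jet (fun n t => a ^+ n * F n (a * t + b)).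
Proof.
move=> jF n t.
have d1 : is_derive t 1 (fun t => a * t + b) a.
  have := is_deriveD (is_deriveZ a (is_derive_id t (1 : R))) (is_derive_cst b t (1 : R)).
  by rewrite addr0 [_ *: _]mulr1.
have d2 := @is_derive1_comp R (F n) (fun t => a * t + b) t _ _ (jF n (a * t + b)) d1.
have := is_deriveZ (a ^+ n) d2.
by rewrite (_ : a ^+ n *: _ = a ^+ n.+1 * F n.+1 (a * t + b))//= /GRing.scale/= exprSr; ring.
Qed.

Definition jet_prim (F : nat -> R -> R) n := if n is k.+1 then F k else prim (F 0%N).

Lemma jet_primP F : jet F -> jet (jet_prim F).
Proof.
move=> jF [|n] t; last exact: jF.
by apply: prim_is_derive; exact: jet_cont.
Qed.

Implicit Types s : seq (R * nat * nat).

(** Finite combinations of products of derivatives of [F] and [G]; a triple holds a coefficient and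
    two orders. The class is closed under directional derivatives, by [dtens], which gives
    smoothness for every list of directions at once. *)
Definition tens (F G : nat -> R -> R) s (p : R * R) : R :=
  \sum_(c <- s) c.1.1 * (F c.1.2 p.1 * G c.2 p.2).

Definition dtens (a b : R) s : seq (R * nat * nat) :=
  [seq (c.1.1 * a, c.1.2.+1, c.2) | c <- s] ++ [seq (c.1.1 * b, c.1.2, c.2.+1) | c <- s].

Lemma tens_cons F G c s p : tens F G (c :: s) p = c.1.1 * (F c.1.2 p.1 * G c.2 p.2) + tens F G s p.
Proof. by rewrite /tens big_cons. Qed.

Lemma dtens_cons F G a b c s p : tens F G (dtens a b (c :: s)) p =
  c.1.1 * (a * (F c.1.2.+1 p.1 * G c.2 p.2) + b * (F c.1.2 p.1 * G c.2.+1 p.2)) +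
  tens F G (dtens a b s) p.
Proof. by rewrite /tens /dtens /= !big_cat/= !big_cons/= !big_cat/= big_cons/=; ring. Qed.

Lemma is_derive_dir (f : R -> R) (t f' a : R) : is_derive t 1 f f' -> is_derive t a f (a * f').
Proof.
move=> [df Df]; have dff : differentiable f t by apply/derivable1_diffP.
split; first exact: diff_derivable.
by rewrite deriveE// -[a in 'd f t a]mulr1 linearZ/= -deriveE// Df.
Qed.

Lemma tens_is_derive F G s (p v : R * R) : jet F -> jet G ->
  is_derive p v (tens F G s) (tens F G (dtens v.1 v.2 s) p).
Proof.
move=> jF jG; elim: s => [|c s IH].
  rewrite (_ : tens F G [::] = fun=> 0); last by apply/funext => q; rewrite /tens big_nil.
  exact: is_derive_cst.
have d1 : is_derive p v (fun q : R * R => F c.1.2 q.1) (v.1 * F c.1.2.+1 p.1).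
  by have [d e] := is_derive_dir v.1 (jF c.1.2 p.1); split; [exact: d|exact: e].
have d2 : is_derive p v (fun q : R * R => G c.2 q.2) (v.2 * G c.2.+1 p.2).
  by have [d e] := is_derive_dir v.2 (jG c.2 p.2); split; [exact: d|exact: e].
have := is_deriveD (is_deriveZ c.1.1 (is_deriveM d1 d2)) IH.
rewrite (_ : tens F G (c :: s) = c.1.1 *: ((fun q : R * R => F c.1.2 q.1) * (fun q => G c.2 q.2)) + tens F G s); last first.
  by apply/funext => q; rewrite tens_cons.
by rewrite dtens_cons (_ : _ *: _ = c.1.1 * (v.1 * (F c.1.2.+1 p.1 * G c.2 p.2) + v.2 * (F c.1.2 p.1 * G c.2.+1 p.2)))//
  /GRing.scale/= /GRing.scale/=; ring.
Qed.

Lemma tens_iter_derive F G s (vs : seq (R * R)) : jet F -> jet G ->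
  exists s', iter_derive (tens F G s) vs = tens F G s'.
Proof.
move=> jF jG; elim: vs => [|v vs [s' IH]]; first by exists s.
exists (dtens v.1 v.2 s'); rewrite /= IH; apply/funext => p.
by have [_ ->] := tens_is_derive s' p v jF jG.
Qed.

Lemma tens_cont F G s : jet F -> jet G -> cts (tens F G s).
Proof.
move=> jF jG; rewrite /tens; apply: cont_sum => c.
have cF := jet_cont c.1.2 jF; have cG := jet_cont c.2 jG.
apply: contM; first exact: cont_cst.
by apply: contM; [apply: (@cont_comp1 _ _ (fun p => p.1)) => //; exact: cont_fst|
  apply: (@cont_comp1 _ _ (fun p => p.2)) => //; exact: cont_snd].
Qed.

Definition one1 : seq (R * nat * nat) := [:: (1, 0%N, 0%N)].

Lemma tens_one F G p : tens F G one1 p = F 0%N p.1 * G 0%N p.2.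
Proof. by rewrite /tens big_seq1 mul1r. Qed.

Lemma smooth_tens F G : jet F -> jet G -> smooth (fun p : R * R => F 0%N p.1 * G 0%N p.2).
Proof.
move=> jF jG.
have -> : (fun p : R * R => F 0%N p.1 * G 0%N p.2) = tens F G one1.
  by apply/funext => p; rewrite tens_one.
move=> vs; have [s' ->] := tens_iter_derive one1 vs jF jG; split.
  by have [] := tens_cont s' jF jG.
by move=> p v; have [] := tens_is_derive s' p v jF jG.
Qed.

Lemma ddx_tens F G p : jet F -> jet G ->
  ddx (ddx (fun p : R * R => F 0%N p.1 * G 0%N p.2)) p = F 2%N p.1 * G 0%N p.2.
Proof.
move=> jF jG.
have -> : (fun p : R * R => F 0%N p.1 * G 0%N p.2) = tens F G one1.
  by apply/funext => q; rewrite tens_one.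
rewrite /ddx.
have -> : 'D_(1, 0) (tens F G one1) = tens F G (dtens 1 0 one1).
  by apply/funext => q; have [_ ->] := tens_is_derive one1 q (1, 0) jF jG.
have [_ ->] := tens_is_derive (dtens 1 0 one1) p (1, 0) jF jG.
by rewrite /tens /dtens /one1/= !big_cons big_nil/=; ring.
Qed.

Lemma ddt_tens F G p : jet F -> jet G ->
  ddt (fun p : R * R => F 0%N p.1 * G 0%N p.2) p = F 0%N p.1 * G 1%N p.2.
Proof.
move=> jF jG.
have -> : (fun p : R * R => F 0%N p.1 * G 0%N p.2) = tens F G one1.
  by apply/funext => q; rewrite tens_one.
rewrite /ddt; have [_ ->] := tens_is_derive one1 p (0, 1) jF jG.
by rewrite /tens /dtens /one1/= !big_cons big_nil/=; ring.
Qed.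

(** The product is the tensor product on the diagonal, differentiated in the direction [(1, 1)];
    this replaces Leibniz' formula of order [n]. *)
Lemma jet_mul F G : jet F -> jet G -> exists2 H, jet H & H 0%N = fun t => F 0%N t * G 0%N t.
Proof.
move=> jF jG; exists (fun n t => tens F G (iter n (dtens 1 1) one1) (t, t)); last first.
  by apply/funext => t; rewrite /= tens_one.
move=> n t.
have [d D] := tens_is_derive (iter n (dtens 1 1) one1) (t, t) (1, 1) jF jG.
have E (f : R * R -> R) : derivable f (t, t) (1, 1) -> is_derive t 1 (fun t => f (t, t)) ('D_(1, 1) f (t, t)).
  by move=> df; split.
by have := E _ d; rewrite D.
Qed.
End Jets.

(** * A smooth bump function *)

Section FlatFunction.
Context {R : realType}.
Implicit Types p : {poly R}.

Lemma horner_exp_bounded p : exists2 C, 0 <= C & forall y, 0 <= y -> `|p.[y]| * expR (- y) <= C.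
Proof.
exists (\sum_(i < size p) `|p`_i| * i`!%:R).
  by apply: sumr_ge0 => i _; apply: mulr_ge0.
move=> y y0; rewrite horner_coef.
apply: le_trans (ler_wpM2r (expR_ge0 _) (ler_norm_sum _ _ _)) _.
rewrite mulr_suml; apply: ler_sum => i _; rewrite normrM -mulrA; apply: ler_wpM2l => //.
rewrite ger0_norm ?exprn_ge0// expRN ler_pdivrMr ?expR_gt0//.
case: (nat_of_ord i) => [|k].
  by rewrite expr0 fact0 mul1r; have := expR_ge1Dx y; lra.
have := expR_ge1Dxn k y0 => h.
rewrite mulrC -ler_pdivrMr ?ltr0n ?fact_gt0//; lra.
Qed.

(** Products of a polynomial in [1 / x] with [exp (- 1 / x)], extended by 0. Differentiation
    preserves this form and maps [p] to [dflat p], so the derivatives of [exp (- 1 / x)] are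
    obtained by iterating [dflat]. *)
Definition flat p (x : R) : R := if 0 < x then p.[x^-1] * expR (- x^-1) else 0.

Definition dflat p : {poly R} := 'X^2 * (p - p^`()).

(** Away from 0 this is the chain rule. At 0, boundedness of [y^2 p(y) exp (- y)] at [y = 1 / s]
    makes the quotient at most a multiple of [s], hence of [sqrt s] for [s <= 1], the rate required
    by [is_derive_sqrt_rate]. *)
Lemma flat_is_derive p (x : R) : is_derive x 1 (flat p) (flat (dflat p) x).
Proof.
have [x0|x0|->] := ltgtP x 0.
- have -> : flat (dflat p) x = 0 by rewrite /flat ltNge ltW.
  apply: near_eq_is_derive (is_derive_cst 0 x (1 : R)).
  near=> y; rewrite /flat; case: ifPn => // y0.
  exfalso; have : y < 0 by near: y; exact: lt_nbhsl.
  by rewrite ltNge ltW.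
- have xn0 : x != 0 by rewrite gt_eqF.
  have dV : is_derive x 1 (fun y : R => y^-1) (- x ^- 2).
    have := is_deriveV xn0 (is_derive_id x (1 : R)).
    by rewrite [_ *: 1]mulr1.
  have dp := @is_derive1_comp R (horner p) (fun y => y^-1) x _ _ (is_derive_poly p x^-1) dV.
  have de := @is_derive1_comp R expR (fun y => - y^-1) x _ _ (is_derive_expR (- x^-1)) (is_deriveN dV).
  have := is_deriveM dp de.
  rewrite /GRing.scale/= => D.
  have -> : flat (dflat p) x =
     p.[x^-1] * (expR (- x^-1) * - - x ^- 2) + expR (- x^-1) * ((p^`()).[x^-1] * - x ^- 2).
    by rewrite /flat x0 /dflat hornerM hornerXn hornerD hornerN exprVn; ring.
  apply: near_eq_is_derive D.
  near=> y; rewrite /flat; have -> : 0 < y by near: y; exact: lt_nbhsr.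
  by [].
- have -> : flat (dflat p) 0 = 0 by rewrite /flat ltxx.
  have [C C0 CP] := horner_exp_bounded ('X^2 * p).
  apply: (@is_derive_sqrt_rate R (flat p) 0 0 C C0).
  near=> s => s0; rewrite add0r subr0 {2}/flat ltxx subr0 /flat.
  case: ifPn => [sp|_]; last by rewrite mul0r normr0 mulr_ge0// sqrtr_ge0.
  have s1 : s <= 1 by near: s; apply: lt_le_nbhsl; exact: ltr01.
  have y0 : 0 <= s^-1 by rewrite invr_ge0 ltW.
  rewrite normrM [X in _ * X]gtr0_norm ?invr_gt0// (gtr0_norm sp).
  rewrite normrM [X in _ * X * _]ger0_norm ?expR_ge0//.
  apply: (@le_trans _ _ (C * s)); last first.
    have sge0 := ltW sp; have q0 : 0 < Num.sqrt s by rewrite sqrtr_gt0.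
    have q1 : Num.sqrt s <= 1 by rewrite -sqrtr1 ler_psqrt ?nnegrE.
    by apply: ler_wpM2l => //; rewrite -[leLHS](@sqr_sqrtr _ s)// expr2 ger_pMr.
  have := CP s^-1 y0; rewrite hornerM hornerXn normrM ger0_norm ?exprn_ge0// => h.
  rewrite (_ : _ * s^-1 = s^-1 ^+ 2 * `|p.[s^-1]| * expR (- s^-1) * s).
    by rewrite ler_pM2r.
  by field; rewrite gt_eqF.
Unshelve. all: by end_near. Qed.

Lemma jet_flat : jet (fun n => flat (iter n dflat 1)).
Proof. by move=> n t; exact: flat_is_derive. Qed.

(** The bump is [exp (- 1 / t) exp (- 1 / (1 - t))], rescaled and normalised. Its support lies to
    the right of 0, so that mollified time cutoffs never reach back below their initial time. *)
Lemma mollifier (r : R) : 0 < r -> exists F : nat -> R -> R,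
  [/\ jet F, forall t, 0 <= F 0%N t, forall t, ~~ (0 < t < r) -> F 0%N t = 0 &
      itg 0 r (F 0%N) = 1].
Proof.
move=> r0.
have [H jH H0] := jet_mul jet_flat (jet_affine (-1) 1 jet_flat).
have Hge t : 0 <= H 0%N t.
  rewrite H0 /flat/= expr0 mul1r !hornerC; apply: mulr_ge0; case: ifP => // _;
  by rewrite mul1r expR_ge0.
have Hout t : ~~ (0 < t < 1) -> H 0%N t = 0.
  rewrite H0 /flat/= negb_and -!leNgt => /orP[t0|t1].
    by rewrite ltNge t0/= mul0r.
  by rewrite [X in _ * X](_ : _ = 0) ?mulr0// (_ : 0 < _ = false) ?mulr0//; apply/negbTE; rewrite -leNgt; lra.
have cH := jet_cont 0%N jH.
pose I := itg 0 1 (H 0%N).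
have I0 : 0 < I.
  (* On [[1/4, 3/4]] both factors of the bump are at least [exp (- 4)], so its integral is
     positive. *)
  pose a : R := expR (- 4).
  apply: (@lt_le_trans _ _ (itg 4^-1 (3 / 4) (fun=> a ^+ 2))).
    by rewrite itg_cst; [rewrite mulr_gt0 ?exprn_gt0 ?expR_gt0//; lra|lra].
  apply: (@le_trans _ _ (itg 4^-1 (3 / 4) (H 0%N))); last by apply: itg_subint => //; lra.
  apply: itg_le => //; first exact: cont_cst.
  move=> t tt; rewrite H0 /flat/= expr0 mul1r !hornerC !mul1r expr2.
  have g0 : 0 < t by lra.
  have g1 : 0 < -1 * t + 1 by lra.
  have V (y : R) : 4^-1 <= y -> a <= expR (- y^-1).
    move=> y4; rewrite /a ler_expR lerN2 -[leRHS]invrK lef_pV2// posrE ?invr_gt0//.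
    by apply: lt_le_trans y4; rewrite invr_gt0.
  rewrite g0 g1; apply: ler_pM; rewrite ?expR_ge0//; apply: V; lra.
have jG := jet_affine r^-1 0 jH.
pose G n t := r^-1 ^+ n * H n (r^-1 * t + 0).
exists (fun n t => (r^-1 / I) * G n t + 0 * G n t); split.
- exact: jet_lin.
- move=> t; rewrite mul0r addr0 /G expr0 mul1r; apply: mulr_ge0 => //.
  by apply: divr_ge0; [rewrite invr_ge0|]; exact: ltW.
- move=> t nt; rewrite mul0r addr0 /G Hout ?mulr0//.
  rewrite addr0 mulrC; apply: contraNN nt => /andP[t0 t1].
  move: t0 t1; rewrite ltr_pdivrMr// mul1r => t0 ->; rewrite andbT.
  by move: t0; rewrite pmulr_lgt0// invr_gt0.
have jP := jet_affine r^-1 0 (jet_primP jH).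
have := itg_FTC (jP 0%N) _ (ltW r0).
rewrite /= !expr0 expr1 !mul1r mulr0 addr0 mulVf ?gt_eqF// -itg_prim// -/I => E.
have cG : cts (fun t => r^-1 * H 0%N (r^-1 * t + 0)) by cont.
have {}E := E cG.
transitivity (itg 0 r (fun t => I^-1 * (r^-1 * H 0%N (r^-1 * t + 0)))).
  by apply: eq_itg => t _; rewrite /G expr0; ring.
by rewrite itgZ// E addr0 mulVf// gt_eqF.
Qed.
End FlatFunction.

(** * Fubini's theorem for compactly supported continuous functions *)

Section MeasurabilityPlane.
Context {R : realType}.

Lemma open_measurable_prod (U : set (R * R)) : open U -> measurable U.
Proof.
move=> oU.
pose rect (a b c d : rat) : set (R * R) := [set` `]ratr a, ratr b[] `*` [set` `]ratr c, ratr d[].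
pose G a b c d := if pselect (rect a b c d `<=` U) then rect a b c d else set0.
have -> : U = \bigcup_a \bigcup_b \bigcup_c \bigcup_d G a b c d.
  apply/seteqP; split => [[x t] Uxt|p [a _ [b _ [c _ [d _]]]]]; last first.
    by rewrite /G; case: (pselect (rect a b c d `<=` U)) => sub //= /sub.
  have [[V W] /= [Vx Wt] VW] : nbhs (x, t) U by exact: open_nbhs_nbhs.
  have rat_ball (y : R) (S : set R) : nbhs y S -> exists a b : rat,
      (ratr a < y < ratr b) /\ [set` `]ratr a : R, ratr b[] `<=` S.
    move=> /nbhs_ballP[r /= r0 rS].
    have y1 : y - r < y by rewrite ltrBlDr ltrDl.
    have y2 : y < y + r by rewrite ltrDl.
    have [a] := rat_in_itvoo y1; rewrite in_itv/= => /andP[a1 a2].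
    have [b] := rat_in_itvoo y2; rewrite in_itv/= => /andP[b1 b2].
    exists a, b; rewrite a2 b1; split => //.
    move=> z; rewrite /= in_itv/= => /andP[az zb]; apply: rS.
    rewrite /ball/= ltr_norml; apply/andP; split.
      by rewrite ltrBrDl ltrBlDr (lt_trans zb)// addrC.
    by rewrite ltrBlDl -ltrBlDr (lt_trans a1).
  have [a [b [/andP[ax xb] abV]]] := rat_ball x V Vx.
  have [c [d [/andP[ct td] cdW]]] := rat_ball t W Wt.
  exists a => //; exists b => //; exists c => //; exists d => //.
  rewrite /G; case: (pselect (rect a b c d `<=` U)) => [sub|[]] /=.
    by rewrite /rect; split; rewrite /= in_itv/= ?ax ?xb ?ct ?td.
  by move=> [y s] [/= yab scd]; apply: VW; split; [exact: abV|exact: cdW].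
apply: (@bigcupT_measurable_rat _ (R * R)%type) => a.
apply: (@bigcupT_measurable_rat _ (R * R)%type) => b.
apply: (@bigcupT_measurable_rat _ (R * R)%type) => c.
apply: (@bigcupT_measurable_rat _ (R * R)%type) => d.
rewrite /G; case: (pselect (rect a b c d `<=` U)) => sub //=.
by apply: measurableX; exact: measurable_itv.
Qed.

Lemma measurable_fun_open (D : set (R * R)) (f : R * R -> R) :
  open D -> (forall p, D p -> {for p, continuous f}) -> measurable_fun D f.
Proof.
move=> oD cf mD; apply: (measurability _ (RGenOpens.measurableE R)) => //.
move=> _ [_ [a [b ->] <-]]; apply: open_measurable_prod.
rewrite openE => p [Dp fp]; apply: filterI; first exact: open_nbhs_nbhs.
have := cf p Dp; apply; apply: open_nbhs_nbhs; split => //.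
Qed.

Lemma cts_measurable (f : R * R -> R) : cts f -> measurable_fun [set: R * R] f.
Proof. by move=> [cf]; apply: measurable_fun_open => [|p _]; [exact: openT|exact: cf]. Qed.

End MeasurabilityPlane.

(** A name for [m] that carries the proof of its sigma-finiteness, from which the instance used by
    Fubini's theorem is built. *)
Definition sigma_finite_copy d (T : measurableType d) (R : realType) (m : {measure set T -> \bar R})
  (H : sigma_finite setT m) : set T -> \bar R := m.

Section SigmaFiniteCopy.
Context d (T : measurableType d) (R : realType) (m : {measure set T -> \bar R}).
Variable H : sigma_finite setT m.
HB.instance Definition _ := Measure.copy (sigma_finite_copy H) m.
HB.instance Definition _ := @Measure_isSigmaFinite.Build _ _ _ (sigma_finite_copy H) H.
End SigmaFiniteCopy.

Lemma open_upperE {R : realType} : @open_upper R = [set p | 0 < p.2].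
Proof.
apply/seteqP; split => [[x t] [_] /=|[x t] /= t0]; rewrite /open_upper/= ?in_itv/= ?andbT//.
Qed.

Lemma Rintegral_supp d (T : measurableType d) (R : realType) (mu : {measure set T -> \bar R})
    (D D' : set T) (f : T -> R) : D' `<=` D -> (forall x, ~ D' x -> f x = 0) ->
  \int[mu]_(x in D) f x = \int[mu]_(x in D') f x.
Proof.
move=> DD f0; rewrite Rintegral_mkcond [RHS]Rintegral_mkcond.
congr (Rintegral _ _ _); apply/funext => y; rewrite !patchE.
have [D'y|D'y] := boolP (y \in D').
  by rewrite mem_set//; apply: DD; rewrite inE in D'y.
by rewrite f0 ?if_same// => D'y'; move: D'y; rewrite mem_set.
Qed.

Section FubiniCompact.
Context {R : realType} d (T : measurableType d) (m : {sigma_finite_measure set T -> \bar R}).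
(* The identity of R, whose domain may carry another instance of the Borel
   measurable structure. *)
Variable iota : T -> R.
Hypothesis iota_meas : measurable_fun setT iota.
Variables (F : R -> R -> R) (A B c e : R).
Hypothesis F_cont : cts (fun p => F p.1 p.2).
Hypothesis F_supp : forall y s, ~~ ((A <= y <= B) && (c <= s <= e)) -> F y s = 0.
Hypothesis m_finite : (m (iota @^-1` [set` `[A, B]]) < +oo)%E.

Let mAB : measurable (iota @^-1` [set` `[A, B]]).
Proof. by rewrite -[X in measurable X]setTI; apply: iota_meas => //; exact: measurable_itv. Qed.

Let id_meas : measurable_fun setT (fun t : measurableTypeR R => (t : R)).
Proof. by move=> _ Y mY; rewrite setTI. Qed.

Lemma integrable_rect :
  (m \x @lebesgue_measure R)%E.-integrable setT (fun p => (F (iota p.1) p.2)%:E).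
Proof.
pose D := (iota @^-1` [set` `[A, B]]) `*` ([set` `[c, e]] : set (measurableTypeR R)).
have mD : measurable D by apply: measurableX => //; exact: measurable_itv.
have -> : (fun p : T * measurableTypeR R => (F (iota p.1) p.2)%:E) =
    (EFin \o (fun p => F (iota p.1) p.2)) \_ D.
  apply/funext => -[y s]; rewrite patchE; case: ifPn => // nD /=.
  rewrite F_supp//; apply: contraNN nD => /andP[yAB sce].
  by rewrite inE; split; rewrite /= in_itv.
apply: (proj1 (integrable_mkcond _ mD)); apply: measurable_bounded_integrable => //.
- apply: (@le_lt_trans _ _ (m (iota @^-1` [set` `[A, B]]) * lebesgue_measure [set` `[c, e]])%E).
    rewrite le_eqVlt; apply/orP; left; apply/eqP.
    by apply: product_measure1E => //; exact: measurable_itv.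
  apply: lte_mul_pinfty => //; last first.
    by rewrite lebesgue_measure_itv/=; case: ifP; rewrite ?ltry// -EFinB ltry.
  by rewrite ge0_fin_numE.
- apply: measurable_funTS; have mF := cts_measurable F_cont.
  apply: (@measurableT_comp _ _ _ _ _ _ _ _ (fun p : T * measurableTypeR R => (iota p.1, p.2 : R)) mF).
  apply: measurable_fun_pair; first exact: measurableT_comp iota_meas (measurable_fst).
  exact: measurableT_comp id_meas (measurable_snd).
have [M M0 MP] := bounded_rect A B c e F_cont.
exists M; split; first exact: num_real.
move=> M' MM' [y s] [/=]; rewrite !in_itv/= => yAB sce.
by apply: le_trans (MP _ _ yAB sce) _; exact: ltW.
Qed.

Lemma fubini_rect : 0 < c ->
  \int[(m \x @lebesgue_measure R)%E]_(p in [set p | 0 < p.2]) F (iota p.1) p.2 =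
  \int[m]_(y in iota @^-1` [set` `[A, B]]) itg c e (F (iota y)).
Proof.
move=> c0; rewrite -(@Rintegral_supp _ _ _ _ setT)//; last first.
  move=> [y s] /= s0; rewrite F_supp//; apply/negP => /andP[_ /andP[cs _]].
  by apply: s0; exact: lt_le_trans cs.
rewrite -[RHS](@Rintegral_supp _ _ _ _ setT)//; last first.
  move=> y /= nAB; rewrite (@eq_itg _ _ (fun=> 0)).
    by rewrite /itg /Rintegral integral0.
  move=> s _; rewrite F_supp// negb_and; apply/orP; left.
  by apply/negP => yAB; apply: nAB; rewrite in_itv.
rewrite /Rintegral; congr fine.
rewrite -(integral12_prod_meas1 integrable_rect); apply: eq_integral => y _.
have cF := F_cont.
have cFy : cts (F (iota y)) by cont.
rewrite /fubini_F.
rewrite /itg /Rintegral fineK; last first.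
  by apply: integrable_fin_num => //; exact: itg_integrable.
rewrite [RHS]integral_mkcond; apply: eq_integral => s _; rewrite patchE.
case: ifPn => // sce /=; rewrite F_supp//.
by apply: contraNN sce => /andP[_ sce]; rewrite inE/= in_itv.
Qed.
End FubiniCompact.

Section FubiniInstances.
Context {R : realType} (m : {measure set R -> \bar R}).
Hypothesis m_locfin : locally_finite [set: R] m.

Lemma locfin_sigma_finite : sigma_finite setT m.
Proof.
exists (fun n : nat => [set` `[- n%:R : R, n%:R]]); last first.
  by move=> n; split => //; exact: segment_finite.
apply/esym; rewrite -subTset => x _.
have x0 := normr_ge0 x; have /andP[_ /ltW lt1] := truncn_itv x0.
exists (Num.truncn `|x|).+1 => //; rewrite /= in_itv/= -ler_norml.
exact: lt1.
Qed.

Lemma fubini_m (F : R -> R -> R) A B c e : cts (fun p => F p.1 p.2) -> 0 < c ->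
  (forall y s, ~~ ((A <= y <= B) && (c <= s <= e)) -> F y s = 0) ->
  \int[(m \x @lebesgue_measure R)%E]_(p in @open_upper R) F p.1 p.2 =
  mitg m A B (fun y => itg c e (F y)).
Proof.
move=> cF c0 F0; rewrite open_upperE.
have mid : measurable_fun setT (fun y : R => y) by exact: measurable_id.
exact: (@fubini_rect R _ R (sigma_finite_copy locfin_sigma_finite) (fun y => y) mid F A B c e cF F0
  (segment_finite m_locfin A B) c0).
Qed.

Lemma fubini_lebesgue (F : R -> R -> R) A B c e : cts (fun p => F p.1 p.2) -> 0 < c ->
  (forall y s, ~~ ((A <= y <= B) && (c <= s <= e)) -> F y s = 0) ->
  \int[(@lebesgue_measure R \x @lebesgue_measure R)%E]_(p in @open_upper R) F p.1 p.2 =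
  itg A B (fun y => itg c e (F y)).
Proof.
move=> cF c0 F0; rewrite open_upperE.
have mid : measurable_fun setT (fun y : measurableTypeR R => y : R).
  by move=> _ Y mY; rewrite setTI.
apply: (@fubini_rect R _ (measurableTypeR R) (@lebesgue_measure R) (fun y => y) mid F A B c e cF F0) => //.
have fin : (lebesgue_measure ([set` `[A, B]] : set (measurableTypeR R)) < +oo)%E.
  by rewrite lebesgue_measure_itv/=; case: ifP; rewrite ?ltry// -EFinB ltry.
exact: fin.
Qed.
End FubiniInstances.

(** * Second differences from the weak formulation *)

Section Mollification.
Context {R : realType}.

Lemma itg_supp (f : R -> R) A B A' B' : A <= A' -> B' <= B ->
  (forall y, ~~ (A' <= y <= B') -> f y = 0) -> itg A B f = itg A' B' f.
Proof.
move=> AA BB f0; apply: Rintegral_supp => y; rewrite /= ?in_itv/=.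
  by move=> /andP[Ay yB]; rewrite (le_trans AA Ay) (le_trans yB BB).
by move=> /negP; exact: f0.
Qed.

Lemma cont_itg (F : R -> R -> R) c e : cts (fun p => F p.1 p.2) -> cts (fun x => itg c e (F x)).
Proof.
move=> cF; have [ec|ce] := leP e c.
  by rewrite (_ : (fun x => _) = fun=> 0); [exact: cont_cst|apply/funext => x; rewrite itg_empty].
split => x; apply/cvgrPdist_le => eps e0.
have K0 : 0 < e - c by rewrite subr_gt0.
have [d d0 mod] := uniform_cont_fst x x c e cF (divr_gt0 e0 K0).
near=> y.
have cx : cts (F x) by cont.
have cy : cts (F y) by cont.
rewrite -itgB//; have cg : cts (fun t => F x t - F y t) by cont.
apply: le_trans (itg_abs _ _ cg) _.
rewrite [leRHS](_ : _ = eps / (e - c) * (e - c)); last by field; rewrite gt_eqF.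
rewrite -itg_cst ?(ltW ce)//; apply: itg_le; [by cont|exact: cont_cst|] => t tce.
have xx : x <= x <= x by rewrite lexx.
apply: (mod x y t xx tce).
near: y; apply/nbhs_ballP; exists d => //= y; rewrite /ball/=; exact: ltW.
Unshelve. all: by end_near. Qed.

Lemma uniform_cont_snd (F : R -> R -> R) (a b c e eps : R) :
  cts (fun p => F p.1 p.2) -> 0 < eps ->
  exists2 d, 0 < d & forall x t s, a <= x <= b -> c <= t <= e -> `|t - s| <= d ->
    `|F x t - F x s| <= eps.
Proof.
move=> cF e0.
have cF' : cts (fun p => F p.2 p.1).
  by apply: (@cont_comp2 _ _ (fun p : R * R => p.2) (fun p => p.1)) => //; cont.
have [d d0 mod] := @uniform_cont_fst R (fun t x => F x t) c e a b eps cF' e0.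
by exists d => // x t s xab tce ts; exact: mod.
Qed.

Definition approx_unit (r : R) (F : nat -> R -> R) : Prop :=
  [/\ jet F, forall t, 0 <= F 0%N t, forall t, ~~ (0 < t < r) -> F 0%N t = 0 &
      itg 0 r (F 0%N) = 1].

Lemma approx_unit_close r F (f : R -> R) a om : 0 < r -> approx_unit r F -> cts f ->
  (forall s, a <= s <= a + r -> `|f s - f a| <= om) ->
  `|itg a (a + r) (fun s => f s * F 0%N (s - a)) - f a| <= om.
Proof.
move=> r0 [jF F0 Fs F1] cf H; have cF := jet_cont 0%N jF.
have ar : a <= a + r by rewrite lerDl ltW.
have F1a : itg a (a + r) (fun s => F 0%N (s - a)) = 1.
  have := itg_shift (- a) cF ar; rewrite subrr (_ : a + r - a = r); last by ring.
  by rewrite F1.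
have -> : itg a (a + r) (fun s => f s * F 0%N (s - a)) - f a =
    itg a (a + r) (fun s => (f s - f a) * F 0%N (s - a)).
  have cFa : cts (fun s => F 0%N (s - a)) by cont.
  rewrite -[X in _ - X = _]mulr1 -[X in _ - _ * X = _]F1a -itgZ// -itgB; [|by cont..].
  by apply: eq_itg => s _; rewrite mulrBl.
apply: le_trans (itg_abs _ _ _) _; first by cont.
rewrite -[leRHS]mulr1 -F1a -itgZ; last by cont.
apply: itg_le; [by cont|by cont|] => s sa.
by rewrite normrM [X in _ * X]ger0_norm//; apply: ler_wpM2r => //; exact: H.
Qed.

Lemma jet_supp (F : nat -> R -> R) (A B : R) : jet F -> (forall y, ~~ (A <= y <= B) -> F 0%N y = 0) ->
  forall n y, ~~ (A <= y <= B) -> F n y = 0.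
Proof.
move=> jF F0; elim => [//|n IH] y ny.
have D0 : is_derive y 1 (F n) 0.
  apply: near_eq_is_derive (is_derive_cst 0 y (1 : R)).
  move: ny; rewrite negb_and -!ltNge => /orP[yA|yB].
    near=> z; rewrite /cst IH// negb_and -!ltNge; apply/orP; left.
    by near: z; exact: lt_nbhsl.
  near=> z; rewrite /cst IH// negb_and -!ltNge; apply/orP; right.
  by near: z; exact: lt_nbhsr.
by have [_ <-] := jF n y; have [_ ->] := D0.
Unshelve. all: by end_near. Qed.

(** The primitive of an approximate unit is a smooth Heaviside step, and its second primitive a
    smooth positive part; these are the building blocks of the test functions in time and in
    space. *)
Lemma approx_unit_prim r F : 0 < r -> approx_unit r F ->
  [/\ forall x, x <= 0 -> prim (F 0%N) x = 0, forall x, r <= x -> prim (F 0%N) x = 1 &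
      forall x, 0 <= prim (F 0%N) x <= 1].
Proof.
move=> r0 [jF F0 Fs F1]; have cF := jet_cont 0%N jF.
have z0 : prim (F 0%N) 0 = 0 by rewrite prim.unlock !itg_point subrr.
have p0 x : x <= 0 -> prim (F 0%N) x = 0.
  move=> x0; have := itg_prim cF x0; rewrite z0 sub0r (@eq_itg _ _ (fun=> 0)).
    by rewrite itg_cst// mul0r => /esym/eqP; rewrite oppr_eq0 => /eqP.
  by move=> y /andP[_ y0]; rewrite Fs// negb_and -leNgt y0.
have pr x : r <= x -> prim (F 0%N) x = 1.
  move=> rx; have xr := le_trans (ltW r0) rx.
  rewrite -[LHS]subr0 -z0 -itg_prim// (@itg_supp _ _ _ 0 r)// => y.
  by move=> ny; rewrite Fs//; apply: contraNN ny => /andP[/ltW -> /ltW ->].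
split => // x; have mono a b : a <= b -> prim (F 0%N) a <= prim (F 0%N) b.
  by move=> ab; apply: prim_mono.
apply/andP; split.
  have [x0|x0] := leP x 0; first by rewrite p0.
  by rewrite -(p0 0 (lexx 0)); exact/mono/ltW.
have [rx|rx] := leP r x; first by rewrite pr.
by rewrite -(pr r (lexx r)); exact/mono/ltW.
Qed.

Lemma approx_unit_prim2_eq0 r F : 0 < r -> approx_unit r F ->
  forall x : R, x <= 0 -> prim (prim (F 0%N)) x = 0.
Proof.
move=> r0 aF x x0; have [p0 _ _] := approx_unit_prim r0 aF.
have [jF _ _ _] := aF; have cp := prim_cont (jet_cont 0%N jF).
have z0 : prim (prim (F 0%N)) 0 = 0 by rewrite prim.unlock !itg_point subrr.
have := itg_prim cp x0; rewrite z0 sub0r.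
rewrite (@eq_itg _ _ (fun=> 0)); last by move=> y /andP[_ y0]; rewrite p0.
by rewrite itg_cst// mul0r => /esym/eqP; rewrite oppr_eq0 => /eqP.
Qed.

Lemma approx_unit_prim2 r F : 0 < r -> approx_unit r F ->
  forall x : R, Num.max x 0 - r <= prim (prim (F 0%N)) x <= Num.max x 0.
Proof.
move=> r0 aF x; have [p0 p1 p01] := approx_unit_prim r0 aF.
have [jF _ _ _] := aF; have cF := jet_cont 0%N jF; have cp := prim_cont cF.
have z0 := approx_unit_prim2_eq0 r0 aF.
have [x0|x0] := leP x 0; first by rewrite z0//; apply/andP; split; lra.
rewrite -[prim _ x]subr0 -(z0 0 (lexx 0)) -itg_prim ?(ltW x0)//.
have le1 : itg 0 x (prim (F 0%N)) <= itg 0 x (fun=> 1).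
  by apply: itg_le => [//||t _]; [exact: cont_cst|case/andP: (p01 t)].
rewrite itg_cst ?(ltW x0)// subr0 mul1r in le1; rewrite le1 andbT.
have [xr|rx] := leP x r.
  by apply: (@le_trans _ _ 0); [lra|apply: itg_ge0 => t _; case/andP: (p01 t)].
rewrite (@itg_split _ _ 0 r x)//; last by rewrite (ltW r0) (ltW rx).
have h0 : 0 <= itg 0 r (prim (F 0%N)) by apply: itg_ge0 => t _; case/andP: (p01 t).
rewrite (@eq_itg _ (prim (F 0%N)) (fun=> 1) r x); last by move=> t /andP[rt _]; exact: p1.
by rewrite itg_cst ?(ltW rx)//; lra.
Qed.
(** Beyond [r] the smooth positive part is exactly affine, so its second differences have bounded
    support. *)
Lemma approx_unit_prim2_affine r F (x : R) : 0 < r -> approx_unit r F -> r <= x ->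
  prim (prim (F 0%N)) x = prim (prim (F 0%N)) r + (x - r).
Proof.
move=> r0 aF rx; have [_ p1 _] := approx_unit_prim r0 aF.
have [jF _ _ _] := aF; have cp := prim_cont (jet_cont 0%N jF).
apply/eqP; rewrite addrC -subr_eq -itg_prim//.
rewrite (@eq_itg _ _ (fun=> 1)); first by rewrite itg_cst// mul1r.
by move=> y /andP[ry _]; rewrite p1.
Qed.

End Mollification.

Section WeakFormulation.
Context {R : realType} (m : {measure set R -> \bar R}) (U : R * R -> R).
Hypothesis m_locfin : locally_finite [set: R] m.
Hypothesis U_cont : {within @closed_upper R, continuous U}.
Hypothesis U_eq : distributional_solution m U.

(** Continuation by the initial value to negative times gives a function that is continuous on the
    whole plane, to which the calculus of [cts] applies. *)
Definition extend_time (x t : R) : R := U (x, Num.max t 0).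
Local Notation u := extend_time.

Lemma extend_timeE x t : 0 <= t -> u x t = U (x, t).
Proof. by move=> t0; rewrite /u max_l. Qed.

Lemma extend_time_cont : cts (fun p => u p.1 p.2).
Proof.
have cm : cts (fun p : R * R => Num.max p.2 0) by cont.
have ch : continuous (fun p : R * R => (p.1, Num.max p.2 0)).
  apply: continuous_pair; last by case: cm.
  by move=> p; exact: cvg_fst.
have hin (p : R * R) : closed_upper (p.1, Num.max p.2 0).
  by split => //=; rewrite in_itv/= andbT le_max lexx orbT.
split=> p S /= nS; move/subspace_continuousP : U_cont => /(_ _ (hin p)) H.
have HS : nbhs (p.1, Num.max p.2 0) [set q | closed_upper q -> S (U q)] := H S nS.
have := ch p _ HS.
by apply: (@filterS _ (nbhs p)) => q /=; apply; exact: hin.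
Qed.

Lemma test_function_tens F T A B c e : jet F -> jet T -> 0 < c ->
  (forall x, ~~ (A <= x <= B) -> F 0%N x = 0) ->
  (forall s, ~~ (c <= s <= e) -> T 0%N s = 0) ->
  test_function (@open_upper R) (fun p => F 0%N p.1 * T 0%N p.2).
Proof.
move=> jF jT c0 F0 T0; split; first exact: smooth_tens.
exists ([set` `[A, B]] `*` [set` `[c, e]]); split.
- by apply: compact_setX; exact: segment_compact.
- move=> [x s] [_ /=]; rewrite in_itv/= => /andP[cs _]; split => //=.
  by rewrite in_itv/= andbT (lt_le_trans c0).
move=> [x s] /= nK; have [xAB|/F0 ->] := boolP (A <= x <= B); last by rewrite mul0r.
rewrite T0 ?mulr0//; apply/negP => sce; apply: nK; split; rewrite /= in_itv/=.
  exact: xAB.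
exact: sce.
Qed.

Lemma weak_tens F T A B c e : jet F -> jet T -> 0 < c ->
  (forall x, ~~ (A <= x <= B) -> F 0%N x = 0) ->
  (forall s, ~~ (c <= s <= e) -> T 0%N s = 0) ->
  - 2 * mitg m A B (fun y => itg c e (fun s => u y s * (F 0%N y * T 1%N s))) =
  itg A B (fun x => itg c e (fun s => u x s * (F 2%N x * T 0%N s))).
Proof.
move=> jF jT c0 F0 T0; have cu := extend_time_cont.
have supp n k y s : ~~ ((A <= y <= B) && (c <= s <= e)) -> u y s * (F n y * T k s) = 0.
  rewrite negb_and => /orP[ny|ns].
    by rewrite (jet_supp jF F0)// mul0r mulr0.
  by rewrite (jet_supp jT T0)// !mulr0.
have cFT n k : cts (fun p : R * R => u p.1 p.2 * (F n p.1 * T k p.2)).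
  by have cF := jet_cont n jF; have cT := jet_cont k jT; cont.
rewrite -(@fubini_m R m m_locfin _ A B c e (cFT 0%N 1%N) c0 (supp _ _)).
rewrite -(@fubini_lebesgue R _ A B c e (cFT 2%N 0%N) c0 (supp _ _)).
have := U_eq (test_function_tens jF jT c0 F0 T0).
have E (p : R * R) : p \in @open_upper R -> U p = u p.1 p.2.
  by rewrite inE open_upperE /=; case: p => x s /= s0; rewrite extend_timeE// ltW.
under eq_Rintegral => p pu do rewrite ddt_tens// E//.
under [RHS]eq_Rintegral => p pu do rewrite ddx_tens// E//.
by [].
Qed.

Lemma itg_by_parts (f T0 T1 : R -> R) c e : cts f -> cts T1 -> c <= e ->
  (forall t : R, is_derive t 1 T0 (T1 t)) -> T0 c = 0 -> T0 e = 0 ->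
  itg c e (fun s => f s * T0 s) = - itg c e (fun s => prim f s * T1 s).
Proof.
move=> cf cT1 ce dT Tc Te; have cT0 := is_derive_cont dT; have cV := prim_cont cf.
have D (t : R) : is_derive t 1 (fun t => prim f t * T0 t) (f t * T0 t + prim f t * T1 t).
  rewrite (_ : _ + _ = prim f t * T1 t + T0 t * f t); last by ring.
  by apply: is_derive_mul => // s; exact: prim_is_derive.
have := itg_FTC D _ ce; rewrite Tc Te !mulr0 subrr => E.
apply/eqP; rewrite -addr_eq0 -itgD; [|by cont..].
by apply/eqP/E; cont.
Qed.

Lemma prim_lip (f : R -> R) (M a b : R) : cts f -> a <= b -> (forall s, a <= s <= b -> `|f s| <= M) ->
  `|prim f b - prim f a| <= M * (b - a).
Proof.
move=> cf ab fM; rewrite -itg_prim//; apply: le_trans (itg_abs _ _ cf) _.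
by rewrite -itg_cst//; apply: itg_le; [by cont|exact: cont_cst|].
Qed.

(** The time factor is a smooth step at [t1] minus one at [t2]. It tends to the indicator of
    [[t1, t2]], and its derivative to the difference of the unit masses at [t1] and [t2], which
    absorbs the minus sign of the weak equation. The space factor remains smooth. *)
Lemma weak_int F A B t1 t2 : jet F -> (forall x, ~~ (A <= x <= B) -> F 0%N x = 0) ->
  0 < t1 -> t1 <= t2 ->
  itg A B (fun x => F 2%N x * itg t1 t2 (u x)) =
  2 * mitg m A B (fun y => F 0%N y * (u y t2 - u y t1)).
Proof.
move=> jF F0 t10 t12; have cu := extend_time_cont.
have cux x : cts (u x) by cont.
have cF n := jet_cont n jF.
have [M M0 MP] := bounded_rect A B t1 (t2 + 1) cu.
set L := itg A B _; set D := 2 * _.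
suff : `|L - D| <= 0 by rewrite normr_le0 subr_eq0 => /eqP.
apply: (@le_of_le_addZ _ _ _ (itg A B (fun x => 2 * M * `|F 2%N x|) + 2 * mitg m A B (fun y => 2 * `|F 0%N y|))).
move=> w /andP[w0 w1]; rewrite add0r.
have [d d0 mod] := uniform_cont_snd A B t1 t2 cu w0.
pose r := Num.min d w.
have r0 : 0 < r by rewrite lt_min d0 w0.
have rd : r <= d by rewrite ge_min lexx.
have rw : r <= w by rewrite ge_min lexx orbT.
have [b bP] := mollifier r0; have [jb b0 bs b1] := bP.
have cb := jet_cont 0%N jb; have cpb := prim_cont cb.
have [p0 p1 p01] := approx_unit_prim r0 bP.
pose T n s := 1 * jet_prim b n (s + - t1) + (- 1) * jet_prim b n (s + - t2).
have jT : jet T by apply: jet_lin; apply: jet_translate; exact: jet_primP.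
have T0 s : ~~ (t1 <= s <= t2 + r) -> T 0%N s = 0.
  rewrite negb_and -!ltNge /T/= mul1r mulN1r => /orP[st|st].
    by rewrite !p0 ?subrr//; lra.
  by rewrite !p1 ?subrr//; lra.
have := weak_tens jF jT t10 F0 T0.
have t1e : t1 <= t2 + r by lra.
pose mol (f : R -> R) a := itg a (a + r) (fun s => f s * b 0%N (s - a)).
have molE (f : R -> R) a : cts f -> t1 <= a -> a <= t2 ->
    itg t1 (t2 + r) (fun s => f s * b 0%N (s - a)) = mol f a.
  move=> cf ta at2; apply: itg_supp => //; first by rewrite lerD2r.
  move=> s ns; rewrite bs ?mulr0//; apply: contraNN ns => /andP[s1 s2]; lra.
have TE (f : R -> R) : cts f -> itg t1 (t2 + r) (fun s => f s * T 1%N s) = mol f t1 - mol f t2.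
  move=> cf; rewrite -!molE// -itgB; [|by cont..].
  by apply: eq_itg => s _; rewrite /T/=; ring.
have cmol a (G : R -> R -> R) : cts (fun p => G p.1 p.2) -> cts (fun x => mol (G x) a).
  move=> cG; apply: (@cont_itg R (fun x s => G x s * b 0%N (s - a))); cont.
have -> : mitg m A B (fun y => itg t1 (t2 + r) (fun s => u y s * (F 0%N y * T 1%N s))) =
    mitg m A B (fun y => F 0%N y * (mol (u y) t1 - mol (u y) t2)).
  apply: eq_mitg => y _; rewrite -TE// -itgZ; last by have := jet_cont 1%N jT; cont.
  by apply: eq_itg => s _; ring.
have cT0 := jet_cont 0%N jT.
pose Q x := itg t1 (t2 + r) (fun s => u x s * T 0%N s).
(* Integration by parts expresses the integral against the smooth indicator by mollified values of a
   primitive, so that both sides are compared through [approx_unit_close]. *)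
have QE x : Q x = mol (prim (u x)) t2 - mol (prim (u x)) t1.
  rewrite -opprB -TE; last exact: prim_cont.
  have Tc : T 0%N t1 = 0 by rewrite /T/= !p0 ?mulr0 ?addr0//; lra.
  have Te : T 0%N (t2 + r) = 0 by rewrite /T/= !p1 ?mulN1r ?mulr1 ?subrr//; lra.
  exact: itg_by_parts (cux x) (jet_cont 1%N jT) t1e (jT 0%N) Tc Te.
have -> : itg A B (fun x => itg t1 (t2 + r) (fun s => u x s * (F 2%N x * T 0%N s))) =
    itg A B (fun x => F 2%N x * Q x).
  apply: eq_itg => x _; rewrite -itgZ; last by cont.
  by apply: eq_itg => s _; ring.
set I1 := mitg m A B _; set I2 := itg A B _ => EQ.
have cW : cts (fun x => itg t1 t2 (u x)) by exact: cont_itg.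
have cQ : cts Q by apply: (@cont_itg R (fun x s => u x s * T 0%N s)); cont.
have cm1 := cmol t1 _ cu; have cm2 := cmol t2 _ cu.
have c0 := cF 0%N; have c2 := cF 2%N.
have LI : `|L - I2| <= w * itg A B (fun x => 2 * M * `|F 2%N x|).
  rewrite -itgB; [|by cont..]; rewrite -itgZ; last by cont.
  apply: le_trans (itg_abs _ _ _) _; first by cont.
  apply: itg_le; [by cont..|] => x xAB.
  rewrite QE -mulrBr normrM [leLHS]mulrC [w * _]mulrA; apply: ler_wpM2r => //.
  have close a : t1 <= a <= t2 -> `|mol (prim (u x)) a - prim (u x) a| <= M * w.
    move=> ta; apply: approx_unit_close bP _ _ => //; first exact: prim_cont.
    move=> s sa; apply: le_trans (prim_lip (M := M) (cux x) _ _) _.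
    + by case/andP: sa.
    + by move=> s' s'a; apply: MP => //; lra.
    + by apply: ler_wpM2l => //; lra.
  have h1 := close t1; have h2 := close t2.
  rewrite lexx t12 in h1; rewrite lexx t12 in h2.
  rewrite itg_prim//; move: (h1 isT) (h2 isT); clear.
  by rewrite !ler_norml => /andP[? ?] /andP[? ?]; apply/andP; split; lra.
have DI : `|2 * I1 + D| <= w * (2 * mitg m A B (fun y => 2 * `|F 0%N y|)).
  rewrite -mulrDr -mitgD//; [|by cont..]; rewrite normrM ger0_norm// mulrCA.
  apply: ler_wpM2l => //; rewrite -mitgZ//; last by cont.
  apply: le_trans (mitg_abs _ _ _ _) _ => //; first by cont.
  apply: mitg_le => //; [by cont..|] => y yAB.
  rewrite -mulrDr normrM [leLHS]mulrC [w * _]mulrA; apply: ler_wpM2r => //.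
  have close a : t1 <= a <= t2 -> `|mol (u y) a - u y a| <= w.
    move=> ta; apply: approx_unit_close bP _ _ => // s sa.
    by rewrite distrC; apply: mod => //; rewrite ler_norml; apply/andP; split; lra.
  have h1 := close t1; have h2 := close t2.
  rewrite lexx t12 in h1; rewrite lexx t12 in h2.
  move: (h1 isT) (h2 isT); clear.
  by rewrite !ler_norml => /andP[? ?] /andP[? ?]; apply/andP; split; lra.
rewrite mulrDr; move: EQ LI DI; set X := itg A B _; set Y := 2 * mitg _ _ _ _.
by rewrite !ler_norml => EQ /andP[? ?] /andP[? ?]; apply/andP; split; lra.
Qed.


(** The tent is the second difference of the positive part. The same second difference of the smooth
    positive part is an admissible [F], within [4 * r] of the tent, and its second derivative
    consists of three mollifiers, which evaluate [W] near [x - d], [x] and [x + d]. *)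
Lemma hat_equation (x d t1 t2 A B : R) : 0 < d -> 0 < t1 -> t1 <= t2 -> A <= x - d -> x + d <= B ->
  itg t1 t2 (fun s => u (x + d) s - 2 * u x s + u (x - d) s) =
  2 * mitg m A B (fun y => hat d (y - x) * (u y t2 - u y t1)).
Proof.
move=> d0 t10 t12 Axd xdB; have cu := extend_time_cont.
have cux z : cts (u z) by cont.
pose W z := itg t1 t2 (u z).
have cW : cts W by exact: cont_itg.
have -> : itg t1 t2 (fun s => u (x + d) s - 2 * u x s + u (x - d) s) = W (x + d) - 2 * W x + W (x - d).
  by rewrite /W -itgZ// -itgB// ?itgD//; cont.
have ch := @hat_cont R d x.
pose D y := u y t2 - u y t1.
have cD : cts D by rewrite /D; cont.
have chD : cts (fun y => hat d (y - x) * D y) by cont.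
have hat0 y : ~~ (x - d <= y <= x + d) -> hat d (y - x) * D y = 0.
  move=> ny; rewrite hat_eq0 ?mul0r// leNgt; apply: contraNN ny.
  by rewrite ltr_norml => /andP[? ?]; apply/andP; split; lra.
rewrite (mitg_supp m chD Axd xdB hat0).
(* The mollifiers reach to the right by [r <= 1], so the smooth tent leaves the support of the
   tent. *)
have xdB1 : x + d <= x + d + 1 by lra.
rewrite -(mitg_supp m chD (lexx _) xdB1 hat0).
set A' := x - d; set B' := x + d + 1.
set L := W _ - _ + _; set D' := 2 * _.
suff : `|L - D'| <= 0 by rewrite normr_le0 subr_eq0 => /eqP.
apply: (@le_of_le_addZ _ _ _ (4 + 2 * mitg m A' B' (fun y => 4 * `|D y|))).
move=> w /andP[w0 w1]; rewrite add0r.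
have [dl dl0 mod] := cont_mod A' B' cW w0.
pose r := Num.min dl w.
have r0 : 0 < r by rewrite lt_min dl0 w0.
have rd : r <= dl by rewrite ge_min lexx.
have rw : r <= w by rewrite ge_min lexx orbT.
have [b bP] := mollifier r0; have [jb b0 bs b1] := bP.
have cb := jet_cont 0%N jb.
pose K := jet_prim (jet_prim b).
have jK : jet K by do 2 apply: jet_primP.
pose F n y := 1 * (1 * K n (y + - (x - d)) + (- 2) * K n (y + - x)) + 1 * K n (y + - (x + d)).
have jF : jet F by do 2 (apply: jet_lin; last exact: jet_translate); exact: jet_translate.
have K2 := approx_unit_prim2 r0 bP.
have Ka := approx_unit_prim2_affine r0 bP.
have F0E y : F 0%N y = prim (prim (b 0%N)) (y - (x - d)) - 2 * prim (prim (b 0%N)) (y - x) +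
    prim (prim (b 0%N)) (y - (x + d)).
  by rewrite /F/= !mul1r mulNr.
have F0 y : ~~ (A' <= y <= B') -> F 0%N y = 0.
  have Kn := approx_unit_prim2_eq0 r0 bP.
  rewrite negb_and -!ltNge F0E /A' /B' => /orP[yA|yB].
    by rewrite !Kn ?mulr0 ?subrr ?addr0//; lra.
  rewrite (Ka (y - (x - d))); last by lra.
  rewrite (Ka (y - x)); last by lra.
  by rewrite (Ka (y - (x + d))); last lra; ring.
have := weak_int jF F0 t10 t12.
pose mol (f : R -> R) a := itg a (a + r) (fun s => f s * b 0%N (s - a)).
have cFn n := jet_cont n jF.
have molE a : A' <= a <= x + d -> itg A' B' (fun s => W s * b 0%N (s - a)) = mol W a.
  move=> /andP[Aa aB]; apply: itg_supp => //; first by rewrite /B'; lra.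
  move=> s ns; rewrite bs ?mulr0//; apply: contraNN ns => /andP[s1 s2]; lra.
have -> : itg A' B' (fun y => F 2%N y * itg t1 t2 (u y)) = mol W (x + d) - 2 * mol W x + mol W (x - d).
  rewrite -!molE /A'; [|by apply/andP; split; lra..].
  rewrite -itgZ -?itgB -?itgD; [|by cont..].
  by apply: eq_itg => s _; rewrite /F/= -/(W s); ring.
have close a : A' <= a <= x + d -> `|mol W a - W a| <= w.
  move=> aAB; apply: approx_unit_close bP _ _ => // s sa.
  rewrite distrC; apply: mod; first by rewrite /B'; lra.
  by rewrite ler_norml; apply/andP; split; lra.
have c1 : `|mol W (x + d) - W (x + d)| <= w by apply: close; rewrite /A'; lra.
have c2 : `|mol W x - W x| <= w by apply: close; rewrite /A'; lra.
have c3 : `|mol W (x - d) - W (x - d)| <= w by apply: close; rewrite /A'; lra.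
have cF0 := cFn 0%N.
have DI : `|2 * mitg m A' B' (fun y => F 0%N y * (u y t2 - u y t1)) - D'| <=
    w * (2 * mitg m A' B' (fun y => 4 * `|D y|)).
  rewrite -mulrBr -mitgB//; [|by cont..]; rewrite normrM ger0_norm// mulrCA.
  apply: ler_wpM2l => //; rewrite -mitgZ//; last by cont.
  apply: le_trans (mitg_abs _ _ _ _) _ => //; first by cont.
  apply: mitg_le => //; [by cont..|] => y yAB.
  rewrite -/(D y) -mulrBl normrM [w * _]mulrA; apply: ler_wpM2r => //.
  rewrite F0E hatE; last exact: ltW.
  have := K2 (y - (x - d)); have := K2 (y - x); have := K2 (y - (x + d)).
  rewrite (_ : y - x + d = y - (x - d)); last by ring.
  rewrite (_ : y - x - d = y - (x + d)); last by ring.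
  move: (prim _ _) (prim _ _) (prim _ _) (Num.max _ _) (Num.max _ _) (Num.max _ _).
  clear -rw => k1 k2 k3 z1 z2 z3 /andP[? ?] /andP[? ?] /andP[? ?].
  by rewrite ler_norml; apply/andP; split; lra.
set I1 := 2 * mitg _ _ _ _; rewrite -/I1 in DI * => EQ.
move: DI; rewrite -EQ /L mulrDr; move: c1 c2 c3; set Y := w * (2 * _).
move: (mol _ _) (mol _ _) (mol _ _) (W _) (W _) (W _) D' Y; clear -w0 => m1 m2 m3 w1 w2 w3 D' Y.
by rewrite !ler_norml => /andP[? ?] /andP[? ?] /andP[? ?] /andP[? ?]; apply/andP; split; lra.
Qed.

End WeakFormulation.

(** * Signed measures with a density *)

(* The image under h of the measure with density f^+ with respect to mu. *)
Definition density d d' (S : measurableType d) (T : measurableType d') (R : realType)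
    (mu : {measure set S -> \bar R}) (h : S -> T) (mh : measurable_fun setT h)
    (f : S -> R) (mf : measurable_fun setT f) : set T -> \bar R :=
  fun A => (\int[mu]_(x in h @^-1` A) (Num.max (f x) 0)%:E)%E.

Section Density.
Context d d' (S : measurableType d) (T : measurableType d') (R : realType).
Variables (mu : {measure set S -> \bar R}) (h : S -> T) (f : S -> R).
Hypotheses (mh : measurable_fun setT h) (mf : measurable_fun setT f).
Local Open Scope ereal_scope.

Let g x : \bar R := (Num.max (f x) 0)%:E.
Let g0 x : 0 <= g x. Proof. by rewrite lee_fin le_max lexx orbT. Qed.
Let mg : measurable_fun setT g.
Proof.
apply/measurable_EFinP; apply: measurable_maxr => //.
Qed.
Let mpre A : measurable A -> measurable (h @^-1` A).
Proof. by move=> mA; rewrite -[X in measurable X]setTI; exact: mh. Qed.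

Local Notation nu := (density mu mh mf).

Let nu0 : nu set0 = 0. Proof. by rewrite /density preimage_set0 integral_set0. Qed.
Let nu_ge0 A : 0 <= nu A. Proof. by apply: integral_ge0 => x _; exact: g0. Qed.
Let nu_sigma : semi_sigma_additive nu.
Proof.
move=> F mF tF mUF; rewrite /density preimage_bigcup.
apply: (@semi_sigma_additive_nng_induced _ S R mu g mg g0).
- by move=> n; exact: mpre.
- apply/trivIsetP => /= i j _ _ ij; rewrite -preimage_setI.
  by move/trivIsetP : tF => /(_ _ _ _ _ ij) ->//; rewrite preimage_set0.
- by rewrite -preimage_bigcup; exact: mpre.
Qed.

HB.instance Definition _ := isMeasure.Build _ _ _ nu nu0 nu_ge0 nu_sigma.

Import HBNNSimple.

(** Change of variables: for simple functions it is the definition of the measure, and monotone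
    convergence extends it. *)
Lemma ge0_integral_density (phi : T -> \bar R) : measurable_fun setT phi ->
  (forall x, 0 <= phi x) ->
  \int[nu]_x phi x = \int[mu]_x (phi (h x) * g x).
Proof.
move=> mphi phi0; pose k := nnsfun_approx measurableT mphi.
have kphi x : (EFin \o k n) x @[n --> \oo] --> phi x.
  by apply: cvg_nnsfun_approx.
have mk n : measurable_fun setT (EFin \o k n).
  by apply/measurable_EFinP.
have mkh n : measurable_fun setT (fun x => ((k n) (h x))%:E).
  exact: measurableT_comp (mk n) mh.
have -> : \int[nu]_x phi x = lim (\int[nu]_x (EFin \o k n) x @[n --> \oo]).
  under eq_integral => x _ do rewrite -(cvg_lim _ (kphi x))//.
  apply: monotone_convergence => //.
  - by move=> n x _; rewrite lee_fin.
  - by move=> x _ a b ab; rewrite lee_fin; exact/lefP/nd_nnsfun_approx.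
have -> : \int[mu]_x (phi (h x) * g x) = lim (\int[mu]_x ((k n (h x))%:E * g x) @[n --> \oo]).
  have E x : (((k n (h x))%:E * g x) @[n --> \oo]) --> phi (h x) * g x.
    by apply: cvgeZr => //; exact: kphi.
  under eq_integral => x _ do rewrite -(cvg_lim _ (E x))//.
  apply: monotone_convergence => //.
  - by move=> n; exact: emeasurable_funM.
  - by move=> n x _; rewrite mule_ge0// lee_fin.
  - by move=> x _ a b ab; rewrite lee_wpmul2r// lee_fin; exact/lefP/nd_nnsfun_approx.
suff E n : \int[nu]_x (EFin \o k n) x = \int[mu]_x ((k n (h x))%:E * g x).
  by under eq_fun do rewrite E.
rewrite integralT_nnsfun sintegralE.
pose I r x : \bar R := (r * \1_(k n @^-1` [set r]) (h x))%:E.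
have I0 r x : 0 <= I r x by exact: nnfun_muleindic_ge0.
have mI r : measurable_fun setT (I r).
  apply/measurable_EFinP; apply: measurable_funM => //.
  exact: (measurableT_comp (measurable_indic (measurable_sfunP (k n) (measurable_set1 r))) mh).
transitivity (\int[mu]_x \sum_(r \in range (k n)) (I r x * g x)).
  rewrite ge0_integral_fsum//; last 2 first.
  - by move=> r; exact: emeasurable_funM.
  - by move=> r x _; exact: mule_ge0.
  apply: eq_fsbigr => r; rewrite inE => -[t _ <-].
  have mr := mpre (measurable_sfunP (k n) (measurable_set1 (k n t))).
  transitivity ((k n t)%:E * \int[mu]_x (g \_ (h @^-1` (k n @^-1` [set k n t]))) x).
    by congr (_ * _); exact: integral_mkcond.
  have mgr : measurable_fun setT (g \_ (h @^-1` (k n @^-1` [set k n t]))).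
    by apply/(measurable_restrictT _ mr); exact: measurable_funTS.
  rewrite -ge0_integralZl ?lee_fin//; last first.
    by move=> x _; apply: erestrict_ge0 => y _; exact: g0.
  apply: eq_integral => x _; rewrite patchE /I indicE EFinM.
  rewrite (_ : (x \in h @^-1` (k n @^-1` [set k n t])) = (h x \in k n @^-1` [set k n t])).
    by case: ifPn => _; rewrite ?mule1// !mule0 ?mul0e.
  by apply/idP/idP; rewrite !inE.
apply: eq_integral => x _.
rewrite -ge0_mule_fsuml//; congr (_ * _).
by rewrite [in RHS](fimfunE (k n)) -fsumEFin.
Qed.

Lemma integral_density (phi : T -> \bar R) : measurable_fun setT phi ->
  \int[nu]_x phi x = \int[mu]_x (phi (h x) * g x).
Proof.
move=> mphi; rewrite [LHS](@integralE _ _ _ nu) [RHS]integralE.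
rewrite !ge0_integral_density//; [|exact: measurable_funeneg|exact: measurable_funepos].
congr (_ - _); apply: eq_integral => x _; rewrite ?funeposE ?funenegE.
  by rewrite maxe_pMl// mul0e.
by rewrite -mulNe maxe_pMl// mul0e.
Qed.

Lemma density_eq0 A D : measurable A -> measurable D -> (forall x, A (h x) -> ~ D x -> (f x <= 0)%R) ->
  mu (h @^-1` A `&` D) = 0 -> nu A = 0.
Proof.
move=> mA mD f0 A0; have mAD : measurable (h @^-1` A `&` D) by apply: measurableI => //; exact: mpre.
rewrite /density (_ : \int[mu]_(x in h @^-1` A) g x = \int[mu]_(x in h @^-1` A `&` D) g x).
  by apply: null_set_integral => //; exact: measurable_funTS.
rewrite integral_mkcond [RHS]integral_mkcond; apply: eq_integral => x _.
rewrite !patchE in_setI; case: ifPn => //= Ax.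
case: ifPn => //; rewrite notin_setE => nD; rewrite inE in Ax.
by rewrite /g max_r//; exact: f0.
Qed.

Lemma density_lty A (M : R) : measurable A -> (0 <= M)%R -> (forall x, A (h x) -> (f x <= M)%R) ->
  mu (h @^-1` A) < +oo -> nu A < +oo.
Proof.
move=> mA M0 fM fin; have mhA := mpre mA.
apply: (@le_lt_trans _ _ (\int[mu]_(x in h @^-1` A) M%:E)).
  apply: ge0_le_integral => //.
  - by move=> x _; exact: g0.
  - exact: measurable_funTS.
  - by move=> x Ax; rewrite lee_fin ge_max M0 fM.
rewrite integral_cst//; apply: lte_mul_pinfty => //; rewrite ge0_fin_numE//.
Qed.

End Density.

Section SignedDensity.
Context d d' (S : measurableType d) (T : measurableType d') (R : realType).
Variables (mu : {measure set S -> \bar R}) (h : S -> T) (f : T -> R).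
Hypotheses (mh : measurable_fun setT h) (mf : measurable_fun setT f).

Let mfh : measurable_fun setT (f \o h).
Proof. exact: measurableT_comp. Qed.
Let mNfh : measurable_fun setT (fun x => - f (h x)).
Proof. exact: measurableT_comp. Qed.

Let pos := density mu mh mfh.
Let neg := density mu mh mNfh.

(** The density is a function on the target [T] composed with [h]; hence its sign is constant on
    fibres and the set where it is nonnegative separates the images of the two parts. *)
Lemma density_singular : exists2 P : set T, measurable P & pos (~` P) = 0%E /\ neg P = 0%E.
Proof.
have E : [set x | 0 <= f x] = f @^-1` [set` `[0, +oo[].
  by apply/seteqP; split => x /=; rewrite in_itv/= andbT.
have mP : measurable [set x | 0 <= f x].
  by rewrite E -[X in measurable X]setTI; apply: mf => //; exact: measurable_itv.
exists [set x | 0 <= f x] => //; split.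
  apply: (density_eq0 mh mfh (measurableC mP) (@measurable0 _ S)); last by rewrite setI0 measure0.
  by move=> x /negP; rewrite -ltNge => /ltW.
apply: (density_eq0 mh mNfh mP (@measurable0 _ S)); last by rewrite setI0 measure0.
by move=> x; rewrite /= oppr_le0.
Qed.

Definition signed_density : signed_measure T R := SignedMeasure density_singular.

Lemma signed_Rintegral_density (phi : T -> R) : measurable_fun setT phi ->
  signed_Rintegral signed_density phi =
  \int[mu]_x (phi (h x) * Num.max (f (h x)) 0) - \int[mu]_x (phi (h x) * Num.max (- f (h x)) 0).
Proof.
move=> mphi; have mE : measurable_fun setT (EFin \o phi) by exact/measurable_EFinP.
rewrite /signed_Rintegral /signed_density /=.
have Ep := @integral_density _ _ _ _ _ mu h _ mh mfh _ mE.
have En := @integral_density _ _ _ _ _ mu h _ mh mNfh _ mE.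
have R1 : \int[mu]_x (phi (h x) * Num.max (f (h x)) 0) =
    fine (\int[mu]_x ((EFin \o phi) (h x) * (Num.max ((f \o h) x) 0)%:E))%E.
  by rewrite /Rintegral; congr fine; apply: eq_integral => x _; rewrite /= EFinM.
have R2 : \int[mu]_x (phi (h x) * Num.max (- f (h x)) 0) =
    fine (\int[mu]_x ((EFin \o phi) (h x) * (Num.max (- f (h x)) 0)%:E))%E.
  by rewrite /Rintegral; congr fine; apply: eq_integral => x _; rewrite /= EFinM.
by rewrite R1 R2 -Ep -En.
Qed.

Lemma var_density_eq0 A D : measurable A -> measurable D -> (forall x, A (h x) -> ~ D x -> f (h x) = 0) ->
  mu (h @^-1` A `&` D) = 0%E -> var_measure signed_density A = 0%E.
Proof.
move=> mA mD f0 A0.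
have Ep : density mu mh mfh A = 0%E.
  by apply: (density_eq0 mh mfh mA mD _ A0) => x Ax nD; rewrite /= f0.
have En : density mu mh mNfh A = 0%E.
  by apply: (density_eq0 mh mNfh mA mD _ A0) => x Ax nD; rewrite f0// oppr0.
exact: etrans (congr2 adde Ep En) (adde0 0%E).
Qed.

Lemma var_density_lty A M : measurable A -> (forall x, A (h x) -> `|f (h x)| <= M) ->
  (mu (h @^-1` A) < +oo)%E -> (var_measure signed_density A < +oo)%E.
Proof.
move=> mA fM fin.
have Hp : (density mu mh mfh A < +oo)%E.
  apply: (density_lty mh mfh mA (normr_ge0 M) _ fin) => x Ax.
  by apply: le_trans (ler_norm _) _; apply: le_trans (fM x Ax) (ler_norm _).
have Hn : (density mu mh mNfh A < +oo)%E.
  apply: (density_lty mh mNfh mA (normr_ge0 M) _ fin) => x Ax.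
  by apply: le_trans (ler_norm _) _; rewrite normrN; apply: le_trans (fM x Ax) (ler_norm _).
exact: lte_add_pinfty Hp Hn.
Qed.

End SignedDensity.

(** * Absolute continuity *)

Lemma max0_split {R : realType} (z : R) : Num.max z 0 - Num.max (- z) 0 = z.
Proof. by have [z0|z0] := leP z 0; [rewrite max_l|rewrite max_r]; lra. Qed.

Section AbsoluteContinuity.
Context {R : realType} (m : {measure set R -> \bar R}) (U : R * R -> R).
Hypothesis m_locfin : locally_finite [set: R] m.
Hypothesis m_unbounded : forall b : R, 0 < b ->
  (msupp m `&` `]-oo, - b] !=set0) /\ (msupp m `&` `[b, +oo[ !=set0).
Hypothesis U_cont : {within @closed_upper R, continuous U}.
Hypothesis U_eq : distributional_solution m U.

Local Notation u := (extend_time U).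
Local Notation P := (dudt u).
Let u_cont := extend_time_cont U_cont.
Let u_eqn := hat_equation m_locfin U_cont U_eq.

(** The time derivative is continuous at positive times only. Freezing the time below [c] gives a
    function on the whole plane that agrees with it for times at least [c]. *)
Lemma dudt_max_cont c : 0 < c -> cts (fun p : R * R => P p.1 (Num.max p.2 c)).
Proof.
move=> c0; have cm : cts (fun p : R * R => Num.max p.2 c) by cont.
have ch : continuous (fun p : R * R => (p.1, Num.max p.2 c)).
  apply: continuous_pair; last by case: cm.
  by move=> p; exact: cvg_fst.
have H (p : R * R) : {for (p.1, Num.max p.2 c), continuous (fun q => P q.1 q.2)}.
  by apply: (dudt_cont m_locfin m_unbounded u_cont u_eqn); rewrite lt_max c0 orbT.
split => p; exact: (@continuous_comp _ _ _ (fun p => (p.1, Num.max p.2 c)) (fun q => P q.1 q.2) p (ch p) (H p)).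
Qed.

Lemma dudt_slice_cont t : 0 < t -> cts (fun y => P y t).
Proof.
move=> t0; rewrite (_ : (fun y => P y t) = fun y => P y (Num.max t t)); last first.
  by apply/funext => y; rewrite maxxx.
have cP := dudt_max_cont t0.
apply: (@cont_comp2 R _ id (fun=> t) (fun y s => P y (Num.max s t))) => //; [exact: cont_id|exact: cont_cst].
Qed.

(** The identity [weak_int] on [[t, t + e]], divided by [e], in the limit where [e] tends to 0: the
    averages of [u] and its difference quotients converge uniformly on [[A, B]]. *)
Lemma dudt_slice F A B t : jet F -> (forall x, ~~ (A <= x <= B) -> F 0%N x = 0) -> 0 < t ->
  itg A B (fun x => u x t * F 2%N x) = 2 * mitg m A B (fun y => F 0%N y * P y t).
Proof.
move=> jF F0 t0; have cP := dudt_slice_cont t0.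
have cu := u_cont; have cux x : cts (u x) by cont.
have cF0 := jet_cont 0%N jF; have cF2 := jet_cont 2%N jF.
have [K K0 KP] : exists2 K, 0 <= K & forall eps x, 0 < eps <= 1 -> A <= x <= B ->
    `|dif eps (u x) t / eps - P x t| <= K * Num.sqrt eps.
  have [AB|BA] := leP A B; last by exists 0 => // eps x _ /andP[Ax xB]; lra.
  have [K K0 [KP _]] := dudt_rate m_locfin m_unbounded u_cont u_eqn AB t0 (lexx t).
  by exists K => // eps x e01 xAB; apply: KP => //; rewrite lexx.
set L := itg A B _; set D := 2 * _.
suff : `|L - D| <= 0 by rewrite normr_le0 subr_eq0 => /eqP.
apply: (@le_of_le_addZ _ _ _ (itg A B (fun x => `|F 2%N x|) + 2 * mitg m A B (fun y => K * `|F 0%N y|))).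
move=> w /andP[w0 w1]; rewrite add0r.
have [d d0 mod] := uniform_cont_snd A B t t cu w0.
have [s /andP[s0 s1] sP] := sqrt_small w0.
pose e := Num.min d s.
have e0 : 0 < e by rewrite lt_min d0 s0.
have ed : e <= d by rewrite ge_min lexx.
have es : e <= s by rewrite ge_min lexx orbT.
have ew : Num.sqrt e <= w by apply: sP; rewrite e0.
have e01 : 0 < e <= 1 by rewrite e0 (le_trans es).
have te : t <= t + e by lra.
have := weak_int m_locfin U_cont U_eq jF F0 t0 te.
have cI : cts (fun x => itg t (t + e) (u x)) by exact: cont_itg.
have cd : cts (fun y => u y (t + e) - u y t) by cont.
pose X := itg A B (fun x => F 2%N x * (e^-1 * itg t (t + e) (u x))).
pose Y := 2 * mitg m A B (fun y => F 0%N y * (e^-1 * (u y (t + e) - u y t))).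
move=> EQ; have XY : X = Y.
  transitivity (e^-1 * itg A B (fun x => F 2%N x * itg t (t + e) (u x))).
    by rewrite -itgZ; [apply: eq_itg => x _; ring|cont].
  rewrite EQ mulrCA -mitgZ//; last by cont.
  by congr (_ * _); apply: eq_mitg => y _; ring.
have LX : `|X - L| <= w * itg A B (fun x => `|F 2%N x|).
  rewrite -itgB; [|by cont..]; rewrite -itgZ; last by cont.
  apply: le_trans (itg_abs _ _ _) _; first by cont.
  apply: itg_le; [by cont..|] => x xAB.
  rewrite [u x t * _]mulrC -mulrBr normrM [leLHS]mulrC; apply: ler_wpM2r => //.
  rewrite itg_prim// mulrC; apply: avg_close => // v tv.
  rewrite distrC; apply: mod => //; first by rewrite lexx.
  by rewrite ler_norml; apply/andP; split; lra.
have DY : `|Y - D| <= w * (2 * mitg m A B (fun y => K * `|F 0%N y|)).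
  rewrite -mulrBr -mitgB//; [|by cont..]; rewrite normrM ger0_norm// mulrCA.
  apply: ler_wpM2l => //; rewrite -mitgZ//; last by cont.
  apply: le_trans (mitg_abs _ _ _ _) _ => //; first by cont.
  apply: mitg_le => //; [by cont..|] => y yAB.
  rewrite -mulrBr normrM [leLHS]mulrC [w * _]mulrA; apply: ler_wpM2r => //.
  have := KP e y e01 yAB; rewrite /dif mulrC => /le_trans; apply.
  by rewrite [w * K]mulrC; apply: ler_wpM2l.
rewrite mulrDr; move: LX DY; rewrite XY; move: (w * _) (w * _) => a b.
by rewrite !ler_norml => /andP[? ?] /andP[? ?]; apply/andP; split; lra.
Qed.

Lemma jet_smooth (phi : R -> R) : smooth phi ->
  exists F, [/\ jet F, F 0%N = phi & F 2%N = derive1n 2 phi].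
Proof.
move=> sphi; exists (fun n => iter_derive phi (nseq n 1)); split.
- by move=> n t; have [_ /(_ t 1) d] := sphi (nseq n 1); split.
- by [].
apply/funext => t; rewrite /= derive1E; congr ('D_1 _ t).
by apply/funext => s; rewrite derive1E.
Qed.

Lemma compact_segment (K : set R) : compact K -> exists A B, K `<=` [set` `[A, B]].
Proof.
move=> /compact_bounded[M [_ MP]]; exists (- (`|M| + 1)), (`|M| + 1) => x Kx.
rewrite /= in_itv/= -ler_norml; apply: MP => //.
by rewrite ltr_pwDr// ler_norm.
Qed.

Lemma slice_measure t : 0 < t -> exists nu : signed_measure R R,
  [/\ locally_finite [set: R] (var_measure nu),
      forall phi : R -> R, test_function [set: R] phi ->
        \int[lebesgue_measure]_x (U (x, t) * derive1n 2 phi x) = signed_Rintegral nu phi &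
      var_measure nu `<< m].
Proof.
move=> t0; have cP := dudt_slice_cont t0.
have c2P : cts (fun y => 2 * P y t) by cont.
have mf : measurable_fun setT (fun y => 2 * P y t) by case: c2P; exact: continuous_measurable_fun.
have mid : measurable_fun setT (fun y : R => y) by exact: measurable_id.
exists (signed_density m mid mf); split.
- move=> x _; have [M M0 MP] := @bounded_rect R (fun y _ => 2 * P y t) (x - 1) (x + 1) 0 0 (cont_comp1 (@cont_fst R R) c2P).
  exists [set` `]x - 1, x + 1[].
    by split; [exact: interval_open|rewrite /= in_itv/=; apply/andP; split; lra].
  apply: (@var_density_lty _ _ _ _ _ m _ _ mid mf _ M) => //.
    move=> y; rewrite /= in_itv/= => /andP[/ltW y1 /ltW y2].
    by apply: (MP y 0); rewrite ?y1 ?y2 ?lexx.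
  rewrite preimage_id; apply: le_lt_trans (segment_finite m_locfin (x - 1) (x + 1)).
  apply: le_measure; rewrite ?inE//.
  by move=> y; rewrite /= !in_itv/= => /andP[/ltW -> /ltW ->].
- move=> phi [sphi [K [Kc _ K0]]].
  have [F [jF F0 F2]] := jet_smooth sphi; have [A [B KAB]] := compact_segment Kc.
  have F0s x : ~~ (A <= x <= B) -> F 0%N x = 0.
    by move=> nx; rewrite F0; apply: K0 => /KAB; rewrite /= in_itv/=; exact/negP.
  have cphi : cts phi by rewrite -F0; exact: jet_cont.
  have mphi : measurable_fun setT phi by case: cphi; exact: continuous_measurable_fun.
  have -> : \int[lebesgue_measure]_x (U (x, t) * derive1n 2 phi x) =
      itg A B (fun x => U (x, t) * F 2%N x).
    rewrite -F2; apply: Rintegral_supp => // x; rewrite /= in_itv/= => /negP nx.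
    by rewrite (jet_supp jF F0s) ?mulr0.
  have supp (k : R -> R) : \int[m]_x (phi x * k x) = mitg m A B (fun x => phi x * k x).
    apply: Rintegral_supp => // x; rewrite /= in_itv/= => /negP nx.
    by rewrite -F0 F0s ?mul0r.
  rewrite signed_Rintegral_density// (supp (fun x => Num.max (2 * P x t) 0)).
  rewrite (supp (fun x => Num.max (- (2 * P x t)) 0)).
  rewrite -mitgB//; [|by cont..].
  transitivity (itg A B (fun x => u x t * F 2%N x)).
    by apply: eq_itg => x _; rewrite extend_timeE// ltW.
  have cFP : cts (fun y => F 0%N y * P y t) by rewrite F0; cont.
  rewrite (dudt_slice jF F0s t0) -mitgZ//.
  by apply: eq_mitg => y _; rewrite F0 -mulrBr max0_split; ring.
- apply/null_content_dominatesP => A mA A0.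
  have A0' : m ((fun y : R => y) @^-1` A `&` setT) = 0%E by rewrite setIT preimage_id.
  by apply: (var_density_eq0 mid mf mA measurableT _ A0') => x _ /(_ Logic.I).
Qed.

End AbsoluteContinuity.

(** * The measure on space-time *)

Lemma open_open_upper {R : realType} : open (@open_upper R).
Proof.
rewrite open_upperE; apply: (@open_comp _ _ (fun p : R * R => p.2) [set t | 0 < t]).
  by move=> p _; exact: cvg_snd.
exact: open_gt.
Qed.

Lemma compact_upper {R : realType} (K : set (R * R)) : compact K -> K `<=` @open_upper R ->
  exists A B c e, 0 < c /\ forall p, K p -> (A <= p.1 <= B) && (c <= p.2 <= e).
Proof.
move=> Kc Ku.
have cf : continuous (fun p : R * R => p.1) by move=> p; exact: cvg_fst.
have cs : continuous (fun p : R * R => p.2) by move=> p; exact: cvg_snd.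
have [A [B KAB]] := compact_segment (continuous_compact (continuous_subspaceT cf) Kc).
have [c' [e Kce]] := compact_segment (continuous_compact (continuous_subspaceT cs) Kc).
have [c c0 cP] : exists2 c, 0 < c & forall p, K p -> c <= p.2.
  have [->|/set0P K0] := eqVneq K set0; first by exists 1.
  have [p pK pP] := compact_EVT_min K0 Kc (continuous_subspaceT cs).
  exists p.2; last by move=> q Kq; apply: pP; rewrite inE.
  by have := Ku p (set_mem pK); rewrite open_upperE.
exists A, B, c, e; split => // p Kp.
have := KAB p.1 (ex_intro2 _ _ p Kp erefl); rewrite /= in_itv/= => ->/=.
have := Kce p.2 (ex_intro2 _ _ p Kp erefl); rewrite /= in_itv/= => /andP[_ ->].
by rewrite cP.
Qed.

Lemma is_derive_ddt {R : realType} (phi : R * R -> R) (y s : R) : smooth phi ->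
  is_derive s 1 (fun s => phi (y, s)) (ddt phi (y, s)).
Proof.
move=> sphi; have [_ /(_ (y, s) (0, 1)) d] := sphi [::].
have E : (fun h : R => h^-1 *: (phi (y, h *: 1 + s) - phi (y, s))) =
    (fun h : R => h^-1 *: (phi (h *: (0, 1) + (y, s)) - phi (y, s))).
  apply/funext => h; congr (_ *: (phi _ - _)).
  by congr (_, _); rewrite /= scaler0 add0r.
split; first by rewrite /derivable/= E.
by rewrite /ddt /derive E.
Qed.

Section SpaceTime.
Context {R : realType} (m : {measure set R -> \bar R}) (U : R * R -> R).
Hypothesis m_locfin : locally_finite [set: R] m.
Hypothesis m_unbounded : forall b : R, 0 < b ->
  (msupp m `&` `]-oo, - b] !=set0) /\ (msupp m `&` `[b, +oo[ !=set0).
Hypothesis U_cont : {within @closed_upper R, continuous U}.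
Hypothesis U_eq : distributional_solution m U.

Local Notation u := (extend_time U).
Local Notation P := (dudt u).
Let u_cont := extend_time_cont U_cont.
Let u_eqn := hat_equation m_locfin U_cont U_eq.

(** The weak equation followed by integration by parts in time for each fixed [y]. The test function
    vanishes before time [2 * c] and after [e], so it vanishes near both ends of [[c, e + 1]], and
    freezing the time derivative below [c] does not change the integral. *)
Lemma space_time_identity phi A B c e : test_function (@open_upper R) phi -> 0 < c ->
  (forall p : R * R, ~~ ((A <= p.1 <= B) && (2 * c <= p.2 <= e)) -> phi p = 0) ->
  \int[(lebesgue_measure \x lebesgue_measure)%E]_(p in @open_upper R) (U p * ddx (ddx phi) p) =
  2 * mitg m A B (fun y => itg c (e + 1) (fun s => phi (y, s) * P y (Num.max s c))).
Proof.
move=> tphi c0 phi0; have [sphi _] := tphi.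
have cP := dudt_max_cont m_locfin m_unbounded U_cont U_eq c0.
have cphi : cts (fun p : R * R => phi (p.1, p.2)).
  rewrite (_ : (fun p => _) = phi); last by apply/funext => -[].
  by split; have [] := sphi [::].
have cdphi : cts (fun p : R * R => ddt phi (p.1, p.2)).
  rewrite (_ : (fun p => _) = ddt phi); last by apply/funext => -[].
  by split; have [] := sphi [:: (0, 1)].
have near0 y s : ~~ ((A <= y <= B) && (2 * c <= s <= e)) -> \forall z \near s, phi (y, z) = 0.
  rewrite negb_and => /orP[ny|].
    by near=> z; apply: phi0; rewrite negb_and ny.
  rewrite negb_and -!ltNge => /orP[sc|es]; near=> z; apply: phi0; rewrite !negb_and -!ltNge /=.
    by have -> : z < 2 * c by [near: z; exact: lt_nbhsl]; rewrite orbT.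
  by have -> : e < z by [near: z; exact: lt_nbhsr]; rewrite !orbT.
have dphi0 y s : ~~ ((A <= y <= B) && (2 * c <= s <= e)) -> ddt phi (y, s) = 0.
  move=> ns; have D0 : is_derive s 1 (fun s => phi (y, s)) 0.
    apply: near_eq_is_derive (is_derive_cst 0 s (1 : R)).
    by apply: filterS (near0 y s ns) => z ->.
  by have [_ <-] := is_derive_ddt y s sphi; have [_ ->] := D0.
rewrite -U_eq//.
pose G y s := u y s * ddt phi (y, s).
have cG : cts (fun p => G p.1 p.2) by have cu := u_cont; rewrite /G; cont.
have -> : \int[(m \x lebesgue_measure)%E]_(p in @open_upper R) (U p * ddt phi p) =
    \int[(m \x lebesgue_measure)%E]_(p in @open_upper R) G p.1 p.2.
  apply: eq_Rintegral => -[y s]; rewrite inE open_upperE /= => s0.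
  by rewrite /G extend_timeE// ltW.
rewrite (@fubini_m R m m_locfin G A B c (e + 1) cG c0); last first.
  move=> y s ns; rewrite /G dphi0 ?mulr0//; apply: contraNN ns => /andP[-> /andP[? ?]] /=.
  by apply/andP; split; lra.
have cQ : cts (fun p : R * R => phi (p.1, p.2) * P p.1 (Num.max p.2 c)) by exact: contM.
have cQ' : cts (fun y => itg c (e + 1) (fun s => phi (y, s) * P y (Num.max s c))).
  exact: (@cont_itg R (fun y s => phi (y, s) * P y (Num.max s c))).
have cGi : cts (fun y => itg c (e + 1) (G y)) by exact: cont_itg.
suff -> : mitg m A B (fun y => itg c (e + 1) (G y)) =
    - mitg m A B (fun y => itg c (e + 1) (fun s => phi (y, s) * P y (Num.max s c))).
  by rewrite mulrNN.
rewrite -[RHS]mulN1r -mitgZ//; apply: eq_mitg => y yAB; rewrite mulN1r.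
have [ec|ce] := leP (e + 1) c; first by rewrite !itg_empty ?oppr0.
have cGy : cts (G y) by cont.
have cQy : cts (fun s => phi (y, s) * P y (Num.max s c)).
  by apply: (@cont_comp2 R _ (fun=> y) id (fun y s => phi (y, s) * P y (Num.max s c))) => //;
    [exact: cont_cst|exact: cont_id].
apply/eqP; rewrite -subr_eq0 opprK -itgD//; apply/eqP.
have phic : phi (y, c) = 0 by apply: phi0; apply/negP => /andP[_ /= /andP[? _]]; lra.
have phie : phi (y, e + 1) = 0.
  by apply: phi0; apply/negP => /andP[_ /= /andP[_ ?]]; lra.
have D (s : R) : is_derive s 1 (fun s => u y s * phi (y, s)) (G y s + phi (y, s) * P y (Num.max s c)).
  have dphi := is_derive_ddt y s sphi; have [cs|sc] := ltP c s.
    have du := dudt_is_derive m_locfin m_unbounded u_cont u_eqn y (lt_trans c0 cs).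
    have := is_deriveM du dphi.
    by rewrite (_ : _ *: _ + _ *: _ = G y s + phi (y, s) * P y s)// /G /GRing.scale/=; ring.
  have ns : ~~ ((A <= y <= B) && (2 * c <= s <= e)).
    by apply/negP => /andP[_ /andP[? _]]; lra.
  rewrite /G dphi0// phi0//= mul0r mulr0 addr0.
  apply: near_eq_is_derive (is_derive_cst 0 s (1 : R)).
  by apply: filterS (near0 y s ns) => z /= ->; rewrite mulr0.
have cD : cts (fun s => G y s + phi (y, s) * P y (Num.max s c)) by exact: contD.
by rewrite (itg_FTC D cD (ltW ce)) phic phie !mulr0 subrr.
Unshelve. all: by end_near. Qed.

End SpaceTime.

Section SpaceTimeMeasure.
Context {R : realType} (m : {measure set R -> \bar R}) (U : R * R -> R).
Hypothesis m_locfin : locally_finite [set: R] m.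
Hypothesis m_unbounded : forall b : R, 0 < b ->
  (msupp m `&` `]-oo, - b] !=set0) /\ (msupp m `&` `[b, +oo[ !=set0).
Hypothesis U_cont : {within @closed_upper R, continuous U}.
Hypothesis U_eq : distributional_solution m U.

Local Notation u := (extend_time U).
Local Notation P := (dudt u).

(* The Borel structure that the library attaches to R and the one on which it
   defines the Lebesgue measure are different instances. *)
Definition borel_cast (p : R * measurableTypeR R) : R * R := (p.1, p.2).

Lemma measurable_borel_cast : measurable_fun setT borel_cast.
Proof.
have mid : measurable_fun setT (fun t : measurableTypeR R => (t : R)).
  by move=> _ Y mY; rewrite setTI.
apply: measurable_fun_pair; first exact: measurable_fst.
exact: measurableT_comp mid measurable_snd.
Qed.

(** The value 0 at times that are not positive, where [dudt] has no meaning, makes the density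
    measurable on the plane and the resulting measure carried by [open_upper]. *)
Definition space_time_density : R * R -> R := (fun p => 2 * P p.1 p.2) \_ (@open_upper R).
Local Notation f := space_time_density.

Lemma space_time_densityE p : 0 < p.2 -> f p = 2 * P p.1 p.2.
Proof. by move=> p0; rewrite /f patchE mem_set// open_upperE. Qed.

Lemma space_time_density0 p : ~ (0 < p.2) -> f p = 0.
Proof. by move=> p0; rewrite /f patchE memNset// open_upperE. Qed.

Lemma measurable_space_time_density : measurable_fun setT f.
Proof.
have mO : measurable (@open_upper R) by apply: open_measurable_prod; exact: open_open_upper.
apply: (proj1 (measurable_restrictT _ mO)).
apply: measurable_fun_open; first exact: open_open_upper.
move=> [x t]; rewrite open_upperE /= => t0; apply: cvgM; first exact: cvg_cst.
exact: (dudt_cont m_locfin m_unbounded (extend_time_cont U_cont) (hat_equation m_locfin U_cont U_eq)).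
Qed.

Let mu : {measure set (R * measurableTypeR R) -> \bar R} := (m \x @lebesgue_measure R)%E.

Lemma rectangle_finite a b c e :
  (mu ([set` `]a, b[] `*` [set` `]c, e[]) < +oo)%E.
Proof.
apply: (@le_lt_trans _ _ (m [set` `]a, b[] * lebesgue_measure [set` `]c, e[])%E).
  rewrite le_eqVlt; apply/orP; left; apply/eqP.
  by apply: product_measure1E; exact: measurable_itv.
apply: lte_mul_pinfty => //; last first.
  by rewrite lebesgue_measure_itv/=; case: ifP; rewrite ?ltry// -EFinB ltry.
rewrite ge0_fin_numE//; apply: le_lt_trans (segment_finite m_locfin a b).
apply: le_measure; rewrite ?inE//.
by move=> y; rewrite /= !in_itv/= => /andP[/ltW -> /ltW ->].
Qed.

Lemma space_time_measure : exists nu : signed_measure (R * R)%type R,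
  [/\ locally_finite (@open_upper R) (var_measure nu),
      var_measure nu (~` @open_upper R) = 0%E,
      forall phi : R * R -> R, test_function (@open_upper R) phi ->
        \int[(lebesgue_measure \x lebesgue_measure)%E]_(p in @open_upper R)
          (U p * ddx (ddx phi) p) = signed_Rintegral nu phi &
      var_measure nu `<< (m \x @lebesgue_pos R)%E].
Proof.
have mh := measurable_borel_cast; have mf := measurable_space_time_density.
have mO : measurable (@open_upper R) by apply: open_measurable_prod; exact: open_open_upper.
have mO' : measurable ([set p | 0 < p.2] : set (R * measurableTypeR R)).
  rewrite (_ : [set p | _] = setT `*` [set` `]0 : R, +oo[]).
    by apply: measurableX => //; exact: measurable_itv.
  by apply/seteqP; split => -[y s] /=; rewrite in_itv/= andbT// => -[].
exists (signed_density mu mh mf); split.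
- move=> [x t]; rewrite open_upperE /= => t0; have c0 : 0 < t / 2 by rewrite divr_gt0.
  have cP := dudt_max_cont m_locfin m_unbounded U_cont U_eq c0.
  have c2P : cts (fun p : R * R => 2 * P p.1 (Num.max p.2 (t / 2))) by exact: contM (cont_cst _) _.
  have [M M0 MP] := @bounded_rect R (fun y s => 2 * P y (Num.max s (t / 2))) (x - 1) (x + 1) (t / 2) (t + 1) c2P.
  pose A : set (R * R) := [set` `]x - 1, x + 1[] `*` [set` `]t / 2, t + 1[].
  have oA : open A.
    rewrite (_ : A = fst @^-1` [set` `]x - 1, x + 1[] `&` snd @^-1` [set` `]t / 2, t + 1[])//.
    apply: openI; apply: open_comp; try exact: interval_open.
      by move=> p _; exact: cvg_fst.
    by move=> p _; exact: cvg_snd.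
  exists A.
    split => //; split; rewrite /= in_itv/=; apply/andP; split; lra.
  apply: (@var_density_lty _ _ _ _ _ mu _ _ mh mf _ M).
  + exact: open_measurable_prod.
  + move=> [y s] [/=]; rewrite !in_itv/= => /andP[/ltW y1 /ltW y2] /andP[s1 s2].
    have s0 := lt_trans c0 s1.
    rewrite space_time_densityE//= -{1}(max_l (ltW s1)); apply: MP; first by rewrite y1.
    by rewrite (ltW s1) (ltW s2).
  + exact: rectangle_finite.
- have A0 : mu (borel_cast @^-1` (~` @open_upper R) `&` set0) = 0%E by rewrite setI0 measure0.
  apply: (var_density_eq0 mh mf (measurableC mO) measurable0 _ A0) => p np _.
  by apply: space_time_density0 => p0; apply: np; rewrite open_upperE.
- move=> phi tphi; have [sphi [K [Kc KU K0]]] := tphi.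
  have [A [B [c' [e [c'0 KP]]]]] := compact_upper Kc KU.
  (* Half the earliest time of the support, as [space_time_identity] asks for support after
     [2 * c]. *)
  pose c := c' / 2; have c0 : 0 < c by rewrite divr_gt0.
  have phi0 (p : R * R) : ~~ ((A <= p.1 <= B) && (2 * c <= p.2 <= e)) -> phi p = 0.
    move=> np; apply: K0 => /KP; apply/negP; apply: contraNN np.
    by rewrite /c mulrC divfK.
  rewrite (space_time_identity m_locfin m_unbounded U_cont U_eq tphi c0 phi0).
  have cphi : cts (fun p : R * R => phi (p.1, p.2)).
    rewrite (_ : (fun p => _) = phi); last by apply/funext => -[].
    by split; have [] := sphi [::].
  have mphi : measurable_fun setT phi.
    by apply: cts_measurable; split; have [] := sphi [::].
  rewrite signed_Rintegral_density//.
  have cP := dudt_max_cont m_locfin m_unbounded U_cont U_eq c0.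
  pose G (k : R) y s := phi (y, s) * Num.max (k * (2 * P y (Num.max s c))) 0.
  have cG k : cts (fun p => G k p.1 p.2).
    by apply: contM => //; apply: contmax; [apply: contM; [|apply: contM]|] => //; exact: cont_cst.
  have G0 k y s : ~~ ((A <= y <= B) && (c <= s <= e + 1)) -> G k y s = 0.
    move=> ns; rewrite /G phi0 ?mul0r//; apply: contraNN ns => /andP[-> /= /andP[? ?]].
    by apply/andP; split; lra.
  have fub k : \int[mu]_p (phi (borel_cast p) * Num.max (k * f (borel_cast p)) 0) =
      mitg m A B (fun y => itg c (e + 1) (G k y)).
    rewrite -(@fubini_m R m m_locfin (G k) A B c (e + 1) (cG k) c0 (G0 k)).
    rewrite (@Rintegral_supp _ _ _ mu setT (@open_upper R))//; last first.
      move=> [y s] /= ny; rewrite phi0 ?mul0r//; apply/negP => /andP[_ /andP[/= cs _]].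
      by apply: ny; rewrite open_upperE /=; lra.
    apply: eq_Rintegral => -[y s]; rewrite inE open_upperE /= => s0.
    rewrite /G /borel_cast /= space_time_densityE//=.
    have [cs|sc] := leP c s; first by [].
    rewrite phi0 ?mul0r//; apply/negP => /andP[_ /andP[/= cs _]]; lra.
  have -> : \int[mu]_p (phi (borel_cast p) * Num.max (f (borel_cast p)) 0) =
      mitg m A B (fun y => itg c (e + 1) (G 1 y)).
    by rewrite -fub; apply: eq_Rintegral => p _; rewrite mul1r.
  have -> : \int[mu]_p (phi (borel_cast p) * Num.max (- f (borel_cast p)) 0) =
      mitg m A B (fun y => itg c (e + 1) (G (-1) y)).
    by rewrite -fub; apply: eq_Rintegral => p _; rewrite mulN1r.
  have ci k : cts (fun y => itg c (e + 1) (G k y)) by exact: cont_itg.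
  rewrite -mitgB// -mitgZ//; last by apply: (@cont_itg R (fun y s => phi (y, s) * P y (Num.max s c))); exact: contM.
  apply: eq_mitg => y _.
  have cGy k : cts (G k y) by have := cG k; move=> cGk; cont.
  have cQy : cts (fun s => phi (y, s) * P y (Num.max s c)).
    have cQ : cts (fun p : R * R => phi (p.1, p.2) * P p.1 (Num.max p.2 c)) by exact: contM.
    apply: (@cont_comp2 R _ (fun=> y) id (fun y s => phi (y, s) * P y (Num.max s c))) => //;
      [exact: cont_cst|exact: cont_id].
  rewrite -itgB// -itgZ//; apply: eq_itg => s _.
  by rewrite /G mul1r mulN1r -mulrBr max0_split; ring.
- move=> A' nA' A mA AA'; have A0 := nA' A mA AA'.
  (* [lebesgue_pos] measures only the positive times of each section of [A], so both product
     measures integrate the same function over [m]. *)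
  have A0' : mu (borel_cast @^-1` A `&` [set p | 0 < p.2]) = 0%E.
    rewrite -[RHS]A0; apply: eq_integral => x _ /=; rewrite /lebesgue_pos /mrestr.
    congr (lebesgue_measure _); apply/seteqP; split => t /=.
      by move=> /xsectionP[/= At t0]; split; [exact/xsectionP|rewrite /= in_itv/= andbT].
    by move=> [/xsectionP At]; rewrite in_itv/= andbT => t0; apply/xsectionP; split.
  apply: (var_density_eq0 mh mf mA mO' _ A0') => p _ np.
  exact: space_time_density0.
Qed.

End SpaceTimeMeasure.

Theorem corollary8p2 (R : realType) (m : {measure set R -> \bar R})
    (m_locfin : locally_finite [set: R] m)
    (m_unbounded : forall b : R, 0 < b ->
       (msupp m `&` `]-oo, - b] !=set0) /\ (msupp m `&` `[b, +oo[ !=set0))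
    (g : R -> R) (g_cont : continuous g)
    (g_littleo : littleo_infty g (Psi m))
    (gbar : R -> R) (gbarP : affine_interpolation m g gbar)
    (U : R * R -> R)
    (U_cont : {within @closed_upper R, continuous U})
    (U_littleo : littleo_locally_uniformly U (Psi m))
    (U_eq : distributional_solution m U)
    (U_init : forall x : R, U (x, 0) = gbar x) :
  (exists nu : signed_measure (R * R)%type R,
     [/\ locally_finite (@open_upper R) (var_measure nu),
         var_measure nu (~` @open_upper R) = 0%E,
         forall phi : R * R -> R, test_function (@open_upper R) phi ->
           \int[(lebesgue_measure \x lebesgue_measure)%E]_(p in @open_upper R)
             (U p * ddx (ddx phi) p) = signed_Rintegral nu phi &
         var_measure nu `<< (m \x @lebesgue_pos R)%E]) /\
  (forall t : R, 0 < t ->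
     exists nu : signed_measure R R,
       [/\ locally_finite [set: R] (var_measure nu),
           forall phi : R -> R, test_function [set: R] phi ->
             \int[lebesgue_measure]_x (U (x, t) * derive1n 2 phi x) =
             signed_Rintegral nu phi &
           var_measure nu `<< m]).
Proof.
split; first exact: space_time_measure.
by move=> t; exact: slice_measure.
Qed.
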